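(* Let $m\ge1$ and let $\Omega=B_R(0)\subset\mathbb R^N$ ($N\ge1$) for some $R>0$, with $R>N$ if $m=1$. Let $f\in L^\infty(\Omega)$ be nonnegative and, for each $G>0$, let $g_G\in L^\infty(\partial\Omega)$ be such that $g_G\ge G$. Then the solutions $u_G$ (in the sense defined in the context) of $$u-f=\operatorname{div}\Big(u^m\frac{\nabla u}{|\nabla u|}\Big)\ \text{ in }\Omega,\qquad u=g_G\ \text{ on }\partial\Omega,$$ with data $f$ and $g_G$ are such that $$u_G(x)\to+\infty\quad\text{for all }x\in B_R(0)\text{ as }G\to+\infty .$$
   Context: $\nu$ is the outward unit normal to $\partial\Omega$. $X(\Omega)=\{\mathbf z\in L^\infty(\Omega;\mathbb R^N):\operatorname{div}\mathbf z\in L^\infty(\Omega)\}$. For $\mathbf z\in X(\Omega)$, $[\mathbf z,\nu]\in L^\infty(\partial\Omega)$ is the (Anzellotti) weak normal trace, characterized by $\int_\Omega\varphi\operatorname{div}\mathbf z\,dx+\int_\Omega\mathbf z\cdot\nabla\varphi\,dx=\int_{\partial\Omega}\varphi[\mathbf z,\nu]\,d\mathcal H^{N-1}$ for $\varphi\in C^1(\overline\Omega)$. For $\mathbf z\in X(\Omega)$ and $v\in BV(\Omega)\cap L^\infty(\Omega)$, the pairing $(\mathbf z,Dv)$ is the Radon measure on $\Omega$ defined by $\langle(\mathbf z,Dv),\varphi\rangle=-\int_\Omega v\varphi\operatorname{div}\mathbf z\,dx-\int_\Omega v\,\mathbf z\cdot\nabla\varphi\,dx$ for $\varphi\in C_0^\infty(\Omega)$.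 $T_a^b(s)=\max(\min(b,s),a)$, $T_a^\infty(s)=\max(s,a)$, $\mathcal T=\{T_a^b:0<a<b<+\infty\}$; $\phi(s)=\frac{s^{m+1}}{m+1}$. $TBV^+(\Omega)=\{u\in L^1(\Omega;[0,+\infty)):T_a^\infty(u)\in BV(\Omega)\ \forall a>0\}$; the trace of $u\in TBV^+(\Omega)$ on $\partial\Omega$ (still denoted $u$) is the $\mathcal H^{N-1}$-a.e. limit as $a\to0^+$ of the $BV$ traces of $T_a^\infty(u)$. Definition of solution ($m>0$, data $0\le f\in L^\infty(\Omega)$, $0\le g\in L^\infty(\partial\Omega)$). A function $u:\Omega\to[0,+\infty)$ is a solution with data $(f,g)$ if $u\in TBV^+(\Omega)\cap L^\infty(\Omega)$ and there exists $\mathbf w\in L^\infty(\Omega;\mathbb R^N)$ with $\|\mathbf w\|_\infty\le1$ such that $\mathbf z:=u^m\mathbf w\in X(\Omega)$ satisfies: (1) $|D\phi(T(u))|\le(\mathbf z,DT(u))$ as measures for every $T\in\mathcal T$; (2) $u-f=\operatorname{div}\mathbf z$ in $\mathcal D'(\Omega)$; (3) $u\ge g$ $\mathcal H^{N-1}$-a.e. on $\partial\Omega$; (4) $[\mathbf z,\nu]=-u^m$ $\mathcal H^{N-1}$-a.e. on $\partial\Omega\cap\{u>g\}$. Such a solution exists and is unique (as an a.e. equivalence class). Pointwise values $u_G(x)$ are those of the lower approximate limit $u_G^\wedge(x)=\sup\{t:\lim_{\rho\downarrow0}\rho^{-N}|\{u_G<t\}\cap B_\rho(x)|=0\}$. 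*)

(* Defs.v *)
From HB Require Import structures.
From mathcomp Require Export all_boot all_order all_algebra.
From mathcomp Require Export all_classical all_reals all_analysis.
Export Order.TTheory GRing.Theory Num.Theory.
Export numFieldNormedType.Exports.

Set Implicit Arguments.
Unset Strict Implicit.
Unset Printing Implicit Defensive.

Local Open Scope classical_set_scope.
Local Open Scope ring_scope.

Section euclidean.
Context {R : realType} {N : nat}.
Implicit Types (x y : 'rV[R]_N).

Definition dotp x y : R := \sum_(i < N) x 0 i * y 0 i.

(* The library norm on 'rV[R]_N is the sup norm, hence this definition. It
   induces the same topology. *)
Definition enorm x : R := Num.sqrt (dotp x x).

Definition eball x (r : R) : set 'rV[R]_N := [set y | enorm (y - x) < r].

Definition ediam (A : set 'rV[R]_N) : \bar R :=
  ereal_sup [set (enorm (p.1 - p.2))%:E | p in A `*` A].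

Definition boundary (A : set 'rV[R]_N) : set 'rV[R]_N := closure A `\` A°.

End euclidean.

Section covering_outer_measure.
Context {R : realType} {T : pointedType}.
Local Open Scope ereal_scope.

Definition cover_outer (zeta : set T -> \bar R) (X : set T) : \bar R :=
  ereal_inf [set \sum_(k <oo) zeta (A k) |
             A in [set A : (set T)^nat | X `<=` \bigcup_k A k]].

Let discr := [the measurableType _ of g_sigma_algebraType [set: set T]].

Variable zeta : set T -> \bar R.
Hypotheses (zeta0 : zeta set0 = 0) (zeta_ge0 : forall A, 0 <= zeta A).

Let cover_outerE :
  cover_outer zeta = @mu_ext _ discr R zeta.
Proof.
apply/funext => X; congr ereal_inf; apply/seteqP; split.
- by move=> _ [A XA <-]; exists A => //; split=> // i; exact: sub_sigma_algebra.
- by move=> _ [A [_ XA] <-]; exists A.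
Qed.

Lemma cover_outer0 : cover_outer zeta set0 = 0.
Proof. by rewrite cover_outerE; exact: (@mu_ext0 _ discr). Qed.

Lemma cover_outer_ge0 X : 0 <= cover_outer zeta X.
Proof. by rewrite cover_outerE; exact: (@mu_ext_ge0 _ discr). Qed.

Lemma le_cover_outer : {homo cover_outer zeta : A B / A `<=` B >-> A <= B}.
Proof. by rewrite cover_outerE; exact: (@le_mu_ext _ discr). Qed.

Lemma cover_outer_sigma_subadditive : sigma_subadditive (cover_outer zeta).
Proof. by rewrite cover_outerE; exact: (@mu_ext_sigma_subadditive _ discr). Qed.

End covering_outer_measure.

Section lebesgue.
Context {R : realType} {N : nat}.
Local Open Scope ereal_scope.

Definition box (a b : 'rV[R]_N) : set 'rV[R]_N :=
  [set x | forall i, (a 0 i <= x 0 i <= b 0 i)%R].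

(* +oo on the sets that are not boxes, which excludes them from coverings; the
   empty set is treated apart because box a b is never empty when N = 0. *)
Definition box_volume (A : set 'rV[R]_N) : \bar R :=
  if A == set0 then 0 else
  ereal_inf [set (\prod_(i < N) (p.2 0 i - p.1 0 i))%:E |
             p in [set p : 'rV[R]_N * 'rV[R]_N | A = box p.1 p.2]].

Definition lebN_outer : set 'rV[R]_N -> \bar R := cover_outer box_volume.

Lemma box_volume0 : box_volume set0 = 0.
Proof. by rewrite /box_volume eqxx. Qed.

Lemma box_volume_ge0 A : 0 <= box_volume A.
Proof.
rewrite /box_volume; case: ifPn => // A0.
apply: le_ereal_inf_tmp => _ [[a b] /= AE <-].
rewrite lee_fin prodr_ge0// => i _.
have /set0P[x] := A0; rewrite AE => /(_ i)/andP[ax xb].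
by rewrite subr_ge0 (le_trans ax).
Qed.

HB.instance Definition _ := isOuterMeasure.Build R 'rV[R]_N lebN_outer
  (cover_outer0 box_volume0 box_volume_ge0)
  (cover_outer_ge0 box_volume_ge0)
  (@le_cover_outer _ _ box_volume)
  (cover_outer_sigma_subadditive box_volume_ge0).

End lebesgue.

Definition lebN_om (R : realType) (N : nat) :
  {outer_measure set 'rV[R]_N -> \bar R} := @lebN_outer R N.

(* The measurable sets of this type are the Lebesgue measurable subsets. *)
Notation lebT R N := (caratheodory_type (lebN_om R N)).

Definition lebN (R : realType) (N : nat) :
  {measure set (lebT R N) -> \bar R} := lebN_om R N.
Arguments lebN : clear implicits.

Section hausdorff.
Context {R : realType} {N : nat}.
Variable s : nat.
Local Open Scope ereal_scope.

Definition unit_ball_volume : R := fine (lebN R s (eball 0 1)).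

(* The constant makes the s-dimensional measure agree with surface area. *)
Definition hausdorff_gauge (delta : R) (A : set 'rV[R]_N) : \bar R :=
  if A == set0 then 0 else
  if ediam A <= delta%:E
  then (unit_ball_volume * (fine (ediam A) / 2) ^+ s)%:E
  else +oo.

Definition hausdorff_outer (X : set 'rV[R]_N) : \bar R :=
  ereal_sup [set cover_outer (hausdorff_gauge delta) X |
             delta in [set delta : R | (0 < delta)%R]].

Lemma hausdorff_gauge0 delta : hausdorff_gauge delta set0 = 0.
Proof. by rewrite /hausdorff_gauge eqxx. Qed.

Lemma hausdorff_gauge_ge0 delta A : 0 <= hausdorff_gauge delta A.
Proof.
rewrite /hausdorff_gauge; case: ifPn => // /set0P[x Ax]; case: ifPn => // _.
rewrite lee_fin mulr_ge0//; first exact/fine_ge0/measure_ge0.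
rewrite exprn_ge0// divr_ge0// fine_ge0//.
apply: ereal_sup_ubound; exists (x, x) => //=.
by rewrite subrr /enorm /dotp big1 ?sqrtr0// => i _; rewrite mxE mul0r.
Qed.

Let hausdorff_outer0 : hausdorff_outer set0 = 0.
Proof.
apply/eqP; rewrite eq_le; apply/andP; split.
  apply: ge_ereal_sup => _ [e e0 <-].
  by rewrite cover_outer0//; [exact: hausdorff_gauge0|exact: hausdorff_gauge_ge0].
apply: ereal_sup_ubound; exists 1%R => //=.
by rewrite cover_outer0//; [exact: hausdorff_gauge0|exact: hausdorff_gauge_ge0].
Qed.

Let hausdorff_outer_ge0 X : 0 <= hausdorff_outer X.
Proof.
apply: (@le_trans _ _ (cover_outer (hausdorff_gauge 1) X)).
  exact: (cover_outer_ge0 (hausdorff_gauge_ge0 _)).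
by apply: ereal_sup_ubound; exists 1%R => //=.
Qed.

Let le_hausdorff_outer : {homo hausdorff_outer : A B / A `<=` B >-> A <= B}.
Proof.
move=> A B AB; apply: ge_ereal_sup => _ [e e0 <-].
apply: (le_trans (le_cover_outer _ AB)).
by apply: ereal_sup_ubound; exists e.
Qed.

Let hausdorff_outer_sigma_subadditive : sigma_subadditive hausdorff_outer.
Proof.
move=> F; apply: ge_ereal_sup => _ [e e0 <-].
apply: (le_trans (cover_outer_sigma_subadditive (hausdorff_gauge_ge0 e) F)).
apply: lee_nneseries => [k *|k _].
  exact: (cover_outer_ge0 (hausdorff_gauge_ge0 _)).
by apply: ereal_sup_ubound; exists e.
Qed.

HB.instance Definition _ := isOuterMeasure.Build R 'rV[R]_N hausdorff_outer
  hausdorff_outer0 hausdorff_outer_ge0 le_hausdorff_outer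
  hausdorff_outer_sigma_subadditive.

End hausdorff.

Definition hausdorff_om (R : realType) (N s : nat) :
  {outer_measure set 'rV[R]_N -> \bar R} := @hausdorff_outer R N s.

Notation hausT R N s := (caratheodory_type (hausdorff_om R N s)).

Definition hausdorff (R : realType) (N s : nat) :
  {measure set (hausT R N s) -> \bar R} := hausdorff_om R N s.
Arguments hausdorff : clear implicits.

Section function_classes.
Context {R : realType} {N : nat}.
Implicit Types (Omega : set 'rV[R]_N) (phi : 'rV[R]_N -> R).

Definition partial (i : 'I_N) phi : 'rV[R]_N -> R :=
  fun x => 'D_(delta_mx 0 i) phi x.

Definition grad phi (x : 'rV[R]_N) : 'rV[R]_N := \row_i partial i phi x.

Fixpoint isC (k : nat) phi : Prop :=
  continuous phi /\
  if k is k'.+1 then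
    forall i, (forall x, derivable phi x (delta_mx 0 i)) /\ isC k' (partial i phi)
  else True.

Definition test_function Omega phi : Prop :=
  (forall k, isC k phi) /\
  exists K, [/\ compact K, K `<=` Omega & forall x, ~ K x -> phi x = 0].

Definition Linfty d (T : measurableType d) (mu : {measure set T -> \bar R})
    (D : set T) (f : T -> R) : Prop :=
  measurable_fun D f /\ exists M : R, {ae mu, forall x, D x -> `|f x| <= M}.

Definition Linfty_vec Omega (z : 'rV[R]_N -> 'rV[R]_N) : Prop :=
  forall i, Linfty (lebN R N) Omega (fun x => z x 0 i).

Definition is_div Omega (z : 'rV[R]_N -> 'rV[R]_N) (d : 'rV[R]_N -> R) : Prop :=
  forall phi, test_function Omega phi ->
  (\int[lebN R N]_(x in Omega) dotp (z x) (grad phi x)) =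
  - (\int[lebN R N]_(x in Omega) (d x * phi x)).

(* z is in X(Omega), with divergence d (unique almost everywhere). *)
Definition in_X Omega (z : 'rV[R]_N -> 'rV[R]_N) (d : 'rV[R]_N -> R) : Prop :=
  [/\ Linfty_vec Omega z, Linfty (lebN R N) Omega d & is_div Omega z d].

(* C^1 functions on the closure of Omega are taken to be the restrictions of
   C^1 functions on the whole space. *)
Definition is_normal_trace Omega (z : 'rV[R]_N -> 'rV[R]_N)
    (d zn : 'rV[R]_N -> R) : Prop :=
  Linfty (hausdorff R N N.-1) (boundary Omega) zn /\
  forall phi, isC 1 phi ->
  (\int[lebN R N]_(x in Omega) (phi x * d x)) +
  (\int[lebN R N]_(x in Omega) dotp (z x) (grad phi x)) =
  (\int[hausdorff R N N.-1]_(x in boundary Omega) (phi x * zn x)).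

End function_classes.

(* Finite signed Borel measures on R^N. A finite Radon measure on Omega is given
   by such a charge, of which only the values on Borel subsets of Omega matter. *)
Notation borelT R N := (g_sigma_algebraType (@open 'rV[R]_N)).
Notation signed_borel R N := (@Charge.type _ (borelT R N) R).

Section signed_measures.
Context {R : realType} {N : nat}.

Definition charge_integral (nu : signed_borel R N) (D : set 'rV[R]_N)
    (phi : 'rV[R]_N -> R) : R :=
  let P := cid (Hahn_decomposition nu) in
  let Q := cid (projT2 P) in
  (\int[jordan_pos (projT2 Q)]_(x in D) phi x) -
  (\int[jordan_neg (projT2 Q)]_(x in D) phi x).

Definition total_variation (nu : 'I_N -> signed_borel R N)
    (B : set (borelT R N)) : \bar R :=
  ereal_sup [set (\sum_(k <oo) (enorm (\row_i fine (nu i (F k))))%:E)%E |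
    F in [set F : (set (borelT R N))^nat |
      [/\ forall k, measurable (F k), trivIset setT F & \bigcup_k F k = B]]].

End signed_measures.

Section BV.
Context {R : realType} {N : nat}.
Variable Omega : set 'rV[R]_N.
Implicit Types (u v : 'rV[R]_N -> R).

(* nu is the vector measure Dv on Omega. *)
Definition is_gradient_measure v (nu : 'I_N -> signed_borel R N) : Prop :=
  forall i phi, test_function Omega phi ->
  (\int[lebN R N]_(x in Omega) (v x * partial i phi x)) =
  - charge_integral (nu i) Omega phi.

Definition in_BV v : Prop :=
  (lebN R N).-integrable Omega (EFin \o v) /\
  exists nu, is_gradient_measure v nu.

(* lam is the pairing (z, Dv), for z in X(Omega) with divergence d. *)
Definition is_pairing (z : 'rV[R]_N -> 'rV[R]_N) (d v : 'rV[R]_N -> R)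
    (lam : signed_borel R N) : Prop :=
  forall phi, test_function Omega phi ->
  charge_integral lam Omega phi =
  - (\int[lebN R N]_(x in Omega) (v x * phi x * d x))
  - (\int[lebN R N]_(x in Omega) (v x * dotp (z x) (grad phi x))).

Definition is_BV_trace v (tr : 'rV[R]_N -> R) : Prop :=
  {ae hausdorff R N N.-1, forall x, boundary Omega x ->
    ((rho ^- N)%:E *
      (\int[lebN R N]_(y in Omega `&` eball x rho) (`|v y - tr x|%R)%:E))%E
    @[rho --> 0^'+] --> 0%E}.

Definition truncate (a b s : R) : R := Num.max (Num.min b s) a.

Definition truncate_below (a s : R) : R := Num.max s a.

Definition in_TBVp u : Prop :=
  [/\ forall x, Omega x -> 0 <= u x,
      (lebN R N).-integrable Omega (EFin \o u) &
      forall a, 0 < a -> in_BV (truncate_below a \o u)].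

(* The choice of the representatives tr a is immaterial: two such limits agree
   at almost every point, as seen along the sequence of values a = 1/n. *)
Definition is_TBVp_trace u (ub : 'rV[R]_N -> R) : Prop :=
  exists tr : R -> 'rV[R]_N -> R,
  (forall a, 0 < a -> is_BV_trace (truncate_below a \o u) (tr a)) /\
  {ae hausdorff R N N.-1, forall x, boundary Omega x ->
    tr a x @[a --> 0^'+] --> ub x}.

End BV.

Section solution.
Context {R : realType} {N : nat}.
Variables (m : R) (Omega : set 'rV[R]_N).

Definition phi_m (s : R) : R := s `^ (m + 1) / (m + 1).

Definition is_solution (f g u : 'rV[R]_N -> R) : Prop :=
  [/\ in_TBVp Omega u,
      Linfty (lebN R N) Omega u &
  exists (w : 'rV[R]_N -> 'rV[R]_N) (d ub zn : 'rV[R]_N -> R),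
  let z := fun x => (u x `^ m) *: w x in
  [/\ Linfty_vec Omega w /\
        {ae lebN R N, forall x, Omega x -> enorm (w x) <= 1},
      in_X Omega z d,
      is_TBVp_trace Omega u ub /\ is_normal_trace Omega z d zn &
  [/\ forall a b : R, 0 < a -> a < b ->
        exists (lam : signed_borel R N) (nu : 'I_N -> signed_borel R N),
        [/\ is_pairing Omega z d (truncate a b \o u) lam,
            is_gradient_measure Omega (phi_m \o truncate a b \o u) nu &
            forall B : set (borelT R N), measurable B -> B `<=` Omega ->
              (total_variation nu B <= lam B)%E],
      is_div Omega z (fun x => u x - f x),
      {ae hausdorff R N N.-1, forall x, boundary Omega x -> g x <= ub x} &
      {ae hausdorff R N N.-1, forall x, boundary Omega x ->
         g x < ub x -> zn x = - (ub x `^ m)}]]].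

Definition lower_approx_limit (u : 'rV[R]_N -> R) (x : 'rV[R]_N) : \bar R :=
  ereal_sup [set t%:E | t in [set t : R |
    ((rho ^- N)%:E * lebN R N ([set y | Omega y /\ (u y < t)%R] `&` eball x rho))%E
    @[rho --> 0^'+] --> 0%E]].

End solution.

(* Main.v *)
(* For every lam >= 1 the function lam * exp(x_1 + r) is a subsolution, because
   div(v^m e_1) = m v^m >= v when v >= 1 and m >= 1, and f >= 0; it stays below
   lam * exp(2 r), hence below the boundary datum once G is large. Comparison
   needs condition (1) only in the direction e_1, that is
   (z, DT(u)) >= D_1 phi(T(u)). It is tested, for the truncations between the
   consecutive levels t_k = lam (1 + h)^k, with a ramp which is increasing in x_1
   and supported in {x_1 + r >= k h}; summing over k and letting h -> 0 gives
   u >= lam almost everywhere in smaller balls.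

   The tests must vanish near the sphere. There u > lam * exp(2 r) in the sense of
   traces, so E = {u < lam * exp(2 r)} has density zero at H^(N-1)-almost every
   boundary point. Covering the exceptional null set by definition of H^(N-1) and
   the remaining points by Vitali's lemma yields finitely many balls B(c, rho)
   covering the sphere with the sum of |E n B(c, 2 rho)| / rho as small as
   desired; the cutoff built from them costs no more than this sum. *)
From mathcomp Require Import ring lra measurable_realfun finmap.
Require Import Defs.

Set Implicit Arguments.
Unset Strict Implicit.
Unset Printing Implicit Defensive.

Local Open Scope classical_set_scope.
Local Open Scope ring_scope.

(** Condition (1) is an inequality of measures for each truncation separately, which suits finitely
    many levels better than a direct comparison with the exponential. Each tested inequality is
    integrated against [b - T(u)] instead of [T(u)]: the added constants integrate to zero, and the
    integrand then vanishes where [u] exceeds all the levels, so the cutoff costs something only on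
    [E]. This cost is multiplied by the number of levels, which is harmless because the covering is
    chosen last. The levels interact through [th k - th k.+1 <= h * dth k], a convexity property of
    the ramp. A bounded increasing ramp cannot be convex everywhere; hence [exp(-1/t)], scaled so
    that the ball sees only its convex part. The Vitali selection needs a bound on the sum of
    [rho^(N-1)]. It is obtained without surface measure: the sphere is cut into patches parametrised
    by all the coordinates but one, the selection is made among projections, and these are thickened
    to disjoint boxes of bounded total Lebesgue volume. *)

(** * The Euclidean norm and continuity *)

Lemma dotp_ge0 (R : realType) (N : nat) (x : 'rV[R]_N) : 0 <= dotp x x.
Proof. by apply: sumr_ge0 => i _; rewrite -expr2 sqr_ge0. Qed.

Lemma dotpC (R : realType) (N : nat) (x y : 'rV[R]_N) : dotp x y = dotp y x.
Proof. by apply: eq_bigr => i _; rewrite mulrC. Qed.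

Lemma dotpDl (R : realType) (N : nat) (x y z : 'rV[R]_N) :
  dotp (x + y) z = dotp x z + dotp y z.
Proof. by rewrite -big_split; apply: eq_bigr => i _ /=; rewrite mxE mulrDl. Qed.

Lemma dotpZl (R : realType) (N : nat) (c : R) (x z : 'rV[R]_N) :
  dotp (c *: x) z = c * dotp x z.
Proof. by rewrite mulr_sumr; apply: eq_bigr => i _; rewrite mxE mulrA. Qed.

Lemma dotpNN (R : realType) (N : nat) (x : 'rV[R]_N) :
  dotp (- x) (- x) = dotp x x.
Proof. by apply: eq_bigr => i _; rewrite mxE mulrNN. Qed.

Lemma enorm_ge0 (R : realType) (N : nat) (x : 'rV[R]_N) : 0 <= enorm x.
Proof. exact: sqrtr_ge0. Qed.

Lemma sqr_enorm (R : realType) (N : nat) (x : 'rV[R]_N) :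
  enorm x ^+ 2 = dotp x x.
Proof. by rewrite sqr_sqrtr// dotp_ge0. Qed.

Lemma enormN (R : realType) (N : nat) (x : 'rV[R]_N) : enorm (- x) = enorm x.
Proof. by rewrite /enorm dotpNN. Qed.

Lemma enorm0 (R : realType) (N : nat) : enorm (0 : 'rV[R]_N) = 0.
Proof. by rewrite /enorm /dotp big1 ?sqrtr0// => i _; rewrite mxE mul0r. Qed.

Lemma normr_coord_le_enorm (R : realType) (N : nat) (x : 'rV[R]_N) i :
  `|x 0 i| <= enorm x.
Proof.
rewrite -sqrtr_sqr ler_wsqrtr// /dotp (bigD1 i)//= -expr2 lerDl.
by apply: sumr_ge0 => j _; rewrite -expr2 sqr_ge0.
Qed.

(** Cauchy-Schwarz: with [a], [b] the norms of [x], [y] and [p] their product, the vector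
    [b x - a y] has square [2 a b (a b - p)]. The cases of a zero norm are apart because of the
    division by [a b]. *)
Lemma dotp_le_enorm (R : realType) (N : nat) (x y : 'rV[R]_N) :
  dotp x y <= enorm x * enorm y.
Proof.
have [x0|x0] := eqVneq (enorm x) 0.
  rewrite x0 mul0r /dotp big1// => i _.
  have := normr_coord_le_enorm x i; rewrite x0 normr_le0 => /eqP ->.
  by rewrite mul0r.
have xp : 0 < enorm x by rewrite lt_neqAle eq_sym x0 enorm_ge0.
have [y0|y0] := eqVneq (enorm y) 0.
  rewrite y0 mulr0 /dotp big1// => i _.
  have := normr_coord_le_enorm y i; rewrite y0 normr_le0 => /eqP ->.
  by rewrite mulr0.
have yp : 0 < enorm y by rewrite lt_neqAle eq_sym y0 enorm_ge0.
have := dotp_ge0 (enorm y *: x + - enorm x *: y).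
rewrite dotpDl !dotpZl !(dotpC _ (_ + _)) !dotpDl !dotpZl -!sqr_enorm (dotpC y x).
set p := dotp x y; set a := enorm x; set b := enorm y.
have -> : b * (b * a ^+ 2 + - a * p) + - a * (b * p + - a * b ^+ 2) =
  (a * b) * (2 * (a * b - p)) by ring.
by rewrite pmulr_rge0 ?mulr_gt0// pmulr_rge0// subr_ge0.
Qed.

Lemma ler_enormD (R : realType) (N : nat) (x y : 'rV[R]_N) :
  enorm (x + y) <= enorm x + enorm y.
Proof.
rewrite -(ler_pXn2r (n := 2))// ?nnegrE ?addr_ge0 ?enorm_ge0//.
rewrite sqr_enorm dotpDl !(dotpC _ (x + y)) !dotpDl (dotpC y x) -!sqr_enorm.
have := dotp_le_enorm x y; set p := dotp x y; lra.
Qed.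

Lemma ler_enorm_sum (R : realType) (N : nat) (x : 'rV[R]_N) :
  enorm x <= \sum_i `|x 0 i|.
Proof.
rewrite -(ler_pXn2r (n := 2))// ?nnegrE ?enorm_ge0 ?sumr_ge0//.
rewrite sqr_enorm expr2 mulr_suml; apply: ler_sum => i _.
apply: le_trans (ler_norm _) _; rewrite normrM ler_wpM2l//.
by rewrite (bigD1 i)//= lerDl sumr_ge0.
Qed.

Lemma continuous_add (R : realType) (T : topologicalType) (f g : T -> R) :
  continuous f -> continuous g -> continuous (fun x => f x + g x).
Proof. by move=> cf cg x; apply: cvgD; [exact: cf|exact: cg]. Qed.

Lemma continuous_mul (R : realType) (T : topologicalType) (f g : T -> R) :
  continuous f -> continuous g -> continuous (fun x => f x * g x).
Proof. by move=> cf cg x; apply: cvgM; [exact: cf|exact: cg]. Qed.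

Lemma continuous_cst (R : realType) (T : topologicalType) (c : R) :
  continuous (fun _ : T => c).
Proof. by move=> x; exact: cvg_cst. Qed.

Lemma continuous_compose (R : realType) (T : topologicalType) (f : T -> R)
    (h : R -> R) :
  continuous f -> continuous h -> continuous (fun x => h (f x)).
Proof. by move=> cf ch x; apply: continuous_comp; [exact: cf|exact: ch]. Qed.

Lemma continuous_sum (R : realType) (T : topologicalType) (I : Type)
    (s : seq I) (f : I -> T -> R) :
  (forall i, continuous (f i)) -> continuous (fun x => \sum_(i <- s) f i x).
Proof.
move=> cf x; elim: s => [|i s ih].
  by under eq_fun do rewrite big_nil; exact: cvg_cst.
by under eq_fun do rewrite big_cons; apply: cvgD; [exact: cf|exact: ih].
Qed.

Lemma continuous_coord (R : realType) (N : nat) (i : 'I_N) :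
  continuous (fun y : 'rV[R]_N => y 0 i).
Proof. by move=> y; exact: coord_continuous. Qed.

Lemma continuous_coordB (R : realType) (N : nat) (c : 'rV[R]_N) (i : 'I_N) :
  continuous (fun y : 'rV[R]_N => (y - c) 0 i).
Proof.
rewrite (_ : (fun y => _) = (fun y : 'rV[R]_N => y 0 i + - c 0 i)); last first.
  by apply/funext => y; rewrite !mxE.
by apply: continuous_add; [exact: continuous_coord|exact: continuous_cst].
Qed.

Lemma continuous_dotpB (R : realType) (N : nat) (c : 'rV[R]_N) :
  continuous (fun x : 'rV[R]_N => dotp (x - c) (x - c)).
Proof.
apply: continuous_sum => i.
by apply: continuous_mul; exact: continuous_coordB.
Qed.

Lemma enormB_continuous (R : realType) (N : nat) (c : 'rV[R]_N) :
  continuous (fun x : 'rV[R]_N => enorm (x - c)).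
Proof.
apply: (@continuous_compose _ _ (fun y : 'rV[R]_N => dotp (y - c) (y - c)) Num.sqrt).
  exact: continuous_dotpB.
exact: sqrt_continuous.
Qed.

Lemma enorm_continuous (R : realType) (N : nat) :
  continuous (@enorm R N).
Proof.
by move=> x; have := @enormB_continuous R N 0 x; under eq_fun do rewrite subr0.
Qed.

Lemma open_eball (R : realType) (N : nat) (c : 'rV[R]_N) r : open (eball c r).
Proof.
have := @open_comp _ _ (fun x : 'rV[R]_N => enorm (x - c)) [set t | t < r].
by apply; [move=> x _; exact: enormB_continuous|exact: open_lt].
Qed.

(** * Lebesgue measure of boxes *)

(** Induction on the dimension: the inequality for the slices is integrated over the last
    coordinate, and sum and integral are exchanged on the line. The predicate [P] makes the
    induction possible, since the boxes that meet a slice depend on the slice; it also discards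
    boxes in dimension 0, where every product is 1. Bounds are functions on [nat] so that the
    dimension can drop without a cast. *)
Lemma prod_le_cover (R : realType) (s : nat) (l u : nat -> R)
    (a b : nat -> nat -> R) (P : pred nat) :
  (forall x : nat -> R, (forall i, (i < s)%N -> l i <= x i <= u i) ->
    exists2 k, P k & forall i, (i < s)%N -> a k i <= x i <= b k i) ->
  ((\prod_(i < s) Num.max 0 (u i - l i))%:E <=
   \sum_(k <oo) (if P k then \prod_(i < s) Num.max 0 (b k i - a k i) else 0)%:E)%E.
Proof.
have ge0 n k (Q : bool) : 0 <= (if Q then \prod_(i < n) Num.max 0 (b k i - a k i) else 0).
  by case: ifP => // _; apply: prodr_ge0 => i _; rewrite le_max lexx.
elim: s P => [|s ih] P cov.
  have [k Pk _] := cov (fun=> 0) (fun i => ltac:(by [])).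
  rewrite big_ord0 (@nneseriesD1 _ _ k)//; last first.
    by move=> n _; rewrite lee_fin (ge0 0%N).
  rewrite Pk big_ord0 leeDl// nneseries_ge0// => n _ _.
  by rewrite lee_fin (ge0 0%N).
rewrite big_ord_recr/=; have [us|us] := leP (u s) (l s).
  rewrite (_ : Num.max 0 (u s - l s) = 0) ?mulr0; last first.
    by apply/max_idPl; rewrite subr_le0.
  by rewrite nneseries_ge0// => n _ _; rewrite lee_fin (ge0 s.+1).
set V := \prod_(i < s) _.
rewrite (_ : Num.max 0 _ = u s - l s); last by apply/max_idPr; rewrite subr_ge0 ltW.
pose vol k : R := \prod_(i < s) Num.max 0 (b k i - a k i).
pose F k (t : R) : R := vol k * \1_(`[a k s, b k s]) t * (P k)%:R.
have F0 k t : 0 <= F k t.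
  rewrite /F !mulr_ge0// ?indicE//.
  by have := ge0 s k true.
have mF k : measurable_fun (`[l s, u s] : set R) (F k).
  apply: measurable_funM => //; apply: measurable_funM => //.
have step (t : R) : `[l s, u s]%classic t -> (V%:E <= \sum_(k <oo) (F k t)%:E)%E.
  move=> /=; rewrite in_itv/= => lut.
  (* Only the boxes whose last side contains [t] cover the slice at [t]. *)
  have := ih (fun k => P k && (a k s <= t <= b k s)).
  move=> /(_ _)/le_trans; apply.
    move=> x xlu; have [|k Pk xab] := cov (fun i => if i == s then t else x i).
      move=> i; rewrite ltnS; case: eqVneq => [->//|nis ilts]; apply: xlu.
      by rewrite ltn_neqAle nis.
    exists k; first by rewrite Pk; have := xab s (ltnSn s); rewrite eqxx.
    move=> i ils; have := xab i (ltnW ils); by rewrite (ltn_eqF ils).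
  apply: lee_nneseries => [k _|k _]; first by rewrite lee_fin (ge0 s).
  rewrite lee_fin /F indicE; case: ifPn => [/andP[Pk akt]|_].
    by rewrite Pk mulr1 mem_set ?mulr1//= in_itv.
  rewrite mulr_ge0// mulr_ge0//; by have := ge0 s k true.
have : (\int[lebesgue_measure]_(t in `[l s, u s]) V%:E <=
   \int[lebesgue_measure]_(t in `[l s, u s]) (\sum_(k <oo) (F k t)%:E))%E.
  apply: ge0_le_integral => //.
  - move=> t _; rewrite lee_fin; apply: prodr_ge0 => i _; by rewrite le_max lexx.
  - have := @ge0_emeasurable_sum _ _ R `[l s, u s]%classic (fun k t => (F k t)%:E) xpredT.
    by apply; [move=> k t _ _; rewrite lee_fin|move=> k _; exact/measurable_EFinP].
rewrite integral_cst//= lebesgue_measure_itv/= lte_fin us -EFinD -EFinM => /le_trans; apply.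
rewrite integral_nneseries//; last 2 first.
- by move=> k; apply/measurable_EFinP; exact: mF.
- by move=> k t _; rewrite lee_fin.
apply: lee_nneseries => [k _ _|k _].
  by apply: integral_ge0 => t _; rewrite lee_fin.
apply: (@le_trans _ _ (\int[lebesgue_measure]_t (F k t)%:E)%E).
  apply: ge0_subset_integral => //; last by move=> t _; rewrite lee_fin.
  apply/measurable_EFinP; apply: measurable_funM => //; apply: measurable_funM => //.
rewrite (_ : (fun t => _) = (fun t => (vol k * (P k)%:R)%:E * (\1_(`[a k s, b k s]) t)%:E)%E); last first.
  by apply/funext => t; rewrite -EFinM /F mulrAC.
have vP0 : 0 <= vol k * (P k)%:R by rewrite mulr_ge0//; have := ge0 s k true.
rewrite ge0_integralZl_EFin//; last by apply/measurable_EFinP.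
rewrite integral_indic// setIT.
have /= -> := @lebesgue_measure_itv R `[a k s, b k s].
rewrite lte_fin -EFinB.
case: (P k); rewrite ?mulr0 ?mul0e// mulr1 big_ord_recr/= -/(vol k).
case: ltP => ab.
  by rewrite -EFinM lee_fin ler_wpM2l ?le_max ?lexx ?orbT//; have := ge0 s k true.
by rewrite mule0 lee_fin mulr_ge0 ?le_max ?lexx//; have := ge0 s k true.
Qed.

Lemma box_nonempty (R : realType) (N : nat) (a b : 'rV[R]_N) :
  box a b !=set0 <-> forall i, a 0 i <= b 0 i.
Proof.
split=> [[x xab] i|ab]; first by have /andP[] := xab i => /le_trans; apply.
by exists a => i; rewrite lexx ab.
Qed.

Lemma box_inj (R : realType) (N : nat) (a b c d : 'rV[R]_N) :
  box a b !=set0 -> box a b = box c d -> a = c /\ b = d.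
Proof.
move=> ab0 E; have ab := (box_nonempty a b).1 ab0.
have cd : forall i, c 0 i <= d 0 i by apply/box_nonempty; rewrite -E.
have ca : box c d a by rewrite -E => i; rewrite lexx ab.
have cb : box c d b by rewrite -E => i; rewrite lexx ab.
have ac : box a b c by rewrite E => i; rewrite lexx cd.
have ad : box a b d by rewrite E => i; rewrite lexx cd.
split; apply/rowP => i; apply/eqP; rewrite eq_le.
  by have /andP[-> _] := ac i; have /andP[-> _] := ca i.
by have /andP[_ ->] := cb i; have /andP[_ ->] := ad i.
Qed.

Lemma box_volumeE (R : realType) (N : nat) (a b : 'rV[R]_N) :
  (forall i, a 0 i <= b 0 i) ->
  box_volume (box a b) = (\prod_(i < N) (b 0 i - a 0 i))%:E.
Proof.
move=> ab; have ab0 := (box_nonempty a b).2 ab.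
rewrite /box_volume ifF; last by apply/negbTE/set0P.
apply/eqP; rewrite eq_le; apply/andP; split.
  by apply: ereal_inf_lbound; exists (a, b).
apply: le_ereal_inf_tmp => _ [[c d] /= E <-].
by have [-> ->] := box_inj ab0 E.
Qed.

(** A nonempty set that is not a box has as volume the infimum of the empty set, that is +oo. *)
Lemma box_volume_cases (R : realType) (N : nat) (A : set 'rV[R]_N) :
  [\/ A = set0, box_volume A = +oo%E |
     exists a b : 'rV[R]_N, (forall i, a 0 i <= b 0 i) /\ A = box a b].
Proof.
have [->|A0] := eqVneq A set0; first by apply: Or31.
have [[[a b] AE]|noA] := pselect (exists p : 'rV[R]_N * 'rV[R]_N, A = box p.1 p.2).
  apply: Or33; exists a, b; split=> //; apply/box_nonempty.
  by rewrite -[box a b]AE; apply/set0P.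
apply: Or32; rewrite /box_volume (negbTE A0).
apply/eqP; rewrite -leye_eq; apply: le_ereal_inf_tmp => _ [p /= pA <-].
by case: noA; exists p.
Qed.

Lemma lebN_le_cover (R : realType) (N : nat) (F : (set 'rV[R]_N)^nat)
    (X : set 'rV[R]_N) :
  X `<=` \bigcup_k F k ->
  (lebN R N X <= \sum_(k <oo) box_volume (F k))%E.
Proof. by move=> XF; apply: ereal_inf_lbound; exists F. Qed.

Lemma lebN_box_le (R : realType) (N : nat) (a b : 'rV[R]_N) :
  (forall i, a 0 i <= b 0 i) ->
  (lebN R N (box a b) <= (\prod_(i < N) (b 0 i - a 0 i))%:E)%E.
Proof.
move=> ab; rewrite -box_volumeE//.
have := @lebN_le_cover R N (fun k => if k is 0%N then box a b else set0) (box a b).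
rewrite (@nneseriesD1 _ _ 0%N)//; last by move=> k _; exact: box_volume_ge0.
rewrite /= eseries0 ?adde0; last by case=> // k _ _; rewrite box_volume0.
by apply => x abx; exists 0%N.
Qed.

(** Bridges rows and the functions on [nat] of [prod_le_cover]. *)
Definition row_ext (R : realType) (N : nat) (v : 'rV[R]_N) (i : nat) : R :=
  if insub i is Some j then v 0 j else 0.

Lemma row_extE (R : realType) (N : nat) (v : 'rV[R]_N) (i : 'I_N) :
  row_ext v i = v 0 i.
Proof. by rewrite /row_ext valK. Qed.

Lemma lebN_box (R : realType) (N : nat) (a b : 'rV[R]_N) :
  (forall i, a 0 i <= b 0 i) ->
  lebN R N (box a b) = (\prod_(i < N) (b 0 i - a 0 i))%:E.
Proof.
move=> ab; apply/eqP; rewrite eq_le lebN_box_le//=.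
apply: le_ereal_inf_tmp => _ [F abF <-].
(* A member of infinite volume makes the bound trivial; otherwise every nonempty member is a box,
   and its corners can be chosen. *)
have [[k Fk]|noinf] := pselect (exists k, box_volume (F k) = +oo%E).
  rewrite (@nneseriesD1 _ _ k)//; last by move=> *; exact: box_volume_ge0.
  rewrite Fk addye ?leey// gt_eqF// (lt_le_trans ltNy0)//.
  by apply: nneseries_ge0 => *; exact: box_volume_ge0.
pose rep k (p : 'rV[R]_N * 'rV[R]_N) :=
  F k !=set0 -> (forall i, p.1 0 i <= p.2 0 i) /\ F k = box p.1 p.2.
have [p pE] : {p : nat -> 'rV[R]_N * 'rV[R]_N & forall k, rep k (p k)}.
  apply: (@choice _ _ rep) => k.
  have [F0|Foo|[c [d [cd Fk]]]] := box_volume_cases (F k).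
  - by exists (0, 0) => /set0P; rewrite F0 eqxx.
  - by case: noinf; exists k.
  - by exists (c, d).
have := @prod_le_cover R N (row_ext a) (row_ext b)
  (fun k => row_ext (p k).1) (fun k => row_ext (p k).2)
  (fun k => F k != set0).
rewrite (eq_bigr (fun i : 'I_N => b 0 i - a 0 i)); last first.
  by move=> i _; rewrite !row_extE; apply/max_idPr; rewrite subr_ge0.
move=> /(_ _)/le_trans; apply.
  move=> x xab; have /abF[k _ Fkx] : box a b (\row_i x i).
    by move=> i; rewrite mxE; have := xab i (ltn_ord i); rewrite !row_extE.
  have Fk0 : F k !=set0 by exists (\row_i x i).
  exists k; first exact/set0P.
  move=> i iN; have [_ FE] := pE k Fk0.
  move: Fkx; rewrite FE => /(_ (Ordinal iN)); rewrite mxE/=.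
  by have := row_extE (p k).1 (Ordinal iN); have := row_extE (p k).2 (Ordinal iN) => /= -> ->.
apply: lee_nneseries => [k _ _|k _].
  by rewrite lee_fin; case: ifP => // _; apply: prodr_ge0 => i _; rewrite le_max lexx.
case: ifPn => [/set0P/pE[pp ->]|_]; last exact: box_volume_ge0.
rewrite box_volumeE// lee_fin.
rewrite (eq_bigr (fun i : 'I_N => (p k).2 0 i - (p k).1 0 i))// => i _.
by rewrite !row_extE; apply/max_idPr; rewrite subr_ge0.
Qed.

(** * Caratheodory measurability and outer regularity *)

(** The two hypotheses place [H] between the open and the closed half-space, so that both are
    treated at once. The two halves may share a face, since only the sum of their volumes
    matters. *)
Lemma box_split (R : realType) (N : nat) (i : 'I_N) (c : R) (H : set 'rV[R]_N)
    (A : set 'rV[R]_N) :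
  (forall x : 'rV[R]_N, x 0 i < c -> H x) ->
  (forall x : 'rV[R]_N, H x -> x 0 i <= c) ->
  exists B C, [/\ A `&` H `<=` B, A `&` ~` H `<=` C &
    (box_volume B + box_volume C <= box_volume A)%E].
Proof.
move=> ltH Hle.
have [->|Aoo|[a [b [ab AE]]]] := box_volume_cases A.
- by exists set0, set0; split; rewrite ?set0I ?box_volume0 ?adde0.
- by exists setT, setT; rewrite Aoo leey; split.
have [cb|bc] := ltP c (a 0 i).
  exists set0, A; split.
  + move=> x []; rewrite AE => /(_ i)/andP[/(lt_le_trans cb) + _] /Hle.
    by rewrite ltNge => /negP.
  + by move=> x [].
  + by rewrite box_volume0 add0e.
have [bc'|cb] := ltP (b 0 i) c.
  exists A, set0; split.
  + by move=> x [].
  + move=> x []; rewrite AE => /(_ i)/andP[_ /le_lt_trans/(_ bc')] xc.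
    by move=> /(_ (ltH _ xc)).
  + by rewrite box_volume0 adde0.
pose b' := \row_j (if j == i then c else b 0 j).
pose a' := \row_j (if j == i then c else a 0 j).
have ab' j : a 0 j <= b' 0 j by rewrite mxE; case: eqVneq => // ->.
have a'b j : a' 0 j <= b 0 j by rewrite mxE; case: eqVneq => // ->.
exists (box a b'), (box a' b); split.
- move=> x [+ Hx]; rewrite AE => xab j; have /andP[-> xb] := xab j.
  by rewrite mxE; case: eqVneq => // ->; exact: Hle.
- move=> x [+ Hx]; rewrite AE => xab j; have /andP[ax ->] := xab j.
  rewrite mxE andbT; case: eqVneq => // ->; rewrite leNgt; apply/negP => /ltH.
  exact: Hx.
- rewrite AE !box_volumeE// -EFinD lee_fin.
  rewrite (bigD1 i)//= [X in _ + X](bigD1 i)//= [leRHS](bigD1 i)//= !mxE eqxx.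
  rewrite (eq_bigr (fun j => b 0 j - a 0 j)); last first.
    by move=> j /negbTE ji; rewrite mxE ji.
  rewrite [X in _ + _ * X](eq_bigr (fun j => b 0 j - a 0 j)); last first.
    by move=> j /negbTE ji; rewrite mxE ji.
  by rewrite -mulrDl addrC addrA subrK.
Qed.

(** Splitting every box of a covering of [X] gives coverings of [X] inside and outside [H] of no
    larger total volume, which is Caratheodory's criterion. *)
Lemma measurable_halfspace (R : realType) (N : nat) (i : 'I_N) (c : R)
    (H : set 'rV[R]_N) :
  (forall x : 'rV[R]_N, x 0 i < c -> H x) ->
  (forall x : 'rV[R]_N, H x -> x 0 i <= c) ->
  measurable (H : set (lebT R N)).
Proof.
move=> ltH Hle; apply: le_caratheodory_measurable => X.
apply: le_ereal_inf_tmp => _ [F XF <-].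
pose sp k (p : set 'rV[R]_N * set 'rV[R]_N) :=
  [/\ F k `&` H `<=` p.1, F k `&` ~` H `<=` p.2 &
  (box_volume p.1 + box_volume p.2 <= box_volume (F k))%E].
have [p pE] : {p : nat -> set 'rV[R]_N * set 'rV[R]_N & forall k, sp k (p k)}.
  apply: (@choice _ _ sp) => k.
  by have [B [C BC]] := box_split (F k) ltH Hle; exists (B, C).
apply: (@le_trans _ _ (\sum_(k <oo) box_volume (p k).1 + \sum_(k <oo) box_volume (p k).2)%E).
  apply: leeD; apply: lebN_le_cover => x [/XF[k _ Fx] Hx]; exists k => //.
    by have [+ _ _] := pE k; apply.
  by have [_ + _] := pE k; apply.
rewrite -nneseriesD; [|by move=> *; exact: box_volume_ge0..].
apply: lee_nneseries => [k _ _|k _]; last by have [] := pE k.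
by apply: adde_ge0; exact: box_volume_ge0.
Qed.

Definition obox (R : realType) (N : nat) (a b : 'rV[R]_N) : set 'rV[R]_N :=
  [set x | forall i, a 0 i < x 0 i < b 0 i].

Lemma measurable_box (R : realType) (N : nat) (a b : 'rV[R]_N) :
  measurable (box a b : set (lebT R N)).
Proof.
rewrite (_ : box a b = \big[setI/setT]_(i < N)
   (~` [set x : 'rV[R]_N | x 0 i < a 0 i] `&` [set x | x 0 i <= b 0 i])).
  apply: bigsetI_measurable => i _; apply: measurableI.
    apply: measurableC; apply: (@measurable_halfspace _ _ i (a 0 i)) => //.
    by move=> x /ltW.
  by apply: (@measurable_halfspace _ _ i (b 0 i)) => // x /ltW.
rewrite -bigcap_seq; apply/seteqP; split=> [x xab i _/=|x xab i].
  have /andP[ax xb] := xab i; split=> //; apply/negP; by rewrite -leNgt.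
by have [/negP + ->] := xab i (mem_index_enum i); rewrite -leNgt => ->.
Qed.

Lemma measurable_obox (R : realType) (N : nat) (a b : 'rV[R]_N) :
  measurable (obox a b : set (lebT R N)).
Proof.
rewrite (_ : obox a b = \big[setI/setT]_(i < N)
   (~` [set x : 'rV[R]_N | x 0 i <= a 0 i] `&` [set x | x 0 i < b 0 i])).
  apply: bigsetI_measurable => i _; apply: measurableI.
    apply: measurableC; apply: (@measurable_halfspace _ _ i (a 0 i)) => //.
    by move=> x /ltW.
  by apply: (@measurable_halfspace _ _ i (b 0 i)) => // x /ltW.
rewrite -bigcap_seq; apply/seteqP; split=> [x xab i _/=|x xab i].
  have /andP[ax xb] := xab i; split=> //; apply/negP; by rewrite -ltNge.
by have [/negP + ->] := xab i (mem_index_enum i); rewrite -ltNge => ->.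
Qed.

Lemma open_row_ball (R : realType) (N : nat) (U : set 'rV[R]_N) x :
  open U -> U x ->
  exists2 e : R, 0 < e & forall y : 'rV[R]_N, (forall i, `|x 0 i - y 0 i| < e) -> U y.
Proof.
move=> oU Ux; have /nbhs_ballP[e /= e0 xU] := open_nbhs_nbhs (conj oU Ux).
exists e => // y xy; apply: xU; split=> // i j; rewrite (ord1 i); exact: xy.
Qed.

(** Boxes with rational corners. The second clause, on the closed boxes, will provide compact
    supports in [open_test_approx]. *)
Lemma open_row_boxes (R : realType) (N : nat) (U : set 'rV[R]_N) :
  open U -> exists (P : pred nat) (a b : nat -> 'rV[R]_N),
    U = \bigcup_(k in [set k | P k]) obox (a k) (b k) /\
    forall k, P k -> box (a k) (b k) `<=` U.
Proof.
move=> oU.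
pose I := ('rV[rat]_N * 'rV[rat]_N)%type.
pose a (p : I) : 'rV[R]_N := map_mx ratr p.1.
pose b (p : I) : 'rV[R]_N := map_mx ratr p.2.
(* Integers that code no pair are sent to [(0, 0)]; this is harmless, as [P] tests the resulting
   box. *)
pose get k : I := odflt (0, 0) (unpickle k).
pose P k := `[< box (a (get k)) (b (get k)) `<=` U >].
exists P, (a \o get), (b \o get); split; last by move=> k /asboolP.
apply/seteqP; split=> [x Ux|x [k /= /asboolP kU xab]]; last first.
  by apply: kU => i; have /andP[/ltW -> /ltW ->] := xab i.
have [e e0 xU] := open_row_ball oU Ux.
have [p pP] : {p : 'I_N -> rat * rat & forall i,
    [/\ x 0 i - e < ratr (p i).1 :> R, ratr (p i).1 < x 0 i,
       x 0 i < ratr (p i).2 & ratr (p i).2 < x 0 i + e]}.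
  apply: (@choice _ _ (fun i (p : rat * rat) =>
    [/\ x 0 i - e < ratr p.1 :> R, ratr p.1 < x 0 i,
       x 0 i < ratr p.2 & ratr p.2 < x 0 i + e])) => i.
  have /rat_in_itvoo[q1] : x 0 i - e < x 0 i by rewrite ltrBlDr ltrDl.
  rewrite in_itv/= => /andP[q1l q1r].
  have /rat_in_itvoo[q2] : x 0 i < x 0 i + e by rewrite ltrDl.
  rewrite in_itv/= => /andP[q2l q2r].
  by exists (q1, q2).
pose q : I := (\row_i (p i).1, \row_i (p i).2).
exists (pickle q) => /=; last first.
  by move=> i; rewrite /= /get pickleK /= !mxE; have [_ -> -> _] := pP i.
apply/asboolP => y; rewrite /get pickleK /= => yq; apply: xU => i.
have := yq i; rewrite !mxE => /andP[y1 y2]; have [h1 h2 h3 h4] := pP i.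
by rewrite ltr_norml; apply/andP; split; lra.
Qed.

Lemma measurable_open (R : realType) (N : nat) (U : set 'rV[R]_N) :
  open U -> measurable (U : set (lebT R N)).
Proof.
move=> /open_row_boxes[P [a [b [-> _]]]].
by apply: bigcup_measurable => k _; exact: measurable_obox.
Qed.

Lemma measurable_continuous (R : realType) (N : nat) (D : set 'rV[R]_N)
    (f : 'rV[R]_N -> R) :
  continuous f -> measurable_fun (D : set (lebT R N)) f.
Proof.
move=> cf; apply: measurable_funTS => //.
move=> mD; apply: (measurability _ (RGenOInfty.measurableE R)).
move=> /= _ [_ [x ->] <-]; rewrite setTI; apply: measurable_open.
apply: open_comp => [y _|]; first exact: cf.
by rewrite set_itvE; exact: open_gt.
exact: mD.
Qed.

Lemma measurable_borel_continuous (R : realType) (N : nat) (D : set 'rV[R]_N)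
    (f : 'rV[R]_N -> R) :
  continuous f -> measurable_fun (D : set (borelT R N)) f.
Proof.
move=> cf; apply: measurable_funTS => //.
move=> mD; apply: (measurability _ (RGenOInfty.measurableE R)).
move=> /= _ [_ [x ->] <-]; rewrite setTI; apply: sub_sigma_algebra.
apply: open_comp => [y _|]; first exact: cf.
by rewrite set_itvE; exact: open_gt.
exact: mD.
Qed.

Lemma lebN_eball_le (R : realType) (N : nat) (c : 'rV[R]_N) (r : R) :
  0 <= r -> (lebN R N (eball c r) <= ((2 * r) ^+ N)%:E)%E.
Proof.
move=> r0; pose e : 'rV[R]_N := const_mx r.
have ce i : (c - e) 0 i <= (c + e) 0 i by rewrite !mxE; lra.
apply: le_trans (le_trans _ (lebN_box_le ce)) _; last first.
  rewrite (eq_bigr (fun=> 2 * r)) ?prodr_const ?card_ord//.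
  by move=> i _; rewrite !mxE; ring.
apply: le_measure; rewrite ?inE.
- exact/measurable_open/open_eball.
- exact: measurable_box.
- move=> x xr i; have := le_lt_trans (normr_coord_le_enorm (x - c) i) xr.
  by rewrite !mxE ltr_norml => /andP[] ? ?; apply/andP; split; lra.
Qed.

(** Allows dividing by the constant of the Hausdorff gauge. The ball contains a cube of side
    [1 / (N + 1)], whose points have [enorm] at most [N / (N + 1) < 1], also when [N = 0].
    Finiteness matters as well, because [fine] would send +oo to 0. *)
Lemma unit_ball_volume_gt0 (R : realType) (N : nat) :
  0 < @unit_ball_volume R N.
Proof.
pose e : 'rV[R]_N := const_mx (N.+1%:R^-1).
have ub := @lebN_eball_le R N 0 1 ler01.
have lb : ((N.+1%:R^-1 ^+ N)%:E <= lebN R N (eball 0 1))%E.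
  have := @lebN_box R N 0 e.
  rewrite (eq_bigr (fun=> N.+1%:R^-1)); last by move=> i _; rewrite !mxE subr0.
  rewrite prodr_const card_ord => <-; last by move=> i; rewrite !mxE.
  apply: le_measure; rewrite ?inE.
  - exact: measurable_box.
  - exact/measurable_open/open_eball.
  move=> x xe; rewrite /eball/= subr0.
  apply: (le_lt_trans (ler_enorm_sum x)).
  apply: (@le_lt_trans _ _ (\sum_(i < N) N.+1%:R^-1)).
    by apply: ler_sum => i _; have := xe i; rewrite !mxE => /andP[x0]; rewrite ger0_norm.
  rewrite sumr_const card_ord -[_ *+ _]mulr_natr mulrC ltr_pdivrMr// mul1r ltr_nat//.
rewrite /unit_ball_volume fine_gt0//; apply/andP; split.
  by apply: lt_le_trans lb; rewrite lte_fin exprn_gt0.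
exact: le_lt_trans ub (ltry _).
Qed.

Lemma open_obox (R : realType) (N : nat) (a b : 'rV[R]_N) : open (obox a b).
Proof.
rewrite openE => x xab; rewrite /interior.
apply: (@filter_forall _ _ (fun i => [set y : 'rV[R]_N | a 0 i < y 0 i < b 0 i])
  (nbhs x) (nbhs_filter x)) => i.
have /andP[ax xb] := xab i.
have ci := @continuous_coord R N i x.
near=> y; apply/andP; split; near: y.
  by apply: (ci [set t | a 0 i < t]); exact: lt_nbhsr.
by apply: (ci [set t | t < b 0 i]); exact: lt_nbhsl.
Unshelve. all: end_near. Qed.

(** Replaces a box of a covering by an open one: the volume of the box enlarged by [t] on every side
    is continuous in [t]. *)
Lemma box_volume_fattening (R : realType) (N : nat) (A : set 'rV[R]_N) (e : R) :
  0 < e -> exists U, [/\ open U, A `<=` U &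
  (lebN R N U <= box_volume A + e%:E)%E].
Proof.
move=> e0; have [->|Aoo|[a [b [ab AE]]]] := box_volume_cases A.
- exists set0; split=> //.
  by rewrite measure0 adde_ge0 ?box_volume_ge0// lee_fin ltW.
- by exists setT; split=> //; [exact: openT|rewrite Aoo addye ?leey].
pose vol (t : R) : R := \prod_(i < N) ((b 0 i - a 0 i) + 2 * t).
have cvol : continuous vol.
  rewrite /vol; elim: (index_enum _) => [|i s ih].
    by under eq_fun do rewrite big_nil; exact: continuous_cst.
  under eq_fun do rewrite big_cons.
  apply: continuous_mul => //; apply: continuous_add; first exact: continuous_cst.
  apply: continuous_mul; first exact: continuous_cst.
  by move=> t; exact: cvg_id.
have /nbhs_ballP[d /= d0 dvol] : nbhs (0 : R) [set t | vol t < vol 0 + e].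
  by apply: (cvol 0 [set t | t < vol 0 + e]); apply: lt_nbhsl; rewrite ltrDl.
pose t := d / 2; have t0 : 0 < t by rewrite divr_gt0.
have vt : vol t < vol 0 + e.
  by apply: dvol; rewrite /ball/= sub0r normrN gtr0_norm// /t ltr_pdivrMr// ltr_pMr// ltr1n.
pose c : 'rV[R]_N := const_mx t.
have acb i : (a - c) 0 i <= (b + c) 0 i by rewrite !mxE; have := ab i; lra.
exists (obox (a - c) (b + c)); split; first exact: open_obox.
  rewrite AE => x xab i; rewrite !mxE; have /andP[ax xb] := xab i.
  by apply/andP; split; lra.
apply: (@le_trans _ _ (lebN R N (box (a - c) (b + c)))).
  apply: le_measure; rewrite ?inE.
  - exact: measurable_obox.
  - exact: measurable_box.
  - by move=> x xab i; have /andP[/ltW -> /ltW ->] := xab i.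
rewrite lebN_box// AE box_volumeE// -EFinD lee_fin.
rewrite (eq_bigr (fun i => (b 0 i - a 0 i) + 2 * t)); last first.
  by move=> i _; rewrite !mxE; ring.
rewrite (eq_bigr (fun i => (b 0 i - a 0 i) + 2 * 0) (F1 := fun i => b 0 i - a 0 i)); last first.
  by move=> i _; rewrite mulr0 addr0.
exact: ltW.
Qed.

Lemma lebN_open_regular (R : realType) (N : nat) (A : set 'rV[R]_N) (e : R) :
  (lebN R N A < +oo)%E -> 0 < e ->
  exists U, [/\ open U, A `<=` U & (lebN R N U <= lebN R N A + e%:E)%E].
Proof.
move=> Afin e0.
have e20 : 0 < e / 2 by rewrite divr_gt0.
have Afn : lebN R N A \is a fin_num by rewrite ge0_fin_numE.
have [_ [F AF <-] Fe] := lb_ereal_inf_adherent e20 Afn.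
(* Half of [e] pays for the covering, the other half is spread geometrically over the
   enlargements. *)
have ek0 k : 0 < e / 2 / (2 ^ k.+1)%:R by rewrite divr_gt0// ltr0n expn_gt0.
pose fat k (U : set 'rV[R]_N) := [/\ open U, F k `<=` U &
  (lebN R N U <= box_volume (F k) + (e / 2 / (2 ^ k.+1)%:R)%:E)%E].
have [U UP] : {U & forall k, fat k (U k)}.
  by apply: (@choice _ _ fat) => k; exact: box_volume_fattening.
exists (\bigcup_k U k); split.
- by apply: bigcup_open => k _; have [] := UP k.
- by move=> x /AF[k _ Fx]; exists k => //; have [_ + _] := UP k; apply.
apply: (@le_trans _ _ (\sum_(k <oo) lebN R N (U k))%E).
  by apply: outer_measure_sigma_subadditive.
apply: (@le_trans _ _ (\sum_(k <oo) (box_volume (F k) + (e / 2 / (2 ^ k.+1)%:R)%:E))%E).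
  by apply: lee_nneseries => // k _; have [] := UP k.
apply: (le_trans (epsilon_trick xpredT _ _)).
- by move=> k; exact: box_volume_ge0.
- exact: ltW.
rewrite [X in (_ <= _ + X)%E](_ : _ = (e / 2)%:E + (e / 2)%:E)%E; last first.
  by rewrite -EFinD -splitr.
by rewrite addeA leeD2r// ltW.
Qed.

(** * Differential calculus for the classes C^k *)

(** Restriction to a line reduces a directional derivative to one variable. The chain rule with an
    outer function on the reals then holds without total differentiability. *)
Lemma is_derive_lineP (R : realType) (N : nat) (f : 'rV[R]_N -> R) x v (df : R) :
  is_derive x v f df <-> is_derive (0 : R) 1 (fun s : R => f (s *: v + x)) df.
Proof.
have E : (fun h : R => h^-1 *: ((f \o shift x) (h *: v) - f x)) =
  (fun h : R => h^-1 *: (((fun s : R => f (s *: v + x)) \o shift 0) (h *: (1:R)) -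
    (fun s : R => f (s *: v + x)) 0)).
  by apply/funext => h /=; rewrite scale0r add0r addr0 [h *: 1]mulr1.
split=> -[d e]; split.
- by rewrite /derivable -E.
- by rewrite /derive -E.
- by rewrite /derivable E.
- by rewrite /derive E.
Qed.

Lemma is_derive_compose (R : realType) (N : nat) (f : 'rV[R]_N -> R)
    (h : R -> R) x v (df dh : R) :
  is_derive x v f df -> is_derive (f x) 1 h dh ->
  is_derive x v (fun y => h (f y)) (dh * df).
Proof.
move=> /is_derive_lineP df1 dh1; apply/is_derive_lineP.
apply: (@is_derive1_comp _ h (fun s : R => f (s *: v + x)) 0) => //.
by rewrite scale0r add0r.
Qed.

(** One-variable counterpart of [isC], for the outer functions of [isC_compose]. The derivative is a
    witness, so that it can be given by a formula. *)
Fixpoint smooth1 (R : realType) (k : nat) (h : R -> R) : Prop :=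
  continuous h /\
  if k is k'.+1 then
    exists h', (forall t : R, is_derive t 1 h (h' t)) /\ smooth1 k' h'
  else True.

Lemma smooth1_add (R : realType) (f g : R -> R) k :
  smooth1 k f -> smooth1 k g -> smooth1 k (fun t => f t + g t).
Proof.
elim: k f g => [|k ih] f g [cf Df] [cg Dg]; split; try exact: continuous_add.
  by [].
have [f' [ff' sf']] := Df; have [g' [gg' sg']] := Dg.
exists (fun t => f' t + g' t); split; last exact: ih.
by move=> t; exact: is_deriveD.
Qed.

Lemma smooth1_scale (R : realType) (f : R -> R) (c : R) k :
  smooth1 k f -> smooth1 k (fun t => c * f t).
Proof.
elim: k f => [|k ih] f [cf Df]; split; try by apply: continuous_mul => //; exact: continuous_cst.
  by [].
have [f' [ff' sf']] := Df.
exists (fun t => c * f' t); split; last exact: ih.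
by move=> t; exact: is_deriveZ.
Qed.

Lemma isC_le (R : realType) (N : nat) k (f : 'rV[R]_N -> R) : isC k.+1 f -> isC k f.
Proof.
elim: k f => [|k ih] f [cf Df]; split=> // i; split; first by have [] := Df i.
by apply: ih; have [] := Df i.
Qed.

Lemma isCS (R : realType) (N : nat) k (f : 'rV[R]_N -> R) (f' : 'I_N -> 'rV[R]_N -> R) :
  continuous f -> (forall i x, is_derive x (delta_mx 0 i) f (f' i x)) ->
  (forall i, isC k (f' i)) -> isC k.+1 f.
Proof.
move=> cf Df Cf'; split=> // i; split; first by move=> x; have [] := Df i x.
rewrite (_ : partial i f = f' i)//; apply/funext => x.
by have [_ <-] := Df i x.
Qed.

Lemma isCP (R : realType) (N : nat) k (f : 'rV[R]_N -> R) : isC k.+1 f ->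
  forall i x, is_derive x (delta_mx 0 i) f (partial i f x).
Proof. by move=> [_ Df] i x; apply: derivableP; have [] := Df i. Qed.

Lemma isC_continuous (R : realType) (N : nat) k (f : 'rV[R]_N -> R) :
  isC k f -> continuous f.
Proof. by case: k => [|k] []. Qed.

Lemma isC_cst (R : realType) (N : nat) (c : R) k : isC k (fun _ : 'rV[R]_N => c).
Proof.
elim: k c => [|k ih] c; first by split=> //; exact: continuous_cst.
have D i x : is_derive x (delta_mx 0 i) (fun _ : 'rV[R]_N => c) 0.
  exact: is_derive_cst.
by apply: (isCS _ D) => [|i]; [exact: continuous_cst|exact: ih].
Qed.

Lemma is_derive_coord (R : realType) (N : nat) (i j : 'I_N) (x : 'rV[R]_N) :
  is_derive x (delta_mx 0 j) (fun y => y 0 i) ((i == j)%:R : R).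
Proof.
apply/is_derive_lineP.
rewrite (_ : (fun s : R => _) = (fun s : R => (i == j)%:R * s + x 0 i)); last first.
  by apply/funext => s; rewrite !mxE eqxx mulrC.
rewrite -[X in is_derive _ _ _ X]addr0; apply: is_deriveD.
rewrite -[X in is_derive _ _ _ X]mulr1.
have := @is_deriveZ R R^o R^o id ((i == j)%:R) 0 1 1 (is_derive_id _ _).
exact.
Qed.

Lemma isC_coord (R : realType) (N : nat) (i : 'I_N) k :
  isC k (fun y : 'rV[R]_N => y 0 i).
Proof.
case: k => [|k]; first by split=> //; exact: continuous_coord.
apply: (isCS _ (is_derive_coord i)) => [|j]; first exact: continuous_coord.
exact: isC_cst.
Qed.

Lemma isC_add (R : realType) (N : nat) k (f g : 'rV[R]_N -> R) :
  isC k f -> isC k g -> isC k (fun x => f x + g x).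
Proof.
elim: k f g => [|k ih] f g Cf Cg.
  by split=> //; apply: continuous_add; [have [] := Cf|have [] := Cg].
have D i x : is_derive x (delta_mx 0 i) (fun x => f x + g x)
    (partial i f x + partial i g x).
  by have := isCP Cf i x; have := isCP Cg i x => dg df; exact: is_deriveD.
apply: (isCS _ D) => [|i].
- by apply: continuous_add; [have [] := Cf|have [] := Cg].
- by apply: ih; [have [_ /(_ i)[]] := Cf|have [_ /(_ i)[]] := Cg].
Qed.

Lemma isC_mul (R : realType) (N : nat) k (f g : 'rV[R]_N -> R) :
  isC k f -> isC k g -> isC k (fun x => f x * g x).
Proof.
elim: k f g => [|k ih] f g Cf Cg.
  by split=> //; apply: continuous_mul; [have [] := Cf|have [] := Cg].
have D i x : is_derive x (delta_mx 0 i) (fun x => f x * g x)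
    (f x * partial i g x + g x * partial i f x).
  by have := isCP Cf i x; have := isCP Cg i x => dg df; exact: is_deriveM.
apply: (isCS _ D) => [|i].
- by apply: continuous_mul; [have [] := Cf|have [] := Cg].
- by apply: isC_add; apply: ih => //; try exact: isC_le;
    [have [_ /(_ i)[]] := Cg|have [_ /(_ i)[]] := Cf].
Qed.

Lemma isC_compose (R : realType) (N : nat) k (f : 'rV[R]_N -> R) (h : R -> R) :
  isC k f -> smooth1 k h -> isC k (fun x => h (f x)).
Proof.
elim: k f h => [|k ih] f h Cf Ch.
  by split=> //; apply: continuous_compose; [have [] := Cf|have [] := Ch].
have [ch [h' [hh' sh']]] := Ch.
have D i x : is_derive x (delta_mx 0 i) (fun x => h (f x))
    (h' (f x) * partial i f x).
  by have := isCP Cf i x => df; exact: is_derive_compose.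
apply: (isCS _ D) => [|i].
- by apply: continuous_compose => //; have [] := Cf.
- apply: isC_mul; last by have [_ /(_ i)[]] := Cf.
  by apply: ih => //; exact: isC_le.
Qed.

Lemma isC_sum (R : realType) (N : nat) k (I : Type) (s : seq I)
    (f : I -> 'rV[R]_N -> R) :
  (forall i, isC k (f i)) -> isC k (fun x => \sum_(i <- s) f i x).
Proof.
move=> Cf; elim: s => [|i s ih].
  rewrite (_ : (fun x => _) = fun=> 0); first exact: isC_cst.
  by apply/funext => x; rewrite big_nil.
rewrite (_ : (fun x => _) = fun x => f i x + \sum_(j <- s) f j x).
  exact: isC_add.
by apply/funext => x; rewrite big_cons.
Qed.

Lemma isC_prod (R : realType) (N : nat) k (I : Type) (s : seq I)
    (f : I -> 'rV[R]_N -> R) :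
  (forall i, isC k (f i)) -> isC k (fun x => \prod_(i <- s) f i x).
Proof.
move=> Cf; elim: s => [|i s ih].
  rewrite (_ : (fun x => _) = fun=> 1); first exact: isC_cst.
  by apply/funext => x; rewrite big_nil.
rewrite (_ : (fun x => _) = fun x => f i x * \prod_(j <- s) f j x).
  exact: isC_mul.
by apply/funext => x; rewrite big_cons.
Qed.

(** * The function exp(-1/t) and smooth steps *)

(** The case [n = 0] is the classical flat function [exp(-1/t)]. The powers of [1/t] make the linear
    span of the family stable under differentiation, whence smoothness by induction on the order. *)
Definition expinv (R : realType) (n : nat) (t : R) : R :=
  if 0 < t then t^-1 ^+ n * expR (- t^-1) else 0.

Lemma expinv_le0 (R : realType) n (t : R) : t <= 0 -> expinv n t = 0.
Proof. by rewrite /expinv ltNge => ->. Qed.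

Lemma expinv_ge0 (R : realType) n (t : R) : 0 <= expinv n t.
Proof.
rewrite /expinv; case: ifPn => // t0.
by rewrite mulr_ge0 ?expR_ge0// exprn_ge0// invr_ge0 ltW.
Qed.

Lemma expinv_gt0 (R : realType) n (t : R) : 0 < t -> 0 < expinv n t.
Proof.
move=> t0; rewrite /expinv t0 mulr_gt0 ?expR_gt0// exprn_gt0// invr_gt0//.
Qed.

(** With [s = 1/t] this is [s^n / n! <= exp s], a single term of the exponential series. *)
Lemma expinv_bound (R : realType) n (t : R) : expinv n t <= n`!%:R.
Proof.
rewrite /expinv; case: ifPn => // t0.
have s0 : 0 <= t^-1 by rewrite invr_ge0 ltW.
rewrite expRN ler_pdivrMr ?expR_gt0//.
case: n => [|n]; first by rewrite expr0 fact0 mul1r -expR0 ler_expR.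
rewrite -ler_pdivrMl ?ltr0n ?fact_gt0// mulrC.
by apply: le_trans (expR_ge1Dxn n s0); rewrite lerDr.
Qed.

Lemma expinv0_le1 (R : realType) (t : R) : expinv 0 t <= 1.
Proof. exact: (expinv_bound 0). Qed.

Lemma expinv_mulS (R : realType) n (t : R) : expinv n t = t * expinv n.+1 t.
Proof.
rewrite /expinv; case: ifPn => [t0|_]; last by rewrite mulr0.
by rewrite exprS !mulrA divff ?mul1r// gt_eqF.
Qed.

Lemma expinv_le (R : realType) n (t : R) : `|expinv n t| <= (n.+1)`!%:R * `|t|.
Proof.
rewrite expinv_mulS normrM mulrC ler_wpM2r// ger0_norm ?expinv_ge0//.
exact: expinv_bound.
Qed.

Lemma is_derive_expinv (R : realType) n (t : R) :
  is_derive t 1 (expinv n) (- n%:R * expinv n.+1 t + expinv n.+2 t).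
Proof.
have [t0|t0|->] := ltgtP t 0.
- rewrite !expinv_le0 ?(ltW t0)// mulr0 addr0.
  apply: (@near_eq_is_derive _ _ _ (cst 0)).
  near=> s; rewrite expinv_le0//; near: s.
  by apply: filterS (lt_nbhsl t0) => s /ltW.
- have NE : \near t, (fun s => s^-1 ^+ n * expR (- s^-1)) t = expinv n t.
    by near=> s; rewrite /expinv ifT//; near: s; exact: lt_nbhsr.
  have tn0 : t != 0 by rewrite gt_eqF.
  have d1 : is_derive t 1 (fun s : R => s^-1) (- t ^- 2 *: 1).
    exact: (@is_deriveV R id).
  have d2 : is_derive t 1 (fun s : R => - s^-1) (- (- t ^- 2 *: 1)).
    exact: is_deriveN.
  have d3 := @is_derive1_comp R expR (fun s : R => - s^-1) t _ _
    (is_derive_expR _) d2.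
  have d4 := @is_deriveX R R^o (fun s : R => s^-1) n t 1 _ d1.
  have d5 := is_deriveM d4 d3.
  have E : (fun s : R => s^-1) ^+ n * (expR \o (fun s : R => - s^-1)) =
      (fun s : R => s^-1 ^+ n * expR (- s^-1)).
    by apply/funext => s; rewrite /= exprfctE.
  rewrite E in d5; have := near_eq_is_derive NE d5.
  rewrite [X in is_derive _ _ _ X -> _](_ : _ = - n%:R * expinv n.+1 t + expinv n.+2 t)//.
  clear -t0 tn0; rewrite /expinv t0 /= /GRing.scale/= exprfctE.
  by case: n => [|n]; rewrite /= ?expr0 ?exprS; field.
- rewrite !expinv_le0// mulr0 addr0.
  have c : h^-1 *: ((expinv n \o shift (0:R)) (h *: (1:R)) - expinv n (0:R)) @[h --> (0:R)^'] --> (0:R).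
    rewrite expinv_le0//=.
    under eq_fun => h do rewrite subr0 addr0 [h *: 1]mulr1.
    apply/cvgr0Pnorm_le => e e0; near=> h.
    have hn0 : h != 0 by near: h; exact: nbhs_dnbhs_neq.
    (* The difference quotient at 0 is [expinv n.+1 h], which is at most [(n + 2)! |h|]. *)
    rewrite expinv_mulS [_ *: _]mulrA mulVf// mul1r.
    apply: (le_trans (expinv_le _ _)).
    rewrite -ler_pdivlMl ?ltr0n ?fact_gt0//.
    near: h; apply: dnbhs0_le; by rewrite mulr_gt0// invr_gt0 ltr0n fact_gt0.
  split; first by apply/cvg_ex; exists 0.
  exact: cvg_lim c.
Unshelve. all: end_near. Qed.

Lemma continuous_expinv (R : realType) n : continuous (@expinv R n).
Proof.
move=> t; apply/differentiable_continuous/derivable1_diffP.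
by have [] := is_derive_expinv n t.
Qed.

Lemma smooth1_expinv (R : realType) k n : smooth1 k (@expinv R n).
Proof.
elim: k n => [|k ih] n; split=> //; try exact: continuous_expinv.
exists (fun t => - n%:R * expinv n.+1 t + expinv n.+2 t); split.
  exact: is_derive_expinv.
by apply: smooth1_add => //; apply: smooth1_scale.
Qed.

Lemma is_derive_expinv0 (R : realType) (t : R) :
  is_derive t 1 (expinv 0) (expinv 2 t).
Proof.
by have := is_derive_expinv 0 t; rewrite oppr0 mul0r add0r.
Qed.

Lemma expinv0_le (R : realType) (s t : R) : s <= t -> expinv 0 s <= expinv 0 t.
Proof.
move=> st; rewrite /expinv; case: ifPn => s0; last exact: expinv_ge0.
rewrite (lt_le_trans s0 st) !expr0 !mul1r ler_expR lerN2 lef_pV2//.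
by rewrite posrE (lt_le_trans s0 st).
Qed.

(* In the variable 1/t this is the decrease of [s^2 exp(-s)] for [s >= 2]. *)
Lemma expinv2_le (R : realType) (s t : R) : s <= t -> t <= 2^-1 ->
  expinv 2 s <= expinv 2 t.
Proof.
move=> st t2; rewrite /expinv; case: ifPn => s0; last exact: expinv_ge0.
have t0 := lt_le_trans s0 st; rewrite t0.
set x := t^-1; set y := s^-1.
have x2 : 2 <= x by rewrite /x -[2]invrK lef_pV2// posrE.
have xy : x <= y by rewrite /x /y lef_pV2// posrE.
have x0 : 0 < x by rewrite invr_gt0.
have yE : y <= x * expR ((y - x) / 2).
  have := expR_ge1Dx ((y - x) / 2); rewrite -(ler_pM2l x0) => /(le_trans _); apply.
  by rewrite mulrDr mulr1; nra.
have : y ^+ 2 <= x ^+ 2 * expR (y - x).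
  have -> : expR (y - x) = expR ((y - x) / 2) ^+ 2.
    by rewrite expr2 -expRD -splitr.
  rewrite -exprMn ler_pXn2r ?nnegrE//; first by rewrite (le_trans (ltW x0)).
  by rewrite mulr_ge0 ?expR_ge0 ?ltW.
have -> : expR (y - x) = expR y * expR (- x) by rewrite expRD.
move=> H; rewrite [expR (- s^-1)]expRN -/y ler_pdivrMr ?expR_gt0//.
by apply: le_trans H _; rewrite mulrCA mulrC.
Qed.

(** Smooth transition from 0 for [t <= 0] to 1 for [t >= 1]. Compared with the usual quotient
    [f(t) / (f(t) + f(1 - t))], the nested form stays within sums, scalings and compositions. *)
Definition step (R : realType) (t : R) : R :=
  (expinv 0 (expinv 0 1))^-1 * expinv 0 (expinv 0 1 + - expinv 0 (1 + - t)).

Definition dstep (R : realType) (t : R) : R :=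
  (expinv 0 (expinv 0 1))^-1 *
  (expinv 2 (expinv 0 1 + - expinv 0 (1 + - t)) * expinv 2 (1 + - t)).

(** The factor 4 is [2! * 2!], from the bound of [expinv 2] in each of the two factors of
    [dstep]. *)
Definition dstep_max (R : realType) : R := (expinv 0 (expinv 0 (1 : R)))^-1 * 4.

Lemma step_cst_gt0 (R : realType) : 0 < (expinv 0 (expinv 0 (1 : R)))^-1.
Proof. by rewrite invr_gt0 expinv_gt0// expinv_gt0. Qed.

Lemma step_ge0 (R : realType) (t : R) : 0 <= step t.
Proof. by rewrite mulr_ge0 ?expinv_ge0// ltW// step_cst_gt0. Qed.

Lemma step_le1 (R : realType) (t : R) : step t <= 1.
Proof.
rewrite /step mulrC ler_pdivrMr ?mul1r; last by rewrite -invr_gt0 step_cst_gt0.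
by apply: expinv0_le; rewrite gerDl oppr_le0 expinv_ge0.
Qed.

Lemma step_eq0 (R : realType) (t : R) : t <= 0 -> step t = 0.
Proof.
move=> t0; rewrite /step [X in _ * X]expinv_le0 ?mulr0// subr_le0.
by apply: expinv0_le; lra.
Qed.

Lemma step_eq1 (R : realType) (t : R) : 1 <= t -> step t = 1.
Proof.
move=> t1; rewrite /step [expinv 0 (1 + - t)]expinv_le0; last by lra.
by rewrite oppr0 addr0 mulVf// gt_eqF// -invr_gt0 step_cst_gt0.
Qed.

Lemma dstep_ge0 (R : realType) (t : R) : 0 <= dstep t.
Proof. by rewrite !mulr_ge0 ?expinv_ge0// ltW// step_cst_gt0. Qed.

Lemma dstep_le (R : realType) (t : R) : dstep t <= dstep_max R.
Proof.
rewrite ler_wpM2l ?(ltW (step_cst_gt0 R))// (_ : 4 = 2 * 2); last by ring.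
by apply: ler_pM; rewrite ?expinv_ge0//; exact: (expinv_bound 2).
Qed.

Lemma dstep_eq0 (R : realType) (t : R) : 1 <= t -> dstep t = 0.
Proof.
by move=> t1; rewrite /dstep [expinv 2 (1 + - t)]expinv_le0 ?mulr0//; lra.
Qed.

Lemma is_derive_opp_add (R : realType) (c t : R) (f : R -> R) (df : R) :
  is_derive t 1 f df -> is_derive t 1 (fun s => c + - f s) (- df).
Proof.
move=> Df; rewrite -[- df]add0r; apply: is_deriveD.
Qed.

Lemma is_derive_step (R : realType) (t : R) : is_derive t 1 (@step R) (dstep t).
Proof.
have d1 := is_derive_opp_add 1 (is_derive_id t (1 : R)).
have d2 := @is_derive1_comp R (expinv 0) (fun s => 1 + - s) t _ _ (is_derive_expinv0 _) d1.
have d3 := is_derive_opp_add (expinv 0 (1 : R)) d2.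
have d4 := @is_derive1_comp R (expinv 0) (fun s => expinv 0 1 + - expinv 0 (1 + - s)) t _ _ (is_derive_expinv0 _) d3.
have d5 := @is_deriveZ R R^o R^o _ ((expinv 0 (expinv 0 (1 : R)))^-1) t 1 _ d4.
rewrite (_ : dstep t = (expinv 0 (expinv 0 1))^-1 *:
  (expinv 2 (expinv 0 1 + - expinv 0 (1 + - t)) * - (expinv 2 (1 + - t) * -1)))//.
by rewrite mulrN1 opprK.
Qed.

Lemma isC_step (R : realType) (N : nat) k (f : 'rV[R]_N -> R) :
  isC k f -> isC k (fun x => step (f x)).
Proof.
have CcB c (h : 'rV[R]_N -> R) : isC k h -> isC k (fun x => c + - h x).
  move=> Ch; apply: isC_add; first exact: isC_cst.
  rewrite (_ : (fun x => _) = fun x => -1 * h x).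
    by apply: isC_mul => //; exact: isC_cst.
  by apply/funext => x; rewrite mulN1r.
move=> Cf; apply: isC_mul; first exact: isC_cst.
apply: (@isC_compose _ _ _ (fun x => expinv 0 1 + - expinv 0 (1 + - f x)) (expinv 0)); last exact: smooth1_expinv.
apply: (CcB); apply: (@isC_compose _ _ _ (fun x => 1 + - f x) (expinv 0)); last exact: smooth1_expinv.
exact: CcB.
Qed.

Lemma isC_dotpB (R : realType) (N : nat) k (c : 'rV[R]_N) :
  isC k (fun x : 'rV[R]_N => dotp (x - c) (x - c)).
Proof.
apply: isC_sum => i.
have Ci : isC k (fun x : 'rV[R]_N => (x - c) 0 i).
  rewrite (_ : (fun x => _) = fun x : 'rV[R]_N => x 0 i + - c 0 i).
    by apply: isC_add; [exact: isC_coord|exact: isC_cst].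
  by apply/funext => x; rewrite !mxE.
exact: isC_mul.
Qed.

Lemma is_derive_dotpB (R : realType) (N : nat) (c : 'rV[R]_N) (x : 'rV[R]_N) i :
  is_derive x (delta_mx 0 i) (fun x : 'rV[R]_N => dotp (x - c) (x - c))
    (2 * (x - c) 0 i).
Proof.
apply/is_derive_lineP.
rewrite (_ : (fun s : R => _) =
  (fun s => (s + (x - c) 0 i) ^+ 2 + \sum_(j | j != i) (x - c) 0 j ^+ 2)); last first.
  apply/funext => s; rewrite /dotp (bigD1 i)//= !mxE !eqxx mulr1 addrA expr2; congr (_ + _).
  by apply: eq_bigr => j /negbTE ji; rewrite !mxE ji andbF mulr0 add0r expr2.
rewrite -[X in is_derive _ _ _ X]addr0; apply: is_deriveD.
have d1 : is_derive (0:R) 1 (fun s => s + (x - c) 0 i) (1 + 0).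
  exact: is_deriveD.
have := @is_deriveX R R^o (fun s => s + (x - c) 0 i) 2 0 1 _ d1.
by rewrite /GRing.scale/= addr0 mulr1 add0r expr1 -exprfctE.
Qed.

Lemma partial_step (R : realType) (N : nat) (f : 'rV[R]_N -> R) (x : 'rV[R]_N) i df :
  is_derive x (delta_mx 0 i) f df ->
  partial i (fun y => step (f y)) x = dstep (f x) * df.
Proof.
move=> Df; have [_] := is_derive_compose Df (is_derive_step (f x)); exact.
Qed.

(** * Cutoff functions near the sphere *)

(** Vanishes on the ball of centre [p.1] and radius [p.2], equals 1 outside the ball of twice the
    radius. The squared distance is smooth at the centre. *)
Definition ball_cutoff (R : realType) (N : nat) (p : 'rV[R]_N * R) (x : 'rV[R]_N) : R :=
  step (p.2 ^- 2 * dotp (x - p.1) (x - p.1) + - 1).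

Lemma isC_ball_cutoff (R : realType) (N : nat) k (p : 'rV[R]_N * R) :
  isC k (ball_cutoff p).
Proof.
apply: isC_step; apply: isC_add; last exact: isC_cst.
by apply: isC_mul; [exact: isC_cst|exact: isC_dotpB].
Qed.

Lemma ball_cutoff_eq0 (R : realType) (N : nat) (p : 'rV[R]_N * R) x :
  0 < p.2 -> enorm (x - p.1) <= p.2 -> ball_cutoff p x = 0.
Proof.
move=> p0 xp; apply: step_eq0; rewrite subr_le0 mulrC ler_pdivrMr ?exprn_gt0// mul1r.
by rewrite -sqr_enorm ler_pXn2r ?nnegrE ?enorm_ge0// ltW.
Qed.

Lemma ball_cutoff_far (R : realType) (N : nat) (p : 'rV[R]_N * R) x :
  0 < p.2 -> 2 * p.2 <= enorm (x - p.1) ->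
  1 <= p.2 ^- 2 * dotp (x - p.1) (x - p.1) + - 1.
Proof.
move=> p0 xp; rewrite lerBrDr mulrC ler_pdivlMr ?exprn_gt0//.
rewrite -sqr_enorm; apply: (@le_trans _ _ ((2 * p.2) ^+ 2)).
  by rewrite exprMn ler_wpM2r ?exprn_ge0 ?(ltW p0)//; lra.
by rewrite ler_pXn2r ?nnegrE ?enorm_ge0// mulr_ge0 ?ltW.
Qed.

(** The 4 is the factor 2 of the derivative of the square times the 2 of the doubled radius. *)
Lemma partial_ball_cutoff_le (R : realType) (N : nat) (p : 'rV[R]_N * R) x i :
  0 < p.2 ->
  `|partial i (ball_cutoff p) x| <=
    4 * dstep_max R / p.2 * \1_(eball p.1 (2 * p.2)) x.
Proof.
move=> p0.
have dq : is_derive x (delta_mx 0 i)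
   (fun x => p.2 ^- 2 * dotp (x - p.1) (x - p.1) + - 1)
   (p.2 ^- 2 * (2 * (x - p.1) 0 i) + 0).
  apply: is_deriveD; have d1 := is_derive_dotpB p.1 x i.
  exact: (@is_deriveZ R _ R^o _ (p.2 ^- 2) x _ _ d1).
rewrite /ball_cutoff (partial_step dq) addr0 indicE.
have [xin|xout] := ltP (enorm (x - p.1)) (2 * p.2); last first.
  rewrite dstep_eq0 ?mul0r ?normr0; last exact: ball_cutoff_far.
  by rewrite mulr_ge0// divr_ge0 ?(ltW p0)// mulr_ge0// (le_trans (dstep_ge0 0))// dstep_le.
rewrite mem_set// mulr1 normrM (ger0_norm (dstep_ge0 _)).
rewrite (_ : 4 * dstep_max R / p.2 = dstep_max R * (p.2 ^- 2 * (2 * (2 * p.2)))); last first.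
  by field; rewrite gt_eqF.
apply: ler_pM => //; [exact: dstep_ge0|exact: dstep_le|].
have p2 : 0 <= p.2 ^- 2 by rewrite invr_ge0 exprn_ge0// ltW.
rewrite normrM (ger0_norm p2) ler_wpM2l// normrM ger0_norm// ler_wpM2l//.
exact: le_trans (normr_coord_le_enorm _ _) (ltW xin).
Qed.

(** Leibniz' rule: in each term the undifferentiated factors lie between 0 and 1. *)
Lemma partial_prod_le (R : realType) (N : nat) (I : eqType) (s : seq I)
    (f : I -> 'rV[R]_N -> R) x i :
  (forall p, isC 1 (f p)) -> (forall p y, 0 <= f p y <= 1) ->
  `|partial i (fun y => \prod_(p <- s) f p y) x| <= \sum_(p <- s) `|partial i (f p) x|.
Proof.
move=> Cf f01; elim: s => [|p s ih].
  rewrite (_ : (fun y => _) = cst 1); last by apply/funext => y; rewrite big_nil.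
  by rewrite /partial derive_cst normr0 big_nil.
rewrite (_ : (fun y => _) = fun y => f p y * \prod_(q <- s) f q y); last first.
  by apply/funext => y; rewrite big_cons.
have d1 := isCP (Cf p) i x.
have d2 := isCP (isC_prod s Cf) i x.
have [_ E] := is_deriveM d1 d2.
rewrite big_cons [partial _ _ _]E addrC (le_trans (ler_normD _ _))//.
rewrite !normrM; apply: lerD.
  rewrite (ger0_norm (_ : 0 <= \prod_(q <- s) f q x)); last first.
    by apply: prodr_ge0 => q _; have /andP[] := f01 q x.
  by rewrite ler_piMl// prodr_ile1// => q _; exact: f01.
apply: le_trans ih; have /andP[f0 f1] := f01 p x.
by rewrite (ger0_norm f0) ler_piMl.
Qed.

Lemma closed_enorm_le (R : realType) (N : nat) (r : R) :
  closed [set x : 'rV[R]_N | enorm x <= r].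
Proof.
apply: (@closed_comp _ _ (@enorm R N) [set t | t <= r]); last exact: closed_le.
by move=> x _; exact: enorm_continuous.
Qed.

Lemma compact_enorm_le (R : realType) (N : nat) (r : R) :
  compact [set x : 'rV[R]_N | enorm x <= r].
Proof.
apply: (subclosed_compact (@closed_enorm_le R N r)).
  apply: (@rV_compact R N (fun=> `[- r, r]%classic)) => _.
  exact: segment_compact.
move=> x /= xr i; rewrite in_itv/= -ler_norml.
exact: le_trans (normr_coord_le_enorm x i) xr.
Qed.

(** On the compact part of the closed ball outside [U] the norm attains its maximum, and this is not
    [r] because [U] contains the sphere. *)
Lemma sphere_cover_annulus (R : realType) (N : nat) (U : set 'rV[R]_N) (r r0 : R) :
  r0 < r -> open U -> (forall y : 'rV[R]_N, enorm y = r -> U y) ->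
  exists2 r', r0 <= r' < r & forall y : 'rV[R]_N, r' < enorm y -> enorm y <= r -> U y.
Proof.
move=> r0r oU sU.
pose K := [set x : 'rV[R]_N | enorm x <= r] `&` ~` U.
have cK : compact K.
  apply: (@subclosed_compact _ K [set x | enorm x <= r]).
  - by apply: closedI; [exact: closed_enorm_le|exact: open_closedC].
  - exact: compact_enorm_le.
  - by move=> x [].
have [K0|/set0P K0] := eqVneq K set0.
  exists r0; first by rewrite lexx.
  move=> y _ yr; apply: contrapT => Uy.
  by have : K y by []; rewrite K0.
have [c cK' cmax] := EVT_max_rV K0 cK (continuous_subspaceT (@enorm_continuous R N)).
have [cr cU] := set_mem cK'.
have cr' : enorm c < r by rewrite lt_neqAle cr andbT; apply/eqP => /sU.
exists (Num.max r0 (enorm c)); first by rewrite le_max lexx/= gt_max r0r.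
move=> y; rewrite gt_max => /andP[_ cy] yr; apply: contrapT => Uy.
by have := cmax y (mem_set (conj yr Uy)); rewrite leNgt cy.
Qed.

(** The product of the ball cutoffs vanishes on an annulus inside the sphere, but not necessarily
    beyond it. A radial factor [kap] makes the support compact; it decreases only within the
    annulus, where the product is already 0, so its derivative costs nothing. *)
Lemma cutoff_of_cover (R : realType) (N : nat) (r r0 : R)
    (s : seq ('rV[R]_N * R)) :
  r0 < r -> 0 < r ->
  (forall p, p \in s -> 0 < p.2) ->
  (forall p, p \in s -> forall y, enorm y <= r0 -> 2 * p.2 <= enorm (y - p.1)) ->
  (forall y : 'rV[R]_N, enorm y = r -> exists2 p, p \in s & enorm (y - p.1) < p.2) ->
  exists chi : 'rV[R]_N -> R,
    [/\ test_function (eball 0 r) chi,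
        forall x, 0 <= chi x <= 1,
        forall x, enorm x <= r0 -> chi x = 1 &
        forall x i, eball 0 r x -> `|partial i chi x| <=
          \sum_(p <- s) 4 * dstep_max R / p.2 * \1_(eball p.1 (2 * p.2)) x].
Proof.
move=> r0r rp s0 sfar scov.
pose U := \bigcup_(p in [set p | p \in s]) eball p.1 p.2.
have oU : open U by apply: bigcup_open => p _; exact: open_eball.
(* The maximum with 0 makes [r1] nonnegative, as the comparison of squares requires, even if [r0] is
   negative. *)
have r0'r : Num.max r0 0 < r by rewrite gt_max r0r.
have [r1 /andP[r01 r1r] Ur1] : exists2 r', Num.max r0 0 <= r' < r &
    forall y : 'rV[R]_N, r' < enorm y -> enorm y <= r -> U y.
  by apply: sphere_cover_annulus => // y /scov[p ps yp]; exists p.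
have r10 : 0 <= r1 by apply: le_trans r01; rewrite le_max lexx orbT.
have r0r1 : r0 <= r1 by apply: le_trans r01; rewrite le_max lexx.
pose r2 := (r1 + r) / 2; have r12 : r1 < r2 by rewrite midf_lt.
have r2r : r2 < r by rewrite midf_lt.
have d0 : 0 < r2 ^+ 2 - r1 ^+ 2.
  by rewrite subr_gt0 ltr_pXn2r// nnegrE//; lra.
pose q (x : 'rV[R]_N) := (r2 ^+ 2 - r1 ^+ 2)^-1 * (r2 ^+ 2 + -1 * dotp (x - 0) (x - 0)).
pose kap x := step (q x).
pose P (x : 'rV[R]_N) := \prod_(p <- s) ball_cutoff p x.
have Cq k : isC k q.
  apply: isC_mul; first exact: isC_cst.
  apply: isC_add; first exact: isC_cst.
  by apply: isC_mul; [exact: isC_cst|exact: isC_dotpB].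
have Ckap k : isC k kap by exact: isC_step.
have CP k : isC k P by apply: isC_prod => p; exact: isC_ball_cutoff.
have qge1 x : enorm x <= r1 -> 1 <= q x.
  move=> xr1; rewrite /q mulrC ler_pdivlMr// mul1r subr0 -sqr_enorm mulN1r.
  by rewrite lerD2l lerN2 ler_pXn2r ?nnegrE ?enorm_ge0.
have P01 x : 0 <= P x <= 1.
  apply/andP; split; first by apply: prodr_ge0 => p _; exact: step_ge0.
  by apply: prodr_ile1 => // p _; rewrite step_ge0 step_le1.
have PU0 x : r1 < enorm x -> enorm x <= r -> P x = 0.
  move=> r1x xr; have [p /= ps xp] := Ur1 x r1x xr.
  by rewrite /P (big_rem p)//= ball_cutoff_eq0 ?mul0r ?s0// ltW.
exists (fun x => kap x * P x); split.
- split; first by move=> k; exact: isC_mul.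
  exists [set x | enorm x <= r2]; split; first exact: compact_enorm_le.
    by move=> x /= xr2; rewrite /eball/= subr0 (le_lt_trans xr2).
  move=> x /= /negP; rewrite -ltNge => xr2; rewrite /kap step_eq0 ?mul0r//.
  rewrite /q mulr_ge0_le0 ?invr_ge0 ?(ltW d0)// subr0 -sqr_enorm mulN1r subr_le0.
  by rewrite ler_pXn2r ?nnegrE ?enorm_ge0// ?ltW//; lra.
- move=> x; have /andP[P0 P1] := P01 x.
  by rewrite mulr_ge0 ?step_ge0//= mulr_ile1 ?step_ge0 ?step_le1.
- move=> x xr0; rewrite /kap step_eq1 ?mul1r; last exact/qge1/(le_trans xr0).
  rewrite /P big_seq big1// => p ps; apply: step_eq1.
  by apply: ball_cutoff_far; [exact: s0|exact: sfar].
- move=> x i; rewrite /eball/= subr0 => xr.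
  have d1 := isCP (Ckap 1%N) i x; have d2 := isCP (CP 1%N) i x.
  have [_ E] := is_deriveM d1 d2; rewrite [partial _ _ _]E.
  rewrite (_ : P x *: partial i kap x = 0); last first.
    have [xr1|r1x] := leP (enorm x) r1.
      rewrite /kap (partial_step (isCP (Cq 1%N) i x)) dstep_eq0 ?mul0r ?scaler0//.
      exact: qge1.
    by rewrite PU0 ?scale0r// ltW.
  rewrite addr0 /GRing.scale/= normrM (ger0_norm (step_ge0 _)).
  apply: (@le_trans _ _ `|partial i P x|).
    by rewrite ler_piMl// step_le1.
  apply: (le_trans (partial_prod_le s x i _ _)).
  + by move=> p; exact: isC_ball_cutoff.
  + by move=> p y; rewrite step_ge0 step_le1.
  rewrite big_seq [leRHS]big_seq; apply: ler_sum => p ps.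
  exact: partial_ball_cutoff_le (s0 p ps).
Qed.

(** * Essentially bounded functions and their integrals *)

Lemma Linfty_integrable d (T : measurableType d) (R : realType)
    (mu : {measure set T -> \bar R}) (D : set T) (f : T -> R) :
  measurable D -> (mu D < +oo)%E -> Linfty mu D f -> mu.-integrable D (EFin \o f).
Proof.
move=> mD Dfin [mf [M fM]]; apply/integrableP; split; first exact/measurable_EFinP.
apply: (@le_lt_trans _ _ (`|M|%:E * mu D)%E).
  apply: integral_le_bound => //; first exact/measurable_EFinP.
  apply: filterS fM => x fM Dx; rewrite lee_fin (le_trans (fM Dx))//.
  exact: ler_norm.
by rewrite lte_mul_pinfty.
Qed.

Lemma Linfty_cst d (T : measurableType d) (R : realType)
    (mu : {measure set T -> \bar R}) (D : set T) (c : R) : Linfty mu D (fun=> c).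
Proof. by split; [exact: measurable_cst|exists `|c|; exact: aeW]. Qed.

Lemma Linfty_add d (T : measurableType d) (R : realType)
    (mu : {measure set T -> \bar R}) (D : set T) (f g : T -> R) :
  Linfty mu D f -> Linfty mu D g -> Linfty mu D (fun x => f x + g x).
Proof.
move=> [mf [M fM]] [mg [K gK]]; split; first exact: measurable_funD.
exists (M + K); apply: filterS2 fM gK => x fM gK Dx.
by rewrite (le_trans (ler_normD _ _))// lerD ?fM ?gK.
Qed.

Lemma Linfty_mul d (T : measurableType d) (R : realType)
    (mu : {measure set T -> \bar R}) (D : set T) (f g : T -> R) :
  Linfty mu D f -> Linfty mu D g -> Linfty mu D (fun x => f x * g x).
Proof.
move=> [mf [M fM]] [mg [K gK]]; split; first exact: measurable_funM.
exists (M * K); apply: filterS2 fM gK => x fM gK Dx.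
by rewrite normrM ler_pM// ?fM ?gK.
Qed.

Lemma Linfty_opp d (T : measurableType d) (R : realType)
    (mu : {measure set T -> \bar R}) (D : set T) (f : T -> R) :
  Linfty mu D f -> Linfty mu D (fun x => - f x).
Proof.
move=> Lf; rewrite (_ : (fun x => _) = fun x => -1 * f x).
  by apply: Linfty_mul => //; exact: Linfty_cst.
by apply/funext => x; rewrite mulN1r.
Qed.

Lemma Linfty_sum d (T : measurableType d) (R : realType)
    (mu : {measure set T -> \bar R}) (D : set T) (I : Type) (s : seq I)
    (f : I -> T -> R) :
  (forall i, Linfty mu D (f i)) -> Linfty mu D (fun x => \sum_(i <- s) f i x).
Proof.
move=> Lf; elim: s => [|i s ih].
  rewrite (_ : (fun x => _) = fun=> 0); first exact: Linfty_cst.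
  by apply/funext => x; rewrite big_nil.
rewrite (_ : (fun x => _) = fun x => f i x + \sum_(j <- s) f j x).
  exact: Linfty_add.
by apply/funext => x; rewrite big_cons.
Qed.

Lemma ae_eq_Rintegral d (T : measurableType d) (R : realType)
    (mu : {measure set T -> \bar R}) (D : set T) (f g : T -> R) :
  measurable D -> measurable_fun D f -> measurable_fun D g ->
  {ae mu, forall x, D x -> f x = g x} ->
  \int[mu]_(x in D) f x = \int[mu]_(x in D) g x.
Proof.
move=> mD mf mg fg; rewrite /Rintegral; congr fine.
apply: ae_eq_integral => //; [exact/measurable_EFinP..|].
by apply: filterS fg => x fg Dx; rewrite fg.
Qed.

Lemma ae_le_Rintegral d (T : measurableType d) (R : realType)
    (mu : {measure set T -> \bar R}) (D : set T) (f g : T -> R) :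
  measurable D -> mu.-integrable D (EFin \o f) -> mu.-integrable D (EFin \o g) ->
  {ae mu, forall x, D x -> f x <= g x} ->
  \int[mu]_(x in D) f x <= \int[mu]_(x in D) g x.
Proof.
move=> mD If Ig fg; rewrite -subr_ge0 -RintegralB//.
have mf : measurable_fun D f by apply/measurable_EFinP; exact: measurable_int If.
have mg : measurable_fun D g by apply/measurable_EFinP; exact: measurable_int Ig.
have mgf : measurable_fun D (fun x => g x - f x) by exact: measurable_funB.
rewrite (@ae_eq_Rintegral _ _ _ mu D _ (fun x => `|g x - f x|))//.
- by apply: Rintegral_ge0.
- exact: measurableT_comp.
- by apply: filterS fg => x fg Dx; rewrite ger0_norm// subr_ge0 fg.
Qed.

(** * The fundamental lemma of the calculus of variations *)

(** At each point the value is eventually exactly that of the indicator, because a step reaches 1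
    once its argument does. For each [n] only [n] boxes are used, so that the support is compact. *)
Lemma open_test_approx (R : realType) (N : nat) (Omega V : set 'rV[R]_N) :
  open V -> V `<=` Omega ->
  exists phi : nat -> 'rV[R]_N -> R,
    [/\ forall n, test_function Omega (phi n),
        forall n x, 0 <= phi n x <= 1 &
        forall x, \forall n \near \oo, phi n x = \1_V x].
Proof.
move=> oV VO; have [P [a [b [VE bV]]]] := open_row_boxes oV.
pose t k (n : nat) (x : 'rV[R]_N) : R := (P k)%:R * \prod_(i < N)
  (step (n%:R * (x 0 i + - a k 0 i)) * step (n%:R * (b k 0 i + -1 * x 0 i))).
have t01 k n x : 0 <= t k n x <= 1.
  have p01 : 0 <= \prod_(i < N) (step (n%:R * (x 0 i + - a k 0 i)) *
      step (n%:R * (b k 0 i + -1 * x 0 i))) <= 1.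
    apply/andP; split.
      by apply: prodr_ge0 => i _; rewrite mulr_ge0 ?step_ge0.
    apply: prodr_ile1 => i _; rewrite mulr_ge0 ?step_ge0//=.
    by rewrite mulr_ile1 ?step_ge0 ?step_le1.
  by rewrite /t; case: (P k); rewrite ?mul0r ?lexx ?ler01 ?mul1r.
have t0 k n x : ~ (P k /\ box (a k) (b k) x) -> t k n x = 0.
  move=> Pkx; rewrite /t; case: (boolP (P k)) => Pk; last by rewrite mul0r.
  have /existsNP[i xi] : ~ box (a k) (b k) x by move=> bx; apply: Pkx.
  rewrite (bigD1 i)//=.
  have [xa|ax] := leP (x 0 i) (a k 0 i).
    by rewrite step_eq0 ?mul0r ?mulr0// mulr_ge0_le0// subr_le0.
  have [bx|xb] := leP (b k 0 i) (x 0 i).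
    by rewrite [X in _ * X * _]step_eq0 ?mulr0 ?mul0r ?mulr0// mulr_ge0_le0// mulN1r subr_le0.
  by case: xi; rewrite !ltW.
have Ct k n j : isC j (t k n).
  apply: isC_mul; first exact: isC_cst.
  apply: isC_prod => i; apply: isC_mul; apply: isC_step;
    (apply: isC_mul; first exact: isC_cst); apply: isC_add.
  - exact: isC_coord.
  - exact: isC_cst.
  - exact: isC_cst.
  - by apply: isC_mul; [exact: isC_cst|exact: isC_coord].
(* A smooth substitute for the maximum of the box functions: it is 1 as soon as one of them is, and
   0 where all are. *)
pose phi n x := 1 + -1 * \prod_(k <- iota 0 n) (1 + -1 * t k n x).
have f01 k n x : 0 <= 1 + -1 * t k n x <= 1.
  by have := t01 k n x; rewrite mulN1r => /andP[? ?]; apply/andP; split; lra.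
exists phi; split.
- move=> n; split.
    move=> j; apply: isC_add; first exact: isC_cst.
    apply: isC_mul; first exact: isC_cst.
    apply: isC_prod => k; apply: isC_add; first exact: isC_cst.
    by apply: isC_mul; first exact: isC_cst.
  exists (\big[setU/set0]_(k <- iota 0 n | P k) box (a k) (b k)); split.
  + apply: bigsetU_compact => k _.
    rewrite (_ : box _ _ = [set v | forall i, `[a k 0 i, b k 0 i]%classic (v ord0 i)]).
      apply: (@rV_compact R N (fun i => `[a k 0 i, b k 0 i]%classic)) => i.
      exact: segment_compact.
    by apply/seteqP; split=> x xab i; have := xab i; rewrite /= in_itv.
  + rewrite -bigcup_seq_cond; apply: bigcup_sub => k /= /andP[_ Pk].
    by apply: subset_trans VO; exact: bV.
  + rewrite -bigcup_seq_cond => x nx; rewrite /phi big_seq big1 ?mulr1 ?subrr// => k kn.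
    by rewrite t0 ?mulr0 ?addr0// => -[Pk kx]; apply: nx; exists k; rewrite //= kn.
- move=> n x; have p01 : 0 <= \prod_(k <- iota 0 n) (1 + -1 * t k n x) <= 1.
    apply/andP; split; first by apply: prodr_ge0 => k _; have /andP[] := f01 k n x.
    by apply: prodr_ile1 => k _; exact: f01.
  by rewrite /phi mulN1r; move: p01 => /andP[? ?]; apply/andP; split; lra.
- move=> x; have [xV|xV] := pselect (V x); last first.
    near=> n; rewrite indicE memNset// /phi big1 ?mulr1 ?subrr// => k _.
    by rewrite t0 ?mulr0 ?addr0// => -[Pk /(bV k Pk)].
  rewrite indicE mem_set//.
  have [k Pk kx] : (\bigcup_(k in [set k | P k]) obox (a k) (b k)) x by rewrite -VE.
  have big i : \forall n \near \oo, 1 <= n%:R * (x 0 i + - a k 0 i) /\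
      1 <= n%:R * (b k 0 i + -1 * x 0 i).
    have /andP[ax xb] := kx i.
    have xa0 : 0 < x 0 i - a k 0 i by rewrite subr_gt0.
    have bx0 : 0 < b k 0 i - x 0 i by rewrite subr_gt0.
    near=> n; rewrite mulN1r -!ler_pdivrMr//; split; near: n; exact: nbhs_infty_ger.
  have := @filter_forall _ _ (fun i => [set n : nat | 1 <= n%:R * (x 0 i + - a k 0 i) /\
      1 <= n%:R * (b k 0 i + -1 * x 0 i)]) \oo _ big => allbig.
  near=> n.
  have H : forall i, 1 <= n%:R * (x 0 i + - a k 0 i) /\
      1 <= n%:R * (b k 0 i + -1 * x 0 i) by near: n; exact: allbig.
  have tk1 : t k n x = 1.
    rewrite /t [P k](_ : _ = true)// mul1r big1// => i _.
    by have [h1 h2] := H i; rewrite !step_eq1// mulr1.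
  have kn : (k < n)%N by near: n; exact: nbhs_infty_gt.
  rewrite /phi (big_rem k) ?mem_iota ?add0n//= tk1 mulr1 subrr mul0r mulr0 addr0//.
Unshelve. all: end_near. Qed.

Lemma Rintegral_open_eq0 (R : realType) (N : nat) (Omega V : set 'rV[R]_N)
    (e : 'rV[R]_N -> R) :
  open Omega -> (lebN R N Omega < +oo)%E -> Linfty (lebN R N) Omega e ->
  (forall phi, test_function Omega phi ->
     \int[lebN R N]_(x in Omega) (e x * phi x) = 0) ->
  open V -> V `<=` Omega -> \int[lebN R N]_(x in V) e x = 0.
Proof.
move=> oO Ofin Le e0 oV VO.
have mO : measurable (Omega : set (lebT R N)) := measurable_open oO.
have mV : measurable (V : set (lebT R N)) := measurable_open oV.
have [phi [tphi phi01 cphi]] := open_test_approx oV VO.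
have Ie := Linfty_integrable mO Ofin Le.
have me : measurable_fun (Omega : set (lebT R N)) e by case: Le.
have mphi n : measurable_fun (Omega : set (lebT R N)) (phi n).
  by apply: measurable_continuous; have [/(_ 0%N)[]] := tphi n.
have Iephi n : (lebN R N).-integrable Omega (EFin \o (fun x => e x * phi n x)).
  have Lphi : Linfty (lebN R N) Omega (phi n).
    split; first exact: mphi.
    by exists 1; apply: aeW => x _; have /andP[p0 p1] := phi01 n x; rewrite ger0_norm.
  exact: (Linfty_integrable mO Ofin (Linfty_mul Le Lphi)).
have H1 n : measurable_fun (Omega : set (lebT R N)) (fun x => (e x * phi n x)%:E).
  exact/measurable_EFinP/measurable_funM.
have H2 : measurable_fun (Omega : set (lebT R N)) (fun x => (e x * \1_V x)%:E).
  apply/measurable_EFinP/measurable_funM => //.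
have H3 : {ae lebN R N, forall x, Omega x ->
    (e x * phi n x)%:E @[n --> \oo] --> (e x * \1_V x)%:E}.
  apply: aeW => x Ox; apply: cvg_near_cst.
  by near=> n; congr (e x * _)%:E; near: n; exact: cphi.
have H4 : (lebN R N).-integrable Omega (fun x => `|(e x)%:E|%E).
  exact: integrable_abse.
have H5 : {ae lebN R N, forall x n, Omega x ->
    (`|(e x * phi n x)%:E| <= `|(e x)%:E|)%E}.
  apply: aeW => x n Ox; rewrite /= lee_fin normrM; have /andP[p0 p1] := phi01 n x.
  by rewrite (ger0_norm p0) ler_piMr.
have [_ _ cv] := dominated_convergence mO H1 H2 H3 H4 H5.
have z n : (\int[lebN R N]_(x in Omega) (e x * phi n x)%:E = 0)%E.
  rewrite -[LHS]fineK; last exact: (integrable_fin_num mO (Iephi n)).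
  congr EFin; exact: (e0 _ (tphi n)).
have {cv} : (\int[lebN R N]_(x in Omega) (e x * \1_V x)%:E = 0)%E.
  move: cv; rewrite (_ : (fun n => _) = cst 0%E); last by apply/funext => n; exact: z.
  by move=> cv; apply: cvg_unique cv _; [exact: ereal_hausdorff|exact: cvg_cst].
have VI : Omega `&` V = V by apply/setIidPr.
rewrite /Rintegral -{2}VI integral_mkcondr => E.
rewrite (_ : (fun x => _) \_ V = (fun x => (e x * \1_V x)%:E)) ?E//.
apply/funext => x; rewrite patchE indicE; case: ifP => _; first by rewrite mulr1.
by rewrite mulr0.
Unshelve. all: end_near. Qed.

(** Let [A] be the superlevel set and [V] an open set between [A] and [Omega] with [V \ A] of
    measure at most [eps]. The integral of [e] over [V] vanishes, yet it is at least
    [delta |A| - M' eps]. *)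
Lemma Linfty_superlevel_eq0 (R : realType) (N : nat) (Omega : set 'rV[R]_N)
    (e : 'rV[R]_N -> R) (delta : R) :
  open Omega -> (lebN R N Omega < +oo)%E -> Linfty (lebN R N) Omega e ->
  (forall phi, test_function Omega phi ->
     \int[lebN R N]_(x in Omega) (e x * phi x) = 0) ->
  0 < delta ->
  (lebN R N).-negligible [set x | Omega x /\ delta <= e x].
Proof.
move=> oO Ofin Le e0 d0.
have mO : measurable (Omega : set (lebT R N)) := measurable_open oO.
pose A : set (lebT R N) := [set x | Omega x /\ delta <= e x].
have mA : measurable A.
  have := Le.1 mO _ (measurable_itv `[delta, +oo[); congr measurable.
  by apply/seteqP; split=> x [Ox]; rewrite /= in_itv/= andbT.
apply/negligibleP => //.
have AO : A `<=` Omega by move=> x [].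
have leO (B : set (lebT R N)) : measurable B -> B `<=` Omega -> (lebN R N B < +oo)%E.
  by move=> mB BO; apply: le_lt_trans Ofin; rewrite le_measure ?inE.
have Afin : (lebN R N A < +oo)%E by exact: leO.
have [_ [M eM]] := Le.
pose M' := `|M| + 1; have M'0 : 0 < M' by rewrite ltr_wpDl.
have key eps : 0 < eps -> delta * fine (lebN R N A) <= M' * eps.
  move=> eps0; have [U [oU AU Ueps]] := lebN_open_regular Afin eps0.
  pose V := U `&` Omega; have oV : open V by exact: openI.
  have VO : V `<=` Omega by move=> x [].
  have mV : measurable (V : set (lebT R N)) := measurable_open oV.
  have AV : A `<=` V by move=> x Ax; split; [exact: AU|exact: AO].
  have mVA : measurable (V `\` A : set (lebT R N)) by exact: measurableD.
  have IV : (lebN R N).-integrable V (EFin \o e).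
    by apply: (integrableS mO mV VO); exact: Linfty_integrable.
  have VE : V = A `|` (V `\` A) by rewrite setDUK.
  have := Rintegral_open_eq0 oO Ofin Le e0 oV VO.
  rewrite VE Rintegral_setU//; last 2 first.
  - by rewrite -VE.
  - by apply/disj_setPS => x [Ax [_]].
  have intA : delta * fine (lebN R N A) <= \int[lebN R N]_(x in A) e x.
    rewrite -Rintegral_cst//; apply: le_Rintegral => //.
    - exact: Linfty_integrable (Linfty_cst _ _ _).
    - exact: integrableS mV mA AV IV.
    - by move=> x [].
  have intD : - M' * fine (lebN R N (V `\` A)) <= \int[lebN R N]_(x in V `\` A) e x.
    rewrite -Rintegral_cst//; apply: ae_le_Rintegral => //.
    - apply: Linfty_integrable (Linfty_cst _ _ _) => //.
      by apply: leO => // x [/VO].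
    - by apply: (integrableS mV mVA _ IV) => x [].
    - apply: filterS eM => x eM [/VO Ox _]; have := eM Ox.
      by rewrite ler_norml /M' => /andP[+ _]; have := ler_norm M; lra.
  have muD : fine (lebN R N (V `\` A)) <= eps.
    rewrite -lee_fin fineK; last first.
      by rewrite ge0_fin_numE//; apply: leO => // x [/VO].
    rewrite measureD//; last exact: leO.
    have -> : V `&` A = A by apply/setIidPr.
    rewrite leeBlDl; last by rewrite ge0_fin_numE.
    apply: le_trans Ueps; rewrite le_measure ?inE//; first exact: measurable_open.
    by move=> x [].
  move=> I0; have : M' * fine (lebN R N (V `\` A)) <= M' * eps by rewrite ler_pM2l.
  by rewrite mulNr in intD; lra.
have a0 : 0 <= fine (lebN R N A) by exact: fine_ge0.
rewrite -[LHS]fineK ?ge0_fin_numE//; congr EFin; apply/eqP.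
rewrite eq_le a0 andbT leNgt; apply/negP => a1.
(* With this [eps] the estimate reads [delta |A| <= delta |A| / 2]. *)
have := key (delta * fine (lebN R N A) / (2 * M')).
rewrite divr_gt0 ?mulr_gt0// => /(_ isT).
rewrite (_ : M' * _ = delta * fine (lebN R N A) / 2); last by field; rewrite gt_eqF.
have : 0 < delta * fine (lebN R N A) by rewrite mulr_gt0.
by lra.
Qed.

(** Serves to identify the divergence [d] of [z] with [u - f] almost everywhere, both being weak
    divergences of [z]. *)
Lemma Linfty_test_eq0 (R : realType) (N : nat) (Omega : set 'rV[R]_N)
    (e : 'rV[R]_N -> R) :
  open Omega -> (lebN R N Omega < +oo)%E -> Linfty (lebN R N) Omega e ->
  (forall phi, test_function Omega phi ->
     \int[lebN R N]_(x in Omega) (e x * phi x) = 0) ->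
  {ae lebN R N, forall x, Omega x -> e x = 0}.
Proof.
move=> oO Ofin Le e0.
have mO : measurable (Omega : set (lebT R N)) := measurable_open oO.
have e0N phi : test_function Omega phi ->
    \int[lebN R N]_(x in Omega) (- e x * phi x) = 0.
  move=> tphi; under eq_Rintegral do rewrite mulNr -mulN1r.
  rewrite RintegralZl ?e0 ?mulr0//.
  have [Cphi [K [cK KO phiK]]] := tphi.
  have cphi : continuous phi by have [] := Cphi 0%N.
  suff Lphi : Linfty (lebN R N) Omega phi.
    exact: (Linfty_integrable mO Ofin (Linfty_mul Le Lphi)).
  split; first exact: measurable_continuous.
  have [K0|/set0P K0] := eqVneq K set0.
    by exists 0; apply: aeW => x _; rewrite phiK ?normr0// K0.
  have cn : continuous (fun x => `|phi x|).
    by apply: continuous_compose => //; exact: norm_continuous.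
  have [c _ cmax] := EVT_max_rV K0 cK (continuous_subspaceT cn).
  exists `|phi c|; apply: aeW => x _.
  have [Kx|/phiK ->] := pselect (K x); last by rewrite normr0.
  exact/cmax/mem_set.
have H n := Linfty_superlevel_eq0 (delta := n.+1%:R^-1) oO Ofin Le e0 ltac:(by []).
have HN n := Linfty_superlevel_eq0 (delta := n.+1%:R^-1) oO Ofin (Linfty_opp Le) e0N ltac:(by []).
have := negligibleU (negligible_bigcup H) (negligible_bigcup HN).
apply: negligibleS => x /= /not_implyP[Ox /eqP ex0].
have [n nx] : exists n, n.+1%:R^-1 <= `|e x|.
  have x0 : 0 < `|e x| by rewrite normr_gt0.
  exists (Num.truncn (`|e x|^-1)); rewrite -[leRHS]invrK lef_pV2 ?posrE ?invr_gt0//.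
  by rewrite ltW// truncnS_gt.
have [x0|x0] := leP 0 (e x).
  by left; exists n => //; split; rewrite // -(ger0_norm x0).
by right; exists n => //; split; rewrite // -(ltr0_norm x0).
Qed.

(** * Inequalities between signed measures *)

(** The measures are comparable only inside [D]. Adding to [m2] the restriction of [m1] to the
    complement of [D] makes them comparable everywhere and leaves integrals over [D] unchanged. *)
Lemma ge0_le_integral_measure_subset d (T : measurableType d) (R : realType)
    (m1 m2 : {measure set T -> \bar R}) (D : set T) (f : T -> \bar R) :
  measurable D ->
  (forall S, measurable S -> S `<=` D -> (m1 S <= m2 S)%E) ->
  (forall x, 0 <= f x)%E -> measurable_fun setT f ->
  (\int[m1]_(x in D) f x <= \int[m2]_(x in D) f x)%E.
Proof.
move=> mD m12 f0 mf; have mDc := measurableC mD.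
have mfD : measurable_fun D f by exact: measurable_funTS.
pose m3 := mrestr m1 mDc.
have z : (\int[m3]_(x in D) f x = 0)%E.
  apply: null_set_integral => //.
  by rewrite /= /mrestr setICr measure0.
rewrite -[leRHS]adde0 -z -ge0_integral_measure_add//.
apply: ge0_le_measure_integral => // S mS.
rewrite [X in (_ <= X)%E]measure_addE.
rewrite (measureDI m1 mS mD) addeC setDE leeD2r//.
apply: le_trans (m12 (S `&` D) _ _) _; first exact: measurableI.
  exact: subIsetr.
by rewrite le_measure ?inE//; exact: measurableI.
Qed.

(** The negative parts are moved across the inequality, which then compares the positive measures
    [p2 + n1] and [p1 + n2]. In this way two charges with unrelated Hahn decompositions can be
    compared. *)
Lemma le_Rintegral_measureB d (T : measurableType d) (R : realType)
    (p1 n1 p2 n2 : {finite_measure set T -> \bar R}) (D : set T) (f : T -> R) :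
  measurable D -> measurable_fun setT f -> (forall x, 0 <= f x) ->
  (exists M, forall x, f x <= M) ->
  (forall S, measurable S -> S `<=` D -> (p2 S - n2 S <= p1 S - n1 S)%E) ->
  \int[p2]_(x in D) f x - \int[n2]_(x in D) f x <=
  \int[p1]_(x in D) f x - \int[n1]_(x in D) f x.
Proof.
move=> mD mf f0 [M fM] pn.
have fin (m : {finite_measure set T -> \bar R}) : m.-integrable D (EFin \o f).
  apply: Linfty_integrable => //; first by rewrite ltey_eq fin_num_measure.
  split; first exact: measurable_funTS.
  by exists M; apply: aeW => x _; rewrite ger0_norm.
rewrite lerBlDr addrAC lerBrDr.
have alg (a b c e : \bar R) : a \is a fin_num -> b \is a fin_num ->
    c \is a fin_num -> e \is a fin_num -> (b - e <= a - c)%E -> (b + c <= a + e)%E.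
  move=> /fineK <- /fineK <- /fineK <- /fineK <-.
  by rewrite -!EFinB -!EFinD !lee_fin; lra.
have : (\int[measure_add p2 n1]_(x in D) (f x)%:E <=
    \int[measure_add p1 n2]_(x in D) (f x)%:E)%E.
  apply: ge0_le_integral_measure_subset => //.
  - move=> S mS SD; rewrite [leLHS]measure_addE [leRHS]measure_addE.
    by apply: alg; try exact: fin_num_measure; exact: pn.
  - exact/measurable_EFinP.
move=> I; have {I} I : (\int[p2]_(x in D) (f x)%:E + \int[n1]_(x in D) (f x)%:E <=
    \int[p1]_(x in D) (f x)%:E + \int[n2]_(x in D) (f x)%:E)%E.
  by rewrite -!integral_measure_add//; exact: fin.
rewrite /Rintegral -!fineD; last 4 first.
- exact: integrable_fin_num (fin _).
- exact: integrable_fin_num (fin _).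
- exact: integrable_fin_num (fin _).
- exact: integrable_fin_num (fin _).
apply: fine_le => //; rewrite fin_numD; apply/andP; split; exact: integrable_fin_num (fin _).
Qed.

Lemma normr_charge_integral_le (R : realType) (N : nat) (lam nu : signed_borel R N)
    (D : set 'rV[R]_N) (f : 'rV[R]_N -> R) :
  open D ->
  (forall B : set (borelT R N), measurable B -> B `<=` D -> (`|nu B| <= lam B)%E) ->
  continuous f -> (forall x, 0 <= f x) -> (exists M, forall x, f x <= M) ->
  `|charge_integral nu D f| <= charge_integral lam D f.
Proof.
move=> oD nulam cf f0 fM.
have mD : measurable (D : set (borelT R N)) by exact: sub_sigma_algebra.
have mf : measurable_fun (setT : set (borelT R N)) f.
  exact: measurable_borel_continuous.
rewrite /charge_integral.
move: (projT2 (cid (projT2 (cid (Hahn_decomposition nu))))) => hn.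
move: (projT2 (cid (projT2 (cid (Hahn_decomposition lam))))) => hl.
have dec (S : set (borelT R N)) : measurable S -> S `<=` D ->
  (`|jordan_pos hn S - jordan_neg hn S| <= jordan_pos hl S - jordan_neg hl S)%E.
  move=> mS SD; have := nulam S mS SD.
  by rewrite (jordan_decomp hn mS) (jordan_decomp hl mS) /cadd/= !cscaleN1.
have fn (S : set (borelT R N)) (m : {finite_measure set (borelT R N) -> \bar R}) : measurable S ->
  m S \is a fin_num by move=> mS; exact: fin_num_measure.
rewrite ler_norml lerNl opprB; apply/andP; split; apply: le_Rintegral_measureB => //.
- move=> S mS SD; apply: le_trans (dec S mS SD).
  rewrite -abseN fin_num_oppeB ?fn// addeC; exact: lee_abs.
- move=> S mS SD; apply: le_trans (dec S mS SD); exact: lee_abs.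
Qed.

(** Uses the partition of [B] into [B] and empty sets. It turns condition (1) into a scalar
    inequality for one component of the gradient measure. *)
Lemma le_total_variation (R : realType) (N : nat) (nu : 'I_N -> signed_borel R N)
    (i : 'I_N) (B : set (borelT R N)) :
  measurable B -> (`|nu i B| <= total_variation nu B)%E.
Proof.
move=> mB.
pose F k : set (borelT R N) := if k is 0%N then B else set0.
apply: (@le_trans _ _ (\sum_(k <oo) (enorm (\row_j fine (nu j (F k))))%:E)%E); last first.
  apply: ereal_sup_ubound; exists F => //; split.
  - by case=> [|k]; [exact: mB|exact: measurable0].
  - by apply/trivIsetP => -[|j] [|k] _ _ //=; rewrite ?setI0 ?set0I.
  - by apply/seteqP; split=> [x [[|k]]//|x Bx]; exists 0%N.
rewrite (@nneseriesD1 _ _ 0%N)//; last by move=> k _; rewrite lee_fin enorm_ge0.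
rewrite [X in (_ + X)%E]eseries0 ?adde0; last first.
  case=> // k _ _; rewrite (_ : \row_j _ = 0) ?enorm0//.
  by apply/rowP => j; rewrite !mxE /= charge0.
rewrite -[leLHS]fineK; last by rewrite fin_num_abs abse_id -fin_num_abs fin_num_measure.
rewrite lee_fin (_ : fine _ = `|fine (nu i B)|).
  by have := normr_coord_le_enorm (\row_j fine (nu j B)) i; rewrite mxE.
by rewrite -[in LHS](fineK (fin_num_measure (nu i) B mB)).
Qed.

(** * Vitali selection and coverings of Hausdorff null sets *)

Lemma seq_max_ex (R : realDomainType) (T : eqType) (f : T -> R) (s : seq T) :
  s != [::] -> exists2 q, q \in s & forall p, p \in s -> f p <= f q.
Proof.
elim: s => // a s ih _; have [->|s0] := eqVneq s [::].
  by exists a; [rewrite mem_head|move=> p; rewrite inE => /eqP ->].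
have [q qs qmax] := ih s0; have [aq|qa] := leP (f a) (f q).
  exists q; first by rewrite inE qs orbT.
  by move=> p; rewrite inE => /predU1P[->//|]; exact: qmax.
exists a; first by rewrite mem_head.
by move=> p; rewrite inE => /predU1P[->//|/qmax/le_trans]; apply; exact: ltW.
Qed.

(** Greedy choice of a largest radius, discarding everything that meets it. The relation is abstract
    because it will express the overlap of projections instead of balls. *)
Lemma vitali_finite (R : realDomainType) (T : eqType) (rad : T -> R)
    (meet : rel T) (s : seq T) :
  reflexive meet -> symmetric meet ->
  exists D : seq T, [/\ {subset D <= s}, pairwise (fun p q => ~~ meet p q) D &
    forall p, p \in s -> exists2 q, q \in D & meet p q && (rad p <= rad q)].
Proof.
move=> mr ms; have [n] := ubnP (size s); elim: n s => // n ih s.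
have [->|s0] := eqVneq s [::]; first by exists [::].
have [q qs qmax] := seq_max_ex rad s0.
pose s' := [seq p <- s | ~~ meet q p].
rewrite ltnS => sn.
have s'n : (size s' < n)%N.
  apply: leq_trans sn; rewrite size_filter -(count_predC (fun p => ~~ meet q p) s).
  rewrite -[ltnLHS]addn0 ltn_add2l -has_count; apply/hasP; exists q => //=.
  by rewrite mr.
have [D [Ds pD covD]] := ih s' s'n.
exists (q :: D); split.
- move=> p; rewrite inE => /predU1P[->//|/Ds]; rewrite mem_filter => /andP[] //.
- rewrite /= pD andbT; apply/allP => p /Ds; rewrite mem_filter => /andP[] //.
- move=> p ps; have [qp|qp] := boolP (meet q p).
    by exists q; [rewrite mem_head|rewrite ms qp qmax].
  have [|u uD up] := covD p; first by rewrite mem_filter qp.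
  by exists u => //; rewrite inE uD orbT.
Qed.

Lemma sum_measure_pairwise_le d (T : measurableType d) (R : realType)
    (mu : {measure set T -> \bar R}) (I : eqType) (F : I -> set T) (s : seq I)
    (r : rel I) (X : set T) :
  (forall p, measurable (F p)) -> measurable X ->
  (forall p, p \in s -> F p `<=` X) ->
  pairwise r s -> (forall p q, r p q -> F p `&` F q = set0) ->
  (\sum_(p <- s) mu (F p) <= mu X)%E.
Proof.
move=> mF + + + rF.
elim: s X => [|p s ih] X mX FX; first by rewrite big_nil.
rewrite /= => /andP[/allP ps rs]; rewrite big_cons.
have FpX : F p `<=` X by apply: FX; rewrite mem_head.
have -> : mu X = (mu (F p) + mu (X `\` F p))%E.
  by rewrite -{1}(setDUK FpX) measureU//; [exact: measurableD|rewrite setDIK].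
apply: leeD2l; apply: ih => //; first exact: measurableD.
move=> q qs x Fqx; split; first by apply: (FX q) => //; rewrite inE qs orbT.
by move=> Fpx; have : (F p `&` F q) x by []; rewrite rF// ps.
Qed.

(** A covering set of diameter [D] that meets [Z] at [c] lies in every ball of centre [c] and radius
    larger than [D]. Members that miss [Z] are dropped by [P], so that all the centres belong to
    [Z]. *)
Lemma hausdorff_null_cover (R : realType) (N s : nat) (Z : set 'rV[R]_N) (eps delta : R) :
  hausdorff_outer s Z = 0%E -> 0 < eps -> 0 < delta ->
  exists (P : pred nat) (c : nat -> 'rV[R]_N) (rho : nat -> R),
    [/\ forall k, P k -> Z (c k) /\ 0 < rho k <= delta,
        forall x, Z x -> exists2 k, P k & enorm (x - c k) < rho k &
        (\sum_(k <oo) (if P k then rho k ^+ s else 0)%:E <= eps%:E)%E].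
Proof.
move=> HZ e0 d0.
pose v := @unit_ball_volume R s.
have v0 : 0 < v by exact: unit_ball_volume_gt0.
(* The gauge of a nonempty set of admissible diameter [D] is [w D^s]. Half of [eps * w] pays for the
   covering, half for enlarging the radii. *)
pose w := v / 2 ^+ s.
have w0 : 0 < w by rewrite divr_gt0// exprn_gt0.
pose e1 := eps * w / 2; have e10 : 0 < e1 by rewrite divr_gt0// mulr_gt0.
have d20 : 0 < delta / 2 by rewrite divr_gt0.
have C0 : cover_outer (hausdorff_gauge s (delta / 2)) Z = 0%E.
  apply/eqP; rewrite eq_le cover_outer_ge0 ?andbT; last exact: hausdorff_gauge_ge0.
  by rewrite -HZ; apply: ereal_sup_ubound; exists (delta / 2).
have [_ [F ZF <-]] := @lb_ereal_inf_adherent R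
  [set \sum_(k <oo) hausdorff_gauge s (delta / 2) (A k) |
             A in [set A : (set 'rV[R]_N)^nat | Z `<=` \bigcup_k A k]]%E e1 e10 ltac:(by rewrite -/(cover_outer _ _) C0).
rewrite -/(cover_outer _ _) C0 add0e => Fe.
pose P k := `[< (F k `&` Z) !=set0 >].
have ek0 k : 0 < e1 / (2 ^ k.+1)%:R by rewrite divr_gt0// ltr0n expn_gt0.
pose Q k (p : 'rV[R]_N * R) := P k ->
  [/\ Z p.1, 0 < p.2 <= delta, F k `<=` eball p.1 p.2 &
   ((w * p.2 ^+ s)%:E <= hausdorff_gauge s (delta / 2) (F k) + (e1 / (2 ^ k.+1)%:R)%:E)%E].
have [p pQ] : {p & forall k, Q k (p k)}.
  apply: (@choice _ _ Q) => k.
  have [/asboolP[c [Fc Zc]]|nP] := boolP (P k); last first.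
    by exists (0, 0) => Pk; move: nP; rewrite Pk.
  have Fk0 : F k != set0 by apply/set0P; exists c.
  have gle : (hausdorff_gauge s (delta / 2) (F k) <= e1%:E)%E.
    apply: le_trans (ltW Fe).
    rewrite (@nneseriesD1 _ _ k)//; last by move=> *; exact: hausdorff_gauge_ge0.
    by rewrite leeDl// nneseries_ge0// => *; exact: hausdorff_gauge_ge0.
  have diam0 : (0 <= ediam (F k))%E.
    by apply: ereal_sup_ubound; exists (c, c) => //=; rewrite subrr enorm0.
  have [dk|dk] := leP (ediam (F k)) (delta / 2)%:E; last first.
    by move: gle; rewrite /hausdorff_gauge (negbTE Fk0) ifF ?leye_eq//; apply/negbTE; rewrite -ltNge.
  have dfin : ediam (F k) \is a fin_num by rewrite ge0_fin_numE// (le_lt_trans dk)// ltry.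
  pose D := fine (ediam (F k)).
  have D0 : 0 <= D by exact: fine_ge0.
  have Dd : D <= delta / 2 by rewrite -lee_fin fineK.
  have gE : hausdorff_gauge s (delta / 2) (F k) = (w * D ^+ s)%:E.
    rewrite /hausdorff_gauge (negbTE Fk0) dk; congr EFin.
    by rewrite /w expr_div_n -/v -/D mulrA mulrAC.
  pose eta := e1 / (2 ^ k.+1)%:R / w.
  have eta0 : 0 < eta by rewrite divr_gt0.
  have cX : continuous (fun t : R => t ^+ s) by exact: exprn_continuous.
  have /nbhs_ballP[h /= h0 hb] : nbhs D [set t | t ^+ s < D ^+ s + eta].
    by apply: (cX D [set t | t < D ^+ s + eta]); apply: lt_nbhsl; rewrite ltrDl.
  (* The increment makes the radius positive even for a single point. It is at most [delta / 2],
     like [D], and small enough to raise [D^s] by less than [eta]. *)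
  pose rho := D + Num.min (h / 2) (delta / 2).
  have m0 : 0 < Num.min (h / 2) (delta / 2) by rewrite lt_min !divr_gt0.
  have mh : Num.min (h / 2) (delta / 2) <= h / 2 by rewrite ge_min lexx.
  have md : Num.min (h / 2) (delta / 2) <= delta / 2 by rewrite ge_min lexx orbT.
  exists (c, rho) => _; split => //=.
  - by rewrite /rho; apply/andP; split; lra.
  - move=> x Fx; rewrite /eball/= (@le_lt_trans _ _ D)//; last by rewrite /rho ltrDl.
    rewrite -lee_fin /D fineK//; apply: ereal_sup_ubound; by exists (x, c).
  - rewrite gE -EFinD lee_fin -ler_pdivlMl// mulrDr mulrA mulVf ?gt_eqF// mul1r.
    rewrite [_^-1 * (e1 / _)]mulrC -/eta ltW//; apply: hb.
    by rewrite /ball/= /rho opprD addNKr normrN gtr0_norm//; lra.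
exists P, (fun k => (p k).1), (fun k => (p k).2); split.
- by move=> k /pQ[].
- move=> x Zx; have [k _ Fx] := ZF x Zx.
  have Pk : P k by apply/asboolP; exists x.
  by exists k => //; have [_ _ + _] := pQ k Pk; apply.
have -> : eps%:E = ((w^-1)%:E * (e1 + e1)%:E)%E.
  by rewrite -EFinM; congr EFin; rewrite /e1; field; rewrite gt_eqF.
apply: (@le_trans _ _ ((w^-1)%:E * \sum_(k <oo) (hausdorff_gauge s (delta / 2) (F k) + (e1 / (2 ^ k.+1)%:R)%:E))%E).
  have nn k : (0 <= hausdorff_gauge s (delta / 2) (F k) + (e1 / (2 ^ k.+1)%:R)%:E)%E.
    by rewrite adde_ge0 ?hausdorff_gauge_ge0// lee_fin ltW.
  rewrite -nneseriesZl//; apply: lee_nneseries => [k _ _|k _].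
    by rewrite lee_fin; case: ifPn => // /pQ[_ /andP[r0 _] _ _]; rewrite exprn_ge0// ltW.
  case: ifPn => [/pQ[_ _ _ H]|_]; last by rewrite mule_ge0// lee_fin invr_ge0 ltW.
  have wi : (0 <= (w^-1)%:E)%E by rewrite lee_fin invr_ge0 ltW.
  by have := lee_wpmul2l wi H; rewrite -EFinM mulrA mulVf ?gt_eqF// mul1r.
rewrite lee_wpmul2l// ?lee_fin ?invr_ge0 ?(ltW w0)//.
apply: (le_trans (epsilon_trick xpredT _ _)).
- by move=> k; exact: hausdorff_gauge_ge0.
- exact: ltW.
by rewrite EFinD leeD2r// ltW.
Qed.

(** * Covering the sphere by balls in which a set is thin *)

Section patch.
Context {R : realType} {N : nat}.
Implicit Types (i : 'I_N) (x y : 'rV[R]_N).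

(** Overlap of the projections along the axis [i] of the cubes with centres [x], [y] and half-sides
    [t x], [t y]. The equality keeps the relation reflexive where [t] is not positive. *)
Definition slab_meet i (t : 'rV[R]_N -> R) x y :=
  (x == y) || [forall j, (j != i) ==> (`|x 0 j - y 0 j| < t x + t y)].

Definition slab i x (t : R) : set 'rV[R]_N :=
  [set y | forall j, j != i -> `|x 0 j - y 0 j| < t].

(* A piece of the sphere of radius r on which all the coordinates but the i-th
   are bi-Lipschitz parameters. *)
Definition patch (r : R) i (sg : R) : set 'rV[R]_N :=
  [set x | enorm x = r /\ r <= N%:R * (sg * x 0 i)].

Lemma open_slab i x t : open (slab i x t).
Proof.
rewrite openE => y yt; rewrite /interior.
apply: (@filter_forall _ _ (fun j => [set y : 'rV[R]_N | j != i -> `|x 0 j - y 0 j| < t])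
  (nbhs y) (nbhs_filter y)) => j.
have [->|ji] := eqVneq j i; first by apply: nearW => z.
have cj : continuous (fun y : 'rV[R]_N => `|x 0 j - y 0 j|).
  apply: (@continuous_compose _ _ (fun y : 'rV[R]_N => x 0 j - y 0 j) Num.norm); last exact: norm_continuous.
  rewrite (_ : (fun y => _) = fun y : 'rV[R]_N => x 0 j + -1 * y 0 j); last first.
    by apply/funext => z; rewrite mulN1r.
  apply: continuous_add; first exact: continuous_cst.
  by apply: continuous_mul; [exact: continuous_cst|exact: continuous_coord].
near=> z; move=> _; near: z.
apply: (cj y [set u | u < t]); apply: lt_nbhsl; exact: yt.
Unshelve. all: end_near. Qed.

Lemma closed_patch r i sg : closed (patch r i sg).
Proof.
rewrite (_ : patch r i sg =
  (@enorm R N) @^-1` [set r] `&` (fun x => N%:R * (sg * x 0 i)) @^-1` [set u | r <= u]).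
  apply: closedI; apply: closed_comp.
  - by move=> x _; exact: enorm_continuous.
  - exact: closed_eq.
  - move=> x _; apply: continuous_mul; first exact: continuous_cst.
    by apply: continuous_mul; [exact: continuous_cst|exact: continuous_coord].
  - exact: closed_ge.
by apply/seteqP; split=> x [].
Qed.

Lemma compact_patch r i sg : compact (patch r i sg).
Proof.
apply: (subclosed_compact (@closed_patch r i sg) (@compact_enorm_le R N r)).
by move=> x [/= ->].
Qed.

(** The norm is at most the sum of the [N] moduli of the coordinates, so one of them is at least
    [r / N]; this is the threshold in [patch]. *)
Lemma patch_cover r x : 0 < r -> enorm x = r ->
  exists i (b : bool), patch r i ((-1) ^+ b) x.
Proof.
move=> r0 xr.
have [i xi] : exists i, r <= N%:R * `|x 0 i|.
  apply: contrapT => /forallNP nx.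
  have rS : r <= \sum_(i < N) `|x 0 i| by rewrite -xr ler_enorm_sum.
  have [i0 _|noI] := pickP (@predT 'I_N); last first.
    by move: rS; rewrite big1 ?leNgt ?r0// => i _; have := noI i.
  have : \sum_(i < N) `|x 0 i| *+ N < r *+ N.
    have -> : r *+ N = \sum_(i < N) r by rewrite sumr_const card_ord.
    apply: ltr_sum; last by move=> i _; rewrite -mulr_natl ltNge; apply/negP/nx.
    by apply/hasP; exists i0; rewrite ?mem_index_enum.
  rewrite sumrMnl ltNge => /negP; apply.
  by rewrite lerMn2r rS orbT.
exists i; have [x0|x0] := leP 0 (x 0 i).
  by exists false; split=> //; rewrite expr0 mul1r -(ger0_norm x0).
by exists true; split=> //; rewrite expr1 mulN1r -(ltr0_norm x0).
Qed.

(** Equality of the norms gives [(y_i - x_i)(y_i + x_i)] as the sum over [j != i] of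
    [(x_j - y_j)(x_j + y_j)]. On one patch [|y_i + x_i| >= 2 r / N], so [|y_i - x_i| <= N S] with
    [S <= N t]. The successor in the constant makes the inequality strict. *)
Lemma patch_lipschitz r i (b : bool) x y t : 0 < r -> 0 < t ->
  patch r i ((-1) ^+ b) x -> patch r i ((-1) ^+ b) y -> slab i x t y ->
  enorm (y - x) < (N * N + N).+1%:R * t.
Proof.
move=> r0 t0 [xr xi] [yr yi] xy.
pose S := \sum_(j | j != i) `|y 0 j - x 0 j|.
have St : S <= N%:R * t.
  have -> : N%:R * t = \sum_(j < N) t by rewrite sumr_const card_ord mulr_natl.
  rewrite [leRHS](bigD1 i)//=.
  apply: (@le_trans _ _ (\sum_(j | j != i) t)); last by rewrite lerDr ltW.
  by apply: ler_sum => j ji; rewrite distrC ltW// xy.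
have S0 : 0 <= S by apply: sumr_ge0.
have coord (u : 'rV[R]_N) j : enorm u = r -> `|u 0 j| <= r.
  by move=> <-; exact: normr_coord_le_enorm.
have key : `|y 0 i - x 0 i| * (2 * r) <= N%:R * (S * (2 * r)).
  have : `|y 0 i - x 0 i| * `|y 0 i + x 0 i| <= S * (2 * r).
    rewrite -normrM (_ : _ * _ = \sum_(j | j != i) (x 0 j - y 0 j) * (x 0 j + y 0 j)); last first.
      have : dotp y y - dotp x x = 0 by rewrite -!sqr_enorm xr yr subrr.
      rewrite /dotp (bigD1 i)//= [X in _ - X](bigD1 i)//= => E.
      rewrite (eq_bigr (fun j => x 0 j * x 0 j - y 0 j * y 0 j)); last by move=> j _; ring.
      rewrite sumrB; move: E; set A := \sum_(j | _) _; set B := \sum_(j | _) _.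
      by move=> E; rewrite -[RHS]addr0 -E; ring.
    rewrite (le_trans (ler_norm_sum _ _ _))// mulr_suml; apply: ler_sum => j ji.
    rewrite normrM distrC ler_wpM2l// (le_trans (ler_normD _ _))//.
    by have := coord x j xr; have := coord y j yr; lra.
  have : 2 * r <= N%:R * `|y 0 i + x 0 i|.
    have : 2 * r <= N%:R * ((-1) ^+ b * (y 0 i + x 0 i)) by lra.
    move=> /le_trans; apply; rewrite ler_wpM2l//.
    by rewrite (le_trans (ler_norm _))// normrM normrX normrN normr1 expr1n mul1r.
  have n0 : 0 <= `|y 0 i - x 0 i| by [].
  move=> h1 h2; apply: (le_trans (ler_wpM2l n0 h1)).
  by rewrite mulrCA ler_wpM2l.
have yxi : `|y 0 i - x 0 i| <= N%:R * S.
  by rewrite -(@ler_pM2r _ (2 * r)) ?mulr_gt0// -mulrA.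
apply: (le_lt_trans (ler_enorm_sum _)).
rewrite (bigD1 i)//= (eq_bigr (fun j => `|y 0 j - x 0 j|)); last by move=> j _; rewrite !mxE.
rewrite -/S !mxE (@le_lt_trans _ _ (N%:R * (N%:R * t) + N%:R * t))//.
  by rewrite lerD// (le_trans yxi)// ler_wpM2l.
by rewrite -natr1 natrD natrM; nra.
Qed.

End patch.

(** Zero Lebesgue density of [E] at [x], normalised by [rho ^+ N] instead of the volume of the
    ball. *)
Definition thin_at (R : realType) (N : nat) (E : set 'rV[R]_N) (x : 'rV[R]_N) :=
  forall eps : R, 0 < eps -> exists2 rho0 : R, 0 < rho0 &
    forall rho, 0 < rho < rho0 ->
      (lebN R N (E `&` eball x rho) <= (eps * rho ^+ N)%:E)%E.

(** A discrete substitute for the finite area of the sphere: [t x ^+ N.-1] is the volume of a box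
    with side [t x] in the directions [j != i] and side 1 in direction [i]. These boxes are disjoint
    and lie in a cube of half-side [r + 1]. *)
Lemma sum_slab_le (R : realType) (N : nat) (i : 'I_N) (t : 'rV[R]_N -> R) (r : R)
    (D : seq 'rV[R]_N) :
  0 < r -> (forall x, x \in D -> enorm x = r /\ 0 < t x <= 1) ->
  pairwise (fun x y => ~~ slab_meet i t x y) D ->
  \sum_(x <- D) t x ^+ N.-1 <= (2 * (r + 1)) ^+ N.
Proof.
move=> r0 Dr pD.
pose t' x := Num.max 0 (t x).
have t'0 x : 0 <= t' x by rewrite le_max lexx.
have t'E x : x \in D -> t' x = t x.
  by move=> /Dr[_ /andP[t0 _]]; apply/max_idPr/ltW.
(* Half-sides [t / 2], against [t] in [slab_meet], make even the closed boxes disjoint. *)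
pose lo (x : 'rV[R]_N) : 'rV[R]_N := \row_j (if j == i then 0 else x 0 j - t' x / 2).
pose hi (x : 'rV[R]_N) : 'rV[R]_N := \row_j (if j == i then 1 else x 0 j + t' x / 2).
have lohi x j : lo x 0 j <= hi x 0 j.
  by rewrite !mxE; case: eqP => // _; have := t'0 x; lra.
have volF x : lebN R N (box (lo x) (hi x)) = (t' x ^+ N.-1)%:E.
  rewrite lebN_box//; congr EFin; rewrite (bigD1 i)//= !mxE eqxx subr0 mul1r.
  rewrite (eq_bigr (fun=> t' x)); last first.
    by move=> j /negbTE ji; rewrite !mxE ji; field.
  rewrite prodr_const; congr (_ ^+ _).
  by rewrite -[RHS](congr1 predn (card_ord N)) -(cardC1 i).
pose c : 'rV[R]_N := const_mx (r + 1).
have volX : lebN R N (box (- c) c) = ((2 * (r + 1)) ^+ N)%:E.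
  rewrite lebN_box; last by move=> j; rewrite !mxE; lra.
  rewrite (eq_bigr (fun=> 2 * (r + 1))) ?prodr_const ?card_ord//.
  by move=> j _; rewrite !mxE; ring.
rewrite -lee_fin -volX -sumEFin.
rewrite (eq_big_seq (fun x => lebN R N (box (lo x) (hi x)))); last first.
  by move=> x xD; rewrite volF t'E.
(* Membership in [D] is recorded because [t'] agrees with [t] only there. *)
pose r' x y := (x \in D) && (y \in D) && ~~ slab_meet i t x y.
apply: (@sum_measure_pairwise_le _ _ _ (lebN R N) _ (fun x => box (lo x) (hi x) : set (lebT R N)) D r').
- by move=> x; exact: measurable_box.
- exact: measurable_box.
- move=> x xD y xy j; have [xr /andP[t0 t1]] := Dr x xD.
  have := xy j; rewrite !mxE t'E//; case: eqP => _ /andP[h1 h2].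
    by apply/andP; split; lra.
  have := normr_coord_le_enorm x j; rewrite xr ler_norml => /andP[h3 h4].
  by apply/andP; split; lra.
- apply: (@sub_in_pairwise _ (mem D) _ _ _ D _ pD); last exact/allP.
  by move=> x y xD yD xy; rewrite /r' xy andbT; apply/andP; split.
- move=> x y /andP[/andP[xD yD]]; rewrite negb_or negb_forall => /andP[_ /existsP[j]].
  rewrite negb_imply -leNgt => /andP[ji xyj]; apply/seteqP; split=> // z [xz yz].
  have := xz j; have := yz j; rewrite !mxE (negbTE ji) !t'E//.
  have [_ /andP[tx0 _]] := Dr x xD; have [_ /andP[ty0 _]] := Dr y yD.
  move=> /andP[h1 h2] /andP[h3 h4].
  have : `|x 0 j - y 0 j| < t x + t y by rewrite ltr_norml; apply/andP; split; lra.
  by rewrite ltNge xyj.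
Qed.

(** Selection takes place among projections of size [t x], while the balls have radius [L * t x].
    Thinness bounds each term of the sum by a small multiple of [t x ^+ N.-1], which [sum_slab_le]
    controls. *)
Lemma patch_good_cover (R : realType) (N : nat) (r : R) (i : 'I_N) (b : bool)
    (E K : set 'rV[R]_N) (eps delta : R) :
  0 < r -> compact K -> K `<=` patch r i ((-1) ^+ b) ->
  (forall x, K x -> thin_at E x) -> 0 < eps -> 0 < delta ->
  exists s : seq ('rV[R]_N * R),
    [/\ forall p, p \in s -> enorm p.1 = r /\ 0 < p.2 <= delta,
        forall y, K y -> exists2 p, p \in s & enorm (y - p.1) < p.2 &
        \sum_(p <- s) fine (lebN R N (E `&` eball p.1 (2 * p.2))) / p.2 <= eps].
Proof.
move=> r0 cK KP Kthin e0 d0.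
have N0 : (0 < N)%N by apply: leq_ltn_trans (ltn_ord i).
(* The 3 is the enlargement in Vitali's lemma, the rest the constant of [patch_lipschitz]. *)
pose L : R := 3 * (N * N + N).+1%:R.
have L0 : 0 < L by rewrite mulr_gt0.
pose V := (2 * (r + 1)) ^+ N; have V0 : 0 < V by rewrite exprn_gt0// mulr_gt0// addr_gt0.
(* From [(2 L t)^N / (L t) = 2^N L^(N-1) t^(N-1)] and the bound [V] on the sum of the [t^(N-1)]. *)
pose C := 2 ^+ N * L ^+ N.-1 * V.
have C0 : 0 < C by rewrite !mulr_gt0// exprn_gt0.
pose e1 := eps / C; have e10 : 0 < e1 by rewrite divr_gt0.
have [t tP] : {t : 'rV[R]_N -> R & forall x, K x ->
    [/\ 0 < t x <= 1, L * t x <= delta &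
      (lebN R N (E `&` eball x (2 * (L * t x))) <= (e1 * (2 * (L * t x)) ^+ N)%:E)%E]}.
  apply: (@choice _ _ (fun x t => K x -> [/\ 0 < t <= 1, L * t <= delta &
      (lebN R N (E `&` eball x (2 * (L * t))) <= (e1 * (2 * (L * t)) ^+ N)%:E)%E])) => x.
  have [Kx|nKx] := pselect (K x); last by exists 0.
  have [h h0 hP] := Kthin x Kx e1 e10.
  (* The quarter keeps the doubled radius [2 L t] below [h]; the minimum with 1 below is the size
     limit of [sum_slab_le]. *)
  pose m := Num.min delta (h / 4); have m0 : 0 < m by rewrite lt_min d0 divr_gt0.
  have md : m <= delta by rewrite ge_min lexx.
  have mh : m <= h / 4 by rewrite ge_min lexx orbT.
  exists (Num.min 1 (m / L)) => _.
  have t0 : 0 < Num.min 1 (m / L) by rewrite lt_min ltr01 divr_gt0.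
  have tm : L * Num.min 1 (m / L) <= m.
    by rewrite -ler_pdivlMl// mulrC ge_min lexx orbT.
  split; first by rewrite t0 ge_min lexx.
    exact: le_trans tm md.
  by apply: hP; rewrite !mulr_gt0//=; lra.
have oslab x : K x -> open (slab i x (t x)) by move=> _; exact: open_slab.
have covK : K `<=` cover K (fun x => slab i x (t x)).
  move=> x Kx; exists x => // j _; rewrite subrr normr0.
  by have [/andP[]] := tP x Kx.
have := cK; rewrite compact_cover => /(_ _ K _ oslab covK)[S SK KS].
pose s0 : seq 'rV[R]_N := enum_fset S.
have s0K x : x \in s0 -> K x by move=> xs; have := SK x xs; rewrite inE.
have mr : reflexive (slab_meet i t) by move=> x; rewrite /slab_meet eqxx.
have ms : symmetric (slab_meet i t).
  move=> x y; rewrite /slab_meet eq_sym; congr (_ || _).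
  by apply: eq_forallb => j; rewrite distrC [t y + _]addrC.
have [D [Ds0 pD covD]] := @vitali_finite R _ t _ s0 mr ms.
have DK x : x \in D -> K x by move=> /Ds0/s0K.
exists [seq (x, L * t x) | x <- D]; split.
- move=> p /mapP[x xD ->] /=; have [/andP[t0 t1] td _] := tP x (DK x xD).
  by rewrite mulr_gt0// td; split=> //; have [] := KP x (DK x xD).
- move=> y Ky; have [x /= xS xy] := KS y Ky.
  have [q qD /andP[xq txq]] := covD x xS.
  exists (q, L * t q); first by apply/mapP; exists q.
  have [/andP[tq0 _] _ _] := tP q (DK q qD).
  rewrite /= /L -mulrA mulrCA.
  apply: (patch_lipschitz (t := 3 * t q) r0 _ (KP _ (DK _ qD)) (KP _ Ky)).
    by rewrite mulr_gt0.
  move=> j ji; have := xy j ji => xyj.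
  move: xq => /orP[/eqP xq|/forallP/(_ j)]; first by rewrite -xq; rewrite xq in xyj *; lra.
  rewrite ji /= => xqj.
  rewrite (_ : q 0 j - y 0 j = (q 0 j - x 0 j) + (x 0 j - y 0 j)); last by ring.
  by rewrite (le_lt_trans (ler_normD _ _))// distrC; lra.
- rewrite big_map/=.
  apply: (@le_trans _ _ (\sum_(x <- D) (e1 * (2 ^+ N * L ^+ N.-1)) * t x ^+ N.-1)).
    rewrite big_seq [leRHS]big_seq; apply: ler_sum => x xD.
    have [/andP[t0 t1] td H] := tP x (DK x xD).
    rewrite ler_pdivrMr ?mulr_gt0//.
    have Hf : lebN R N (E `&` eball x (2 * (L * t x))) \is a fin_num.
      by rewrite ge0_fin_numE// (le_lt_trans H)// ltry.
    rewrite -lee_fin fineK//; apply: (le_trans H); rewrite lee_fin le_eqVlt.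
    have EN (u : R) : u ^+ N = u * u ^+ N.-1 by rewrite -exprS prednK.
    apply/orP; left; apply/eqP; rewrite [(2 * _) ^+ N]exprMn [(L * t x) ^+ N]exprMn !EN.
    by ring.
  rewrite -mulr_sumr.
  have HD x : x \in D -> enorm x = r /\ 0 < t x <= 1.
    move=> xD; have [tx _ _] := tP x (DK x xD).
    by split=> //; have [] := KP x (DK x xD).
  have cc : 0 <= e1 * (2 ^+ N * L ^+ N.-1).
    by rewrite mulr_ge0 ?(ltW e10)// mulr_ge0// exprn_ge0// ltW.
  apply: (le_trans (ler_wpM2l cc (sum_slab_le r0 HD pD))).
  rewrite -/V /e1 /C le_eqVlt; apply/orP; left; apply/eqP.
  by field; rewrite !gt_eqF// ?exprn_gt0.
Qed.

(** Removing the open union [U] of the balls around the exceptional points leaves compact pieces of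
    the patches, thin at every point. Only finitely many balls of [U] are then kept, by compactness
    of what the good balls [W] leave of the sphere. *)
Lemma sphere_thin_cover (R : realType) (N : nat) (r : R) (E : set 'rV[R]_N)
    (eps delta : R) :
  (0 < N)%N -> 0 < r ->
  hausdorff_outer N.-1 [set x | enorm x = r /\ ~ thin_at E x] = 0%E ->
  0 < eps -> 0 < delta ->
  exists s : seq ('rV[R]_N * R),
    [/\ forall p, p \in s -> enorm p.1 = r /\ 0 < p.2 <= delta,
        forall y, enorm y = r -> exists2 p, p \in s & enorm (y - p.1) < p.2 &
        \sum_(p <- s) fine (lebN R N (E `&` eball p.1 (2 * p.2))) / p.2 <= eps].
Proof.
move=> N0 r0 HZ e0 d0.
(* A ball of radius [2 rho] lies in a cube of side [4 rho], so an exceptional ball contributes at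
   most [4^N rho^(N-1)]. *)
pose eb := eps / 2 / 4 ^+ N.
have eb0 : 0 < eb by rewrite !divr_gt0// exprn_gt0.
have [P [c [rho [Pc Zc sumc]]]] := hausdorff_null_cover HZ eb0 d0.
pose U := \bigcup_(k in [set k | P k]) eball (c k) (rho k).
have oU : open U by apply: bigcup_open => k _; exact: open_eball.
pose I : finType := ('I_N * bool)%type.
pose K (ib : I) := patch r ib.1 ((-1) ^+ ib.2) `&` ~` U.
have cK ib : compact (K ib).
  apply: (@subclosed_compact _ (K ib) (patch r ib.1 ((-1) ^+ ib.2))).
  - by apply: closedI; [exact: closed_patch|exact: open_closedC].
  - exact: compact_patch.
  - by move=> x [].
have Kthin ib x : K ib x -> thin_at E x.
  move=> [[xr _] nUx]; apply: contrapT => nt; apply: nUx.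
  by have [k Pk xk] := Zc x (conj xr nt); exists k.
pose eg := eps / 2 / (#|I|)%:R.
have I0 : (0 < #|I|)%N.
  by apply/card_gt0P; exists (Ordinal N0, true).
have eg0 : 0 < eg by rewrite !divr_gt0// ltr0n.
pose Q (ib : I) (s : seq ('rV[R]_N * R)) :=
    [/\ forall p, p \in s -> enorm p.1 = r /\ 0 < p.2 <= delta,
        forall y, K ib y -> exists2 p, p \in s & enorm (y - p.1) < p.2 &
        \sum_(p <- s) fine (lebN R N (E `&` eball p.1 (2 * p.2))) / p.2 <= eg].
have [S SQ] : {S & forall ib, Q ib (S ib)}.
  apply: (@choice _ _ Q) => ib.
  exact: (patch_good_cover r0 (cK ib) (fun x Kx => Kx.1) (Kthin ib) eg0 d0).
pose good := flatten [seq S ib | ib <- index_enum I].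
have goodP p : p \in good -> enorm p.1 = r /\ 0 < p.2 <= delta.
  by move=> /flattenP[s /mapP[ib _ ->]]; have [+ _ _] := SQ ib; apply.
have sumgood : \sum_(p <- good) fine (lebN R N (E `&` eball p.1 (2 * p.2))) / p.2 <= eps / 2.
  rewrite big_flatten big_map.
  apply: (@le_trans _ _ (\sum_(ib : I) eg)).
    by apply: ler_sum => ib _; have [] := SQ ib.
  rewrite sumr_const -[eg *+ _]mulr_natr /eg divfK// pnatr_eq0 -lt0n//.
pose W := \bigcup_(p in [set p | p \in good]) eball p.1 p.2.
have oW : open W by apply: bigcup_open => p _; exact: open_eball.
pose B := [set y : 'rV[R]_N | enorm y = r] `&` ~` W.
have cB : compact B.
  apply: (@subclosed_compact _ B [set x | enorm x <= r]).
  - apply: closedI; last exact: open_closedC.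
    apply: (@closed_comp _ _ (@enorm R N) [set r]); last exact: closed_eq.
    by move=> x _; exact: enorm_continuous.
  - exact: compact_enorm_le.
  - by move=> x [/= ->].
have BU : B `<=` cover [set k | P k] (fun k => eball (c k) (rho k)).
  move=> y [yr nWy]; apply: contrapT => nUy.
  have [i [b yp]] := patch_cover r0 yr.
  have [p pS yp'] : exists2 p, p \in S (i, b) & enorm (y - p.1) < p.2.
    by have [_ + _] := SQ (i, b); apply.
  apply: nWy; exists p => //; apply/flattenP; exists (S (i, b)) => //.
  by apply/mapP; exists (i, b); rewrite ?mem_index_enum.
have := cB; rewrite compact_cover => /(_ nat [set k | P k] (fun k => eball (c k) (rho k))).
move=> /(_ (fun k _ => @open_eball R N (c k) (rho k)) BU)[D DP BD].
(* Every admissible index below [n] is kept, even outside the subcover, since the whole series is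
   already small. *)
pose n := (\max_(k <- enum_fset D) k).+1.
pose bad := [seq (c k, rho k) | k <- iota 0 n & P k].
have badP p : p \in bad -> enorm p.1 = r /\ 0 < p.2 <= delta.
  move=> /mapP[k]; rewrite mem_filter => /andP[Pk _] ->.
  by have [[cr _] rk] := Pc k Pk.
exists (good ++ bad); split.
- by move=> p; rewrite mem_cat => /orP[/goodP|/badP].
- move=> y yr; have [[p /= pg yp]|nW] := pselect (W y).
    by exists p; rewrite ?mem_cat ?pg.
  have [k /= kD yk] := BD y (conj yr nW).
  have Pk : P k by have := DP k kD; rewrite inE.
  exists (c k, rho k) => //; rewrite mem_cat; apply/orP; right.
  apply/mapP; exists k => //; rewrite mem_filter Pk mem_iota/= add0n ltnS.
  exact: leq_bigmax_seq.
- rewrite big_cat [eps]splitr; apply: lerD => //.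
  rewrite /bad big_map big_filter.
  apply: (@le_trans _ _ (\sum_(k <- iota 0 n | P k) 4 ^+ N * rho k ^+ N.-1)).
    apply: ler_sum => k Pk; have [_ /andP[rk _]] := Pc k Pk.
    rewrite ler_pdivrMr//.
    have H : (lebN R N (E `&` eball (c k) (2 * rho k)) <= ((2 * (2 * rho k)) ^+ N)%:E)%E.
      apply: le_trans (lebN_eball_le (c k) _); last by rewrite mulr_ge0// ltW.
      exact: (le_outer_measure (lebN_om R N)).
    rewrite -lee_fin fineK; last by rewrite ge0_fin_numE// (le_lt_trans H)// ltry.
    apply: (le_trans H); rewrite lee_fin mulrA exprMn -mulrA -exprSr prednK//.
    by rewrite (_ : 2 * 2 = 4)//; ring.
  rewrite -mulr_sumr mulrC -ler_pdivlMr ?exprn_gt0// -/eb.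
  rewrite -lee_fin; apply: le_trans sumc; rewrite -sumEFin.
  apply: (@le_trans _ _ (\sum_(0 <= k < n) (if P k then rho k ^+ N.-1 else 0)%:E)%E).
    rewrite /index_iota subn0 big_mkcond; apply: lee_sum => k _.
    by case: ifP.
  apply: nneseries_lim_ge => k _ _; rewrite lee_fin; case: ifPn => // Pk.
  by have [_ /andP[rk _]] := Pc k Pk; rewrite exprn_ge0// ltW.
Qed.

(** * The pointwise inequality between consecutive levels *)

(** The graph of the convex [phi_m] lies above its tangents; here this is Young's inequality for [y]
    and [x^m] with exponents [m + 1] and [(m + 1) / m]. *)
Lemma phi_m_tangent (R : realType) (m x y : R) : 0 < m -> 0 <= x -> 0 <= y ->
  x `^ m * (y - x) <= phi_m m y - phi_m m x.
Proof.
move=> m0 x0 y0.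
have m1 : 0 < m + 1 by rewrite addr_gt0.
have q0 : 0 < (m + 1) / m by rewrite divr_gt0.
have pq : (m + 1)^-1 + ((m + 1) / m)^-1 = 1 by field; rewrite !gt_eqF.
have := conjugate_powR y0 (powR_ge0 x m) m1 q0 pq.
rewrite -powRrM (_ : m * ((m + 1) / m) = m + 1); last by field; rewrite gt_eqF.
rewrite invf_div /phi_m => H.
have E : x `^ (m + 1) = x * x `^ m by rewrite -[in RHS](addrK 1 m) mulr_powRB1.
rewrite E in H *.
have -> : x * x `^ m / (m + 1) = x * x `^ m - x * x `^ m * (m / (m + 1)).
  by field; rewrite gt_eqF.
by lra.
Qed.

(** This is where [m >= 1] enters, together with levels at least 1: the difference of the powers is
    at least [(t - u) t^(m-1)]. *)
Lemma powR_sub_ge (R : realType) (m u t : R) : 1 <= m -> 0 <= u <= t -> 1 <= t ->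
  t - u <= t `^ m - u `^ m.
Proof.
move=> m1 /andP[u0 ut] t1.
have t0 : 0 <= t by rewrite (le_trans u0).
have m0 : 0 < m by rewrite (lt_le_trans _ m1).
rewrite -(mulr_powRB1 t0 m0) -(mulr_powRB1 u0 m0).
have a1 : u `^ (m - 1) <= t `^ (m - 1) by rewrite ge0_ler_powR ?subr_ge0// nnegrE.
have a2 : 1 <= t `^ (m - 1).
  by have := @ler_powR _ t t1 0 (m - 1); rewrite powRr0; apply; rewrite subr_ge0.
have a3 : 0 <= u `^ (m - 1) by exact: powR_ge0.
by nra.
Qed.

Definition level (R : realType) (lam h : R) (k : nat) : R := lam * (1 + h) ^+ k.

(** The integrand of the tested inequality at level [k], without cutoff, the divergence being
    replaced by its bound [u] and the component of [z] along the ramp by its bound [u^m]. *)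
Definition level_term (R : realType) (m lam h u : R) (th dth : nat -> R) (k : nat) : R :=
  (level lam h k.+1 - truncate (level lam h k) (level lam h k.+1) u) *
    (u * th k + u `^ m * dth k) -
  (phi_m m (level lam h k.+1) -
   phi_m m (truncate (level lam h k) (level lam h k.+1) u)) * dth k.

(* Summation by parts in the level variable: the mass produced at level k by
   the growth of th is carried to level k.+1. *)
Lemma sum_level_term_le (R : realType) (m lam h u b : R) (th dth : nat -> R) (n : nat) :
  1 <= m -> 1 <= lam -> 0 < h -> 0 <= u -> level lam h n <= b ->
  (forall k, 0 <= th k <= 1) -> (forall k, 0 <= dth k) ->
  (forall k, (k < n)%N -> th k - th k.+1 <= h * dth k) -> th n = 0 ->
  \sum_(k < n) level_term m lam h u th dth k <=
    2 * h * b ^+ 2 - lam * Num.max (lam - u) 0 * th 0%N.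
Proof.
move=> m1 lam1 h0 u0 bn th01 dth0 thd thn.
have m0 : 0 < m by rewrite (lt_le_trans _ m1).
set t := level lam h.
have tS k : t k.+1 = (1 + h) * t k by rewrite /t /level exprS mulrCA.
have t1 k : 1 <= t k.
  elim: k => [|k ih]; first by rewrite /t /level expr0 mulr1.
  by rewrite tS; nra.
have tmono k j : (k <= j)%N -> t k <= t j.
  move=> /subnK <-; elim: (j - k)%N => [|i ih]; first by [].
  by rewrite addSn tS; have := t1 (i + k)%N; nra.
have tb k : (k <= n)%N -> t k <= b by move=> /tmono/le_trans; apply.
have b1 : 1 <= b by apply: le_trans (tb 0%N _); rewrite ?t1.
pose F := level_term m lam h u th dth.
have E0 : 0 <= 2 * h * b ^+ 2 by rewrite mulr_ge0 ?sqr_ge0// mulr_ge0// ltW.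
(* Downward induction on [k]. The correction [h * t k * u] is chosen so that the bracket at level
   [k.+1] equals [(1 + h)^2 t_k (t_k - u)], which dominates the mass [t_k (t_k - u)] carried up from
   level [k]. *)
have main j : (j <= n)%N -> let k := (n - j)%N in
    (u <= t k -> \sum_(k <= i < n) F i <= - (t k * (t k - u) - h * t k * u) * th k) /\
    (t k < u -> \sum_(k <= i < n) F i <= 2 * h * b ^+ 2).
  elim: j => [_|j ih jn] /=.
    by rewrite subn0 big_geq// thn mulr0; split.
  set k := (n - j.+1)%N.
  have kn : (k < n)%N by rewrite /k ltn_subrL; case: (n) jn.
  have kS : (n - j)%N = k.+1 by rewrite /k subnSK.
  have [ih1 ih2] := ih (ltnW jn); rewrite kS in ih1 ih2; clear ih.
  rewrite big_ltn//.
  have [th0 th1] := andP (th01 k); have [thS0 thS1] := andP (th01 k.+1).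
  have tk1 := t1 k; have tSk := tS k; have tSb := tb k.+1 kn; have d0 := dth0 k.
  have thdk := thd k kn.
  have tkb : t k <= b by rewrite tb// ltnW.
  have tkS : t k <= t k.+1 by rewrite tSk; nra.
  split=> [utk|tku].
  - have /ih1 ih : u <= t k.+1 by rewrite (le_trans utk).
    have TE : truncate (t k) (t k.+1) u = t k.
      by rewrite /truncate (min_idPr (le_trans utk tkS)) (max_idPr utk).
    have := phi_m_tangent m0 (le_trans u0 utk) (le_trans ler01 (t1 k.+1)).
    have := powR_sub_ge m1 (introT andP (conj u0 utk)) tk1.
    rewrite /F /level_term -/t TE.
    move: ih; set S := \sum_(_ <= _ < _) _.
    set pu := u `^ m; set pt := t k `^ m; set D := _ - phi_m m (t k).
    move=> ih h1 h2.
    have c1 : (h * t k) * (u * th k + pu * dth k) - D * dth k <=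
        h * t k * u * th k - t k * (t k - u) * (th k - th k.+1).
      have D1 : h * t k * pt <= D.
        by apply: le_trans h2; rewrite le_eqVlt tSk; apply/orP; left; apply/eqP; ring.
      have D2 : h * t k * pt * dth k <= D * dth k by rewrite ler_wpM2r.
      have c2 : 0 <= h * t k by rewrite mulr_ge0 ?(ltW h0)// (le_trans ler01).
      have D3 : t k * (t k - u) * (th k - th k.+1) <= t k * (pt - pu) * (h * dth k).
        have a0 : 0 <= t k * (t k - u) by rewrite mulr_ge0 ?subr_ge0// (le_trans ler01).
        apply: (@le_trans _ _ (t k * (t k - u) * (h * dth k))).
          by rewrite ler_wpM2l.
        rewrite ler_wpM2r ?mulr_ge0 ?(ltW h0)// ler_wpM2l// (le_trans ler01)//.
      by nra.
    have c3 : t k * (t k - u) * th k.+1 <=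
        (t k.+1 * (t k.+1 - u) - h * t k.+1 * u) * th k.+1.
      rewrite ler_wpM2r// tSk.
      have a0 : 0 <= t k * (t k - u) by rewrite mulr_ge0 ?subr_ge0// (le_trans ler01).
      rewrite (_ : (1 + h) * t k * ((1 + h) * t k - u) - h * ((1 + h) * t k) * u =
        t k * (t k - u) * (1 + h) ^+ 2); last by ring.
      by rewrite ler_peMr// expr_ge1//; lra.
    rewrite (_ : t k.+1 - t k = h * t k); last by rewrite tSk; ring.
    by lra.
  (* Above [t k.+1] the term is zero. If [u] is between the two levels, the term and the bracket
     carried from level [k.+1] cost at most [h b^2] each; this is the only source of the error. *)
  - have [utS|tSu] := leP u (t k.+1); last first.
      have TE : truncate (t k) (t k.+1) u = t k.+1.
        by rewrite /truncate (min_idPl (ltW tSu)) (max_idPl tkS).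
      rewrite /F /level_term -/t TE !subrr !mul0r subrr add0r.
      exact: ih2.
    have TE : truncate (t k) (t k.+1) u = u.
      by rewrite /truncate (min_idPr utS) (max_idPl (ltW tku)).
    have := phi_m_tangent m0 u0 (le_trans ler01 (t1 k.+1)).
    rewrite /F /level_term -/t TE.
    have {ih1 ih2} := ih1 utS; set S := \sum_(_ <= _ < _) _.
    set pu := u `^ m; set D := _ - phi_m m u => ih h2.
    have ub : u <= b by rewrite (le_trans utS).
    have c1 : (t k.+1 - u) * (u * th k + pu * dth k) - D * dth k <= h * b ^+ 2.
      have : pu * (t k.+1 - u) * dth k <= D * dth k by rewrite ler_wpM2r.
      have a0 : 0 <= t k.+1 - u by rewrite subr_ge0.
      have a1 : (t k.+1 - u) <= h * b.
        have : t k.+1 - u <= h * t k by rewrite tSk; lra.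
        by move=> /le_trans; apply; rewrite ler_wpM2l// ltW.
      have a2 : u * th k <= b.
        by rewrite (le_trans _ ub)// ler_piMr.
      have a3 : (t k.+1 - u) * (u * th k) <= h * b * b.
        by rewrite ler_pM// mulr_ge0.
      by rewrite expr2; nra.
    have c2 : - (t k.+1 * (t k.+1 - u) - h * t k.+1 * u) * th k.+1 <= h * b ^+ 2.
      have a0 : 0 <= t k.+1 * (t k.+1 - u) by rewrite mulr_ge0 ?subr_ge0// (le_trans ler01).
      have a1 : t k.+1 * u <= b * b by rewrite ler_pM// (le_trans ler01).
      have a2 : t k.+1 * u * th k.+1 <= b * b.
        rewrite (le_trans _ a1)// ler_piMr// mulr_ge0// (le_trans ler01)//.
      have a3 : h * (t k.+1 * u * th k.+1) <= h * (b * b) by rewrite ler_wpM2l// ltW.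
      have a4 : 0 <= t k.+1 * (t k.+1 - u) * th k.+1 by rewrite mulr_ge0.
      by rewrite expr2; nra.
    by lra.
have := main n (leqnn n); rewrite subnn/= big_mkord => -[H1 H2].
have t0 : t 0%N = lam by rewrite /t /level expr0 mulr1.
have [ul|lu] := leP u lam.
  rewrite (max_idPl (_ : 0 <= lam - u)) ?subr_ge0//.
  apply: le_trans (H1 _) _; first by rewrite t0.
  rewrite t0; have [th0 th1] := andP (th01 0%N).
  have lb : lam <= b by rewrite -t0 tb.
  have a1 : lam * u <= b * b.
    by rewrite ler_pM// ?(le_trans ul)// (le_trans ler01).
  have a2 : lam * u * th 0%N <= b * b.
    by rewrite (le_trans _ a1)// ler_piMr// mulr_ge0// (le_trans ler01).
  have a3 : h * (lam * u * th 0%N) <= h * (b * b) by rewrite ler_wpM2l// ltW.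
  have a4 : 0 <= h * (b * b) by rewrite mulr_ge0 ?(ltW h0)// mulr_ge0// (le_trans ler01).
  by rewrite expr2; lra.
rewrite (max_idPr (_ : lam - u <= 0)) ?mulr0 ?mul0r ?subr0; last by rewrite subr_le0 ltW.
by apply: H2; rewrite t0.
Qed.

(** * Boundary values and density *)

Lemma enormZ (R : realType) (N : nat) (c : R) (x : 'rV[R]_N) :
  enorm (c *: x) = `|c| * enorm x.
Proof.
by rewrite /enorm dotpZl dotpC dotpZl mulrA -expr2 sqrtrM ?sqr_ge0// sqrtr_sqr.
Qed.

Lemma sphere_boundary (R : realType) (N : nat) (r : R) (x : 'rV[R]_N) :
  0 < r -> enorm x = r -> boundary (eball 0 r) x.
Proof.
move=> r0 xr; split; last first.
  by move=> /interior_subset; rewrite /eball/= subr0 xr ltxx.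
move=> B /nbhs_ballP[e /= e0 eB].
pose s := Num.min 2^-1 (e / (2 * r)).
have s0 : 0 < s by rewrite lt_min invr_gt0 ltr0n divr_gt0// mulr_gt0.
have s1 : s <= 2^-1 by rewrite ge_min lexx.
have se : s * r <= e / 2.
  rewrite -ler_pdivlMr// (_ : e / 2 / r = e / (2 * r)); last by field; rewrite gt_eqF.
  by rewrite ge_min lexx orbT.
exists ((1 - s) *: x); split.
  rewrite /eball/= subr0 enormZ xr ger0_norm; last by lra.
  by nra.
apply: eB; split=> // i j; rewrite (ord1 i) /ball/= mxE.
rewrite (_ : _ - _ = s * x 0 j); last by ring.
rewrite normrM (ger0_norm (ltW s0)) (@le_lt_trans _ _ (s * r))//; last by lra.
by rewrite ler_wpM2l ?(ltW s0)// -xr normr_coord_le_enorm.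
Qed.

(** Chebyshev's inequality: where [v < b], the distance of [v] to the trace [l] is at least
    [l - b]. *)
Lemma trace_thin_at (R : realType) (N : nat) (Omega : set 'rV[R]_N)
    (v : 'rV[R]_N -> R) (b l : R) (x : 'rV[R]_N) :
  open Omega -> measurable_fun (Omega : set (lebT R N)) v -> b < l ->
  ((rho ^- N)%:E * (\int[lebN R N]_(y in Omega `&` eball x rho) (`|v y - l|%R)%:E))%E
    @[rho --> 0^'+] --> 0%E ->
  thin_at [set y | Omega y /\ v y < b] x.
Proof.
move=> oO mv bl cv eps e0.
have c0 : 0 < l - b by rewrite subr_gt0.
have ec0 : 0 < eps * (l - b) by rewrite mulr_gt0.
have : \forall rho \near 0^'+, ((rho ^- N)%:E *
    (\int[lebN R N]_(y in Omega `&` eball x rho) (`|v y - l|%R)%:E) < (eps * (l - b))%:E)%E.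
  apply: (cv [set t | (t < (eps * (l - b))%:E)%E]); apply: open_nbhs_nbhs.
  by split; [exact: open_ereal_lt_ereal|rewrite /= lte_fin].
rewrite near_withinE => /nbhs_ballP[d /= d0 hd].
exists d => // rho /andP[rho0 rhod].
have {hd} : ((rho ^- N)%:E *
    (\int[lebN R N]_(y in Omega `&` eball x rho) (`|v y - l|%R)%:E) < (eps * (l - b))%:E)%E.
  by apply: hd => //; rewrite /ball/= sub0r normrN gtr0_norm.
have rN : 0 < rho ^+ N by rewrite exprn_gt0.
rewrite lte_pdivrMl// => I.
have mO : measurable (Omega : set (lebT R N)) := measurable_open oO.
have mB : measurable (Omega `&` eball x rho : set (lebT R N)).
  by apply: measurableI => //; exact/measurable_open/open_eball.
pose E : set (lebT R N) := [set y | Omega y /\ v y < b].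
have mE : measurable E.
  have := mv mO _ (measurable_itv `]-oo, b[).
  by rewrite (_ : Omega `&` _ = E)//; apply/seteqP; split=> y [Oy]; rewrite /= in_itv.
have mEB : measurable (E `&` eball x rho : set (lebT R N)).
  by apply: measurableI => //; exact/measurable_open/open_eball.
have mvl (A : set (lebT R N)) : measurable A -> A `<=` Omega ->
    measurable_fun A (fun y => (`|v y - l|%R)%:E).
  move=> mA AO; apply/measurable_EFinP.
  have mvA : measurable_fun A (fun y => v y - l).
    exact: (measurable_funB (measurable_funS mO AO mv) (measurable_cst l)).
  exact: (measurableT_comp (@normr_measurable R setT) mvA).
have J : ((l - b)%:E * lebN R N (E `&` eball x rho) <=
    \int[lebN R N]_(y in Omega `&` eball x rho) (`|v y - l|%R)%:E)%E.
  rewrite -integral_cst//.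
  apply: (@le_trans _ _ (\int[lebN R N]_(y in E `&` eball x rho) (`|v y - l|%R)%:E)%E).
    apply: ge0_le_integral.
    - exact: mEB.
    - by move=> y _; rewrite lee_fin ltW.
    - exact: measurable_cst.
    - by apply: (mvl _ mEB) => y [[]].
    - move=> y [[_ vb] _]; rewrite lee_fin ler0_norm ?opprB; last by rewrite subr_le0 ltW// (lt_trans vb).
      by rewrite lerD2l lerN2 ltW.
  apply: (ge0_subset_integral _ mEB mB).
  - by apply: (mvl _ mB) => y [].
  - by move=> y _; rewrite lee_fin.
  - by move=> y [[Oy _] ry].
have := le_lt_trans J I.
rewrite (_ : (_ * (eps * (l - b))%:E)%E = ((l - b)%:E * (eps * rho ^+ N)%:E)%E); last first.
  by rewrite -!EFinM; congr EFin; ring.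
move=> /ltW.
by rewrite lee_pmul2l// lte_fin.
Qed.

Lemma hausdorff_ae_null (R : realType) (N s : nat) (P : 'rV[R]_N -> Prop) :
  {ae hausdorff R N s, forall x, P x} -> hausdorff_outer s [set x | ~ P x] = 0%E.
Proof.
move=> [A [mA A0 PA]]; apply/eqP; rewrite eq_le; apply/andP; split; last first.
  exact: (outer_measure_ge0 (hausdorff_om R N s)).
by rewrite -A0; apply: (le_outer_measure (hausdorff_om R N s)) => x nPx; exact: PA.
Qed.

Lemma hausdorff_null_bigcup (R : realType) (N s : nat) (F : (set 'rV[R]_N)^nat)
    (Z : set 'rV[R]_N) :
  (forall n, hausdorff_outer s (F n) = 0%E) -> Z `<=` \bigcup_n F n ->
  hausdorff_outer s Z = 0%E.
Proof.
move=> F0 ZF; apply/eqP; rewrite eq_le; apply/andP; split; last first.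
  exact: (outer_measure_ge0 (hausdorff_om R N s)).
apply: le_trans (le_outer_measure (hausdorff_om R N s) _ _ ZF) _.
apply: le_trans (outer_measure_sigma_subadditive (hausdorff_om R N s) F) _.
by rewrite eseries0// => n _ _; exact: F0.
Qed.

(** The exceptional set is a countable union of null sets, because the traces are used only for the
    truncations at [a = 1 / (n + 1)]. *)
Lemma solution_thin (R : realType) (N : nat) (r b G : R)
    (g u ub : 'rV[R]_N -> R) :
  0 < r -> 0 < b -> b < G ->
  measurable_fun (eball 0 r : set (lebT R N)) u ->
  is_TBVp_trace (eball 0 r) u ub ->
  {ae hausdorff R N N.-1, forall x, boundary (eball 0 r) x -> G <= g x} ->
  {ae hausdorff R N N.-1, forall x, boundary (eball 0 r) x -> g x <= ub x} ->
  hausdorff_outer N.-1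
    [set x | enorm x = r /\ ~ thin_at [set y | eball 0 r y /\ u y < b] x] = 0%E.
Proof.
move=> r0 b0 bG mu [tr [trP /hausdorff_ae_null trub]] /hausdorff_ae_null gG /hausdorff_ae_null gub.
have inv0 n : 0 < n.+1%:R^-1 :> R by rewrite invr_gt0.
have trn n := hausdorff_ae_null (trP _ (inv0 n)).
pose F n := match n with
  | 0%N => [set x | ~ (boundary (eball 0 r) x -> tr a x @[a --> 0^'+] --> ub x)]
  | 1%N => [set x | ~ (boundary (eball 0 r) x -> G <= g x)]
  | 2%N => [set x | ~ (boundary (eball 0 r) x -> g x <= ub x)]
  | n.+3 => [set x | ~ (boundary (eball 0 r) x -> ((rho ^- N)%:E *
      (\int[lebN R N]_(y in eball 0 r `&` eball x rho)
        (`|(truncate_below n.+1%:R^-1 \o u) y - tr n.+1%:R^-1 x|%R)%:E))%E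
    @[rho --> 0^'+] --> 0%E)] end.
apply: (@hausdorff_null_bigcup _ _ _ F).
  by move=> [|[|[|n]]]; [exact: trub|exact: gG|exact: gub|exact: trn].
move=> x [xr nthin]; apply: contrapT => nF; apply: nthin.
have bx := sphere_boundary r0 xr.
have nFn n : ~ F n x by move=> Fn; apply: nF; exists n.
have tx : tr a x @[a --> 0^'+] --> ub x by move: bx; apply: contrapT; exact: (nFn 0%N).
have Gg : G <= g x by move: bx; apply: contrapT; exact: (nFn 1%N).
have gu : g x <= ub x by move: bx; apply: contrapT; exact: (nFn 2%N).
have trx n : ((rho ^- N)%:E *
      (\int[lebN R N]_(y in eball 0 r `&` eball x rho)
        (`|(truncate_below n.+1%:R^-1 \o u) y - tr n.+1%:R^-1 x|%R)%:E))%E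
    @[rho --> 0^'+] --> 0%E by move: bx; apply: contrapT; exact: (nFn n.+3).
have bu : b < ub x by rewrite (lt_le_trans bG)// (le_trans Gg).
have : \forall a \near 0^'+, b < tr a x.
  by apply: (tx [set t | b < t]); exact: lt_nbhsr.
rewrite near_withinE => /nbhs_ballP[d /= d0 hd].
(* Below [d] the trace of the truncation exceeds [b]; below [b] the truncation does not alter the
   condition [u < b]. *)
have [n nd] : exists n : nat, n.+1%:R^-1 < Num.min d b.
  have m0 : 0 < Num.min d b by rewrite lt_min d0.
  exists (Num.truncn (Num.min d b)^-1).
  by rewrite -[ltRHS]invrK ltf_pV2 ?posrE ?invr_gt0// truncnS_gt.
move: nd; rewrite lt_min => /andP[nd nb].
have btr : b < tr n.+1%:R^-1 x.
  by apply: hd => //; rewrite /ball/= sub0r normrN gtr0_norm.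
have mt : measurable_fun (eball 0 r : set (lebT R N)) (truncate_below n.+1%:R^-1 \o u).
  by apply: measurable_maxr => //; exact: measurable_cst.
move=> eps e0; have [rho0 rho00 Hr] := trace_thin_at (@open_eball R N 0 r) mt btr (trx n) e0.
exists rho0 => // rho rr; apply: le_trans (Hr rho rr).
apply: (le_outer_measure (lebN_om R N)) => y [[Oy uy] xy]; split=> //; split=> //=.
by rewrite /truncate_below gt_max uy.
Qed.

(** * The inequality obtained by testing at two levels *)

Lemma lebN_ae_mono (R : realType) (N : nat) (P Q : 'rV[R]_N -> Prop) :
  {ae lebN R N, forall x, P x} -> (forall x, P x -> Q x) ->
  {ae lebN R N, forall x, Q x}.
Proof.
move=> [A [mA A0 PA]] PQ; exists A; split=> // x nQx; apply: PA => /PQ.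
exact: nQx.
Qed.

Lemma lebN_ae_and (R : realType) (N : nat) (P Q : 'rV[R]_N -> Prop) :
  {ae lebN R N, forall x, P x} -> {ae lebN R N, forall x, Q x} ->
  {ae lebN R N, forall x, P x /\ Q x}.
Proof.
move=> HP HQ; have := negligibleU HP HQ; apply: negligibleS => x /= /not_andP[|].
  by left.
by right.
Qed.

Lemma Linfty_continuous (R : realType) (N : nat) (r : R) (f : 'rV[R]_N -> R) :
  continuous f -> Linfty (lebN R N) (eball 0 r) f.
Proof.
move=> cf; split; first exact: measurable_continuous.
have cn : continuous (fun x => `|f x|).
  by apply: (continuous_compose cf); exact: norm_continuous.
have [B0|/set0P B0] := eqVneq [set x : 'rV[R]_N | enorm x <= r] set0.
  exists 0; apply: aeW => x; rewrite /eball/= subr0 => xr.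
  have : [set x : 'rV[R]_N | enorm x <= r] x by exact: ltW.
  by rewrite B0.
have [c _ cmax] := EVT_max_rV B0 (@compact_enorm_le R N r) (continuous_subspaceT cn).
exists `|f c|; apply: aeW => x; rewrite /eball/= subr0 => xr.
by apply: cmax; rewrite inE/=; exact: ltW.
Qed.

Lemma lebN_eball_lty (R : realType) (N : nat) (r : R) (c : 'rV[R]_N) : 0 <= r ->
  (lebN R N (eball c r) < +oo)%E.
Proof. by move=> r0; apply: le_lt_trans (lebN_eball_le c r0) _; rewrite ltry. Qed.

Lemma dotp_grad (R : realType) (N : nat) (z : 'rV[R]_N) (phi : 'rV[R]_N -> R) x :
  dotp z (grad phi x) = \sum_j z 0 j * partial j phi x.
Proof. by apply: eq_bigr => j _; rewrite /grad mxE. Qed.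

Lemma phi_m_ge0 (R : realType) (m s : R) : 0 <= m -> 0 <= phi_m m s.
Proof. by move=> m0; rewrite divr_ge0 ?powR_ge0// addr_ge0. Qed.

Lemma phi_m_le (R : realType) (m s t : R) : 0 <= m -> 0 <= s -> s <= t ->
  phi_m m s <= phi_m m t.
Proof.
move=> m0 s0 st; rewrite ler_wpM2r ?invr_ge0 ?addr_ge0//.
by rewrite ge0_ler_powR ?nnegrE ?addr_ge0// (le_trans s0).
Qed.

Lemma truncate_itv (R : realType) (a b s : R) : a <= b -> a <= truncate a b s <= b.
Proof.
by move=> ab; rewrite /truncate le_max lexx orbT/= ge_max ab ge_min lexx.
Qed.

Lemma Linfty_truncate (R : realType) (N : nat) (D : set 'rV[R]_N) (a b : R)
    (u : 'rV[R]_N -> R) :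
  0 < a -> a < b -> measurable_fun (D : set (lebT R N)) u ->
  Linfty (lebN R N) D (fun x => truncate a b (u x)).
Proof.
move=> a0 ab mu; split.
  by apply: measurable_maxr; [apply: measurable_minr => //|]; exact: measurable_cst.
exists b; apply: aeW => x _; have /andP[h1 h2] := truncate_itv (u x) (ltW ab).
by rewrite ger0_norm// (le_trans (ltW a0)).
Qed.

Lemma Linfty_phi_m_truncate (R : realType) (N : nat) (D : set 'rV[R]_N) (m a b : R)
    (u : 'rV[R]_N -> R) :
  0 <= m -> 0 < a -> a < b -> measurable_fun (D : set (lebT R N)) u ->
  Linfty (lebN R N) D (fun x => phi_m m (truncate a b (u x))).
Proof.
move=> m0 a0 ab mu; split.
  have [mT _] := Linfty_truncate a0 ab mu.
  apply: measurable_funM; last exact: measurable_cst.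
  by apply: (@measurableT_comp _ _ _ _ _ _ (fun s : R => s `^ (m + 1))) => //; exact: measurable_powR.
exists (phi_m m b); apply: aeW => x _; have /andP[h1 h2] := truncate_itv (u x) (ltW ab).
by rewrite ger0_norm ?phi_m_ge0// phi_m_le// (le_trans (ltW a0)).
Qed.

(** The component [i0] of condition (1), tested with [alpha], bounds the integral of
    [T(u) (d alpha + z . grad alpha)] by that of [phi(T(u))] times the partial derivative of
    [alpha]. Passing to [b - T(u)] and [phi(b) - phi(T(u))] adds integrals that vanish, since [d] is
    the divergence of [z] and [alpha] has compact support. The bound [d <= u] comes from
    [f >= 0]. *)
Lemma solution_levels (R : realType) (N : nat) (m r : R) (f g u : 'rV[R]_N -> R)
    (i0 : 'I_N) :
  0 < m -> 0 < r -> Linfty (lebN R N) (eball 0 r) f ->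
  {ae lebN R N, forall x, eball 0 r x -> 0 <= f x} ->
  is_solution m (eball 0 r) f g u ->
  exists (z : 'rV[R]_N -> 'rV[R]_N) (d : 'rV[R]_N -> R),
  [/\ forall j, Linfty (lebN R N) (eball 0 r) (fun x => z x 0 j),
      Linfty (lebN R N) (eball 0 r) d,
      {ae lebN R N, forall x, eball 0 r x -> d x <= u x},
      {ae lebN R N, forall x, eball 0 r x -> forall j, `|z x 0 j| <= u x `^ m} &
      forall a b alpha, 0 < a -> a < b -> test_function (eball 0 r) alpha ->
        (forall x, 0 <= alpha x) -> (exists M, forall x, alpha x <= M) ->
        0 <= \int[lebN R N]_(x in eball 0 r)
         ((b - truncate a b (u x)) * (d x * alpha x + dotp (z x) (grad alpha x)) -
          (phi_m m b - phi_m m (truncate a b (u x))) * partial i0 alpha x)].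
Proof.
move=> m0 r0 Lf f0 [[u0 _ _] Lu [w [d [ub [zn]]]]].
set z := fun x => _; move=> [[Lw w1] [Lz Ld dz] _ [lev dz' _ _]].
set O := eball 0 r in Lf f0 u0 Lu Lw w1 Lz Ld dz lev dz' *.
have oO : open O by exact: open_eball.
have Ofin : (lebN R N O < +oo)%E by apply: lebN_eball_lty; exact: ltW.
have mO : measurable (O : set (lebT R N)) := measurable_open oO.
have int h : Linfty (lebN R N) O h -> (lebN R N).-integrable O (EFin \o h).
  exact: Linfty_integrable.
have mu : measurable_fun (O : set (lebT R N)) u by case: Lu.
have Lal alpha : test_function O alpha -> Linfty (lebN R N) O alpha.
  by move=> [/(_ 0%N)[ca _] _]; exact: Linfty_continuous.
have Lpal alpha j : test_function O alpha -> Linfty (lebN R N) O (partial j alpha).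
  move=> [/(_ 1%N)[_ /(_ j)[_ [ca _]]] _]; exact: Linfty_continuous.
have Lzg alpha : test_function O alpha ->
    Linfty (lebN R N) O (fun x => dotp (z x) (grad alpha x)).
  move=> ta; rewrite (_ : (fun x => _) = fun x => \sum_j z x 0 j * partial j alpha x).
    by apply: Linfty_sum => j; apply: Linfty_mul; [exact: Lz|exact: Lpal].
  by apply/funext => x; rewrite dotp_grad.
have dE : {ae lebN R N, forall x, O x -> d x - (u x - f x) = 0}.
  have Le : Linfty (lebN R N) O (fun x => d x - (u x - f x)).
    exact: (Linfty_add Ld (Linfty_opp (Linfty_add Lu (Linfty_opp Lf)))).
  apply: (Linfty_test_eq0 oO Ofin Le) => phi tphi.
  under eq_Rintegral do rewrite mulrBl.
  rewrite RintegralB//.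
  - by rewrite -[X in X - _]opprK -[X in _ - X]opprK -(dz _ tphi) -(dz' _ tphi) subrr.
  - by apply: int; apply: Linfty_mul => //; exact: Lal.
  - exact: int (Linfty_mul (Linfty_add Lu (Linfty_opp Lf)) (Lal phi tphi)).
exists z, d; split => //.
- apply: (lebN_ae_mono (lebN_ae_and dE f0)) => x [{}dE {}f0] Ox; have := dE Ox; have := f0 Ox; lra.
- apply: (lebN_ae_mono w1) => x {}w1 Ox j; rewrite /z mxE normrM ger0_norm ?powR_ge0//.
  by rewrite ler_piMr ?powR_ge0// (le_trans (normr_coord_le_enorm _ _))// w1.
have T0 a b : 0 < a -> a < b -> Linfty (lebN R N) O (fun x => truncate a b (u x)).
  by move=> a0 ab; exact: Linfty_truncate.
have P0 a b : 0 < a -> a < b -> Linfty (lebN R N) O (fun x => phi_m m (truncate a b (u x))).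
  by move=> a0 ab; apply: Linfty_phi_m_truncate => //; exact: ltW.
have pair a b alpha : 0 < a -> a < b -> test_function O alpha ->
    (forall x, 0 <= alpha x) -> (exists M, forall x, alpha x <= M) ->
    `|\int[lebN R N]_(x in O) (phi_m m (truncate a b (u x)) * partial i0 alpha x)| <=
    - \int[lebN R N]_(x in O) (truncate a b (u x) *
        (d x * alpha x + dotp (z x) (grad alpha x))).
  move=> a0 ab ta al0 alM; have [lam [nu [plam gnu tv]]] := lev a b a0 ab.
  have ca : continuous alpha by case: ta => [/(_ 0%N)[]].
  have := @normr_charge_integral_le R N lam (nu i0) O alpha oO _ ca al0 alM.
  move=> /(_ _); rewrite (plam _ ta) => H.
  have -> : \int[lebN R N]_(x in O) (phi_m m (truncate a b (u x)) * partial i0 alpha x) =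
    - charge_integral (nu i0) O alpha by exact: gnu.
  rewrite normrN; apply: le_trans (H _) _.
    by move=> B mB BO; apply: le_trans (le_total_variation nu i0 mB) (tv B mB BO).
  under [X in _ <= - X]eq_Rintegral do rewrite mulrDr.
  rewrite RintegralD//; last 2 first.
  - apply: int; apply: Linfty_mul; first exact: T0.
    by apply: Linfty_mul => //; exact: Lal.
  - by apply: int; apply: Linfty_mul; [exact: T0|exact: Lzg].
  rewrite opprD le_eqVlt; apply/orP; left; apply/eqP; congr (- _ - _).
  by apply: eq_Rintegral => x _; rewrite /= -mulrA [alpha x * _]mulrC.
have divz alpha : test_function O alpha ->
    \int[lebN R N]_(x in O) (d x * alpha x + dotp (z x) (grad alpha x)) = 0.
  move=> ta; rewrite RintegralD//; last 2 first.
  - by apply: int; apply: Linfty_mul => //; exact: Lal.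
  - by apply: int; exact: Lzg.
  by rewrite (dz _ ta) subrr.
(* At a level above the supremum of u, [T u] is constant and both measures vanish. *)
have ipart alpha : test_function O alpha ->
    (forall x, 0 <= alpha x) -> (exists M, forall x, alpha x <= M) ->
    \int[lebN R N]_(x in O) partial i0 alpha x = 0.
  move=> ta al0 alM; have [_ [M uM]] := Lu.
  pose a := `|M| + 1; have a0 : 0 < a by rewrite ltr_wpDl.
  have ab : a < a + 1 by rewrite ltrDl.
  have Ta : {ae lebN R N, forall x, O x -> truncate a (a + 1) (u x) = a}.
    apply: (lebN_ae_mono uM) => x {}uM Ox; rewrite /truncate; apply/max_idPr.
    rewrite ge_min; apply/orP; right; rewrite (le_trans (ler_norm _))// (le_trans (uM Ox))//.
    by rewrite (le_trans (ler_norm _))// /a lerDl.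
  have := pair a (a + 1) alpha a0 ab ta al0 alM.
  have -> : \int[lebN R N]_(x in O) (truncate a (a + 1) (u x) *
      (d x * alpha x + dotp (z x) (grad alpha x))) = 0.
    have L2 : Linfty (lebN R N) O (fun x => d x * alpha x + dotp (z x) (grad alpha x)).
      by apply: Linfty_add; [apply: Linfty_mul => //; exact: Lal|exact: Lzg].
    have Tae : {ae lebN R N, forall x, O x ->
        truncate a (a + 1) (u x) * (d x * alpha x + dotp (z x) (grad alpha x)) =
        a * (d x * alpha x + dotp (z x) (grad alpha x))}.
      by apply: (lebN_ae_mono Ta) => x {}Ta Ox; rewrite Ta.
    apply: (etrans (ae_eq_Rintegral mO (Linfty_mul (T0 _ _ a0 ab) L2).1
      (Linfty_mul (Linfty_cst (lebN R N) O a) L2).1 Tae)).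
    rewrite RintegralZl ?divz ?mulr0//; exact: int L2.
  rewrite oppr0 normr_le0 => /eqP.
  have Tae : {ae lebN R N, forall x, O x ->
      phi_m m (truncate a (a + 1) (u x)) * partial i0 alpha x =
      phi_m m a * partial i0 alpha x}.
    by apply: (lebN_ae_mono Ta) => x {}Ta Ox; rewrite Ta.
  have -> := ae_eq_Rintegral mO (Linfty_mul (P0 _ _ a0 ab) (Lpal alpha i0 ta)).1
    (Linfty_mul (Linfty_cst (lebN R N) O (phi_m m a)) (Lpal alpha i0 ta)).1 Tae.
  rewrite RintegralZl//; last exact: int (Lpal alpha i0 ta).
  move=> /eqP; rewrite mulf_eq0 => /orP[|/eqP//].
  by rewrite gt_eqF// divr_gt0 ?powR_gt0// addr_gt0.
move=> a b alpha a0 ab ta al0 alM.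
have L1 := T0 a b a0 ab; have L2 := P0 a b a0 ab.
have L3 := Lpal alpha i0 ta.
have L4 : Linfty (lebN R N) O (fun x => d x * alpha x + dotp (z x) (grad alpha x)).
  by apply: Linfty_add; [apply: Linfty_mul => //; exact: Lal|exact: Lzg].
have c (k : R) : Linfty (lebN R N) O (fun=> k) := Linfty_cst (lebN R N) O k.
rewrite (_ : (fun x => _) = (fun x =>
   (b * (d x * alpha x + dotp (z x) (grad alpha x)) -
    truncate a b (u x) * (d x * alpha x + dotp (z x) (grad alpha x))) -
   (phi_m m b * partial i0 alpha x -
    phi_m m (truncate a b (u x)) * partial i0 alpha x))); last first.
  by apply/funext => x; rewrite !mulrBl.
have I1 := int _ (Linfty_mul (c b) L4); have I2 := int _ (Linfty_mul L1 L4).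
have I3 := int _ (Linfty_mul (c (phi_m m b)) L3); have I4 := int _ (Linfty_mul L2 L3).
rewrite RintegralB//; last 2 first.
- exact: int (Linfty_add (Linfty_mul (c b) L4) (Linfty_opp (Linfty_mul L1 L4))).
- exact: int (Linfty_add (Linfty_mul (c (phi_m m b)) L3) (Linfty_opp (Linfty_mul L2 L3))).
rewrite RintegralB// RintegralB// RintegralZl ?divz ?mulr0//; last exact: int.
rewrite RintegralZl ?ipart ?mulr0//; last exact: int.
have := pair a b alpha a0 ab ta al0 alM; rewrite ler_norml => /andP[h _].
by move: h; rewrite (divz alpha ta) mulr0; lra.
Qed.

(** * The summed integrand with cutoff, and the ramps *)

(** Convexity on the left of 1/2: mean value theorem and monotonicity of the derivative. *)
Lemma expinv0_sub_le (R : realType) (s e : R) : 0 < e -> s <= 2^-1 ->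
  expinv 0 s - expinv 0 (s - e) <= e * expinv 2 s.
Proof.
move=> e0 s2; have se : s - e < s by rewrite ltrBlDr ltrDl.
have [|c] := @MVT R (expinv 0) (expinv 2) (s - e) s se (fun x _ => is_derive_expinv0 x).
  by apply: continuous_subspaceT; exact: continuous_expinv.
rewrite in_itv/= => /andP[_ cs] ->.
rewrite opprB addrCA subrr addr0 mulrC ler_wpM2l ?(ltW e0)//.
by apply: expinv2_le => //; exact: ltW.
Qed.

Lemma level_le_expR (R : realType) (lam h : R) n : 0 <= lam -> 0 <= h ->
  level lam h n <= lam * expR (n%:R * h).
Proof.
move=> l0 h0; rewrite expRM_natl ler_wpM2l// lerXn2r ?nnegrE ?expR_ge0 ?addr_ge0//.
exact: expR_ge1Dx.
Qed.

(** The part where the ramp is differentiated is [chi] times [level_term]. The part where [chi] is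
    differentiated vanishes for [u >= b], and is bounded crudely, level by level, elsewhere; hence
    the factor [n]. *)
Lemma level_integrand_le (R : realType) (I : finType) (i0 : I)
    (m lam h u b chi d : R) (th dth : nat -> R) (n : nat) (z dchi : I -> R) :
  1 <= m -> 1 <= lam -> 0 < h -> 0 <= u -> level lam h n <= b ->
  (forall k, 0 <= th k <= 1) -> (forall k, 0 <= dth k) ->
  (forall k, (k < n)%N -> th k - th k.+1 <= h * dth k) -> th n = 0 ->
  0 <= chi <= 1 -> d <= u -> (forall j, `|z j| <= u `^ m) ->
  \sum_(k < n)
    ((level lam h k.+1 - truncate (level lam h k) (level lam h k.+1) u) *
      (d * (th k * chi) +
       \sum_j z j * (chi * ((i0 == j)%:R * dth k) + th k * dchi j)) -
     (phi_m m (level lam h k.+1) -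
      phi_m m (truncate (level lam h k) (level lam h k.+1) u)) *
      (chi * dth k + th k * dchi i0)) <=
  chi * (2 * h * b ^+ 2 - lam * Num.max (lam - u) 0 * th 0%N) +
    n%:R * ((b * b `^ m + phi_m m b) * (u < b)%R%:R * \sum_j `|dchi j|).
Proof.
move=> m1 lam1 h0 u0 bn th01 dth0 thd thn /andP[c0 c1] du zu.
have m0 : 0 <= m by rewrite (le_trans _ m1).
have main := sum_level_term_le m1 lam1 h0 u0 bn th01 dth0 thd thn.
apply: le_trans (lerD (ler_wpM2l c0 main) (lexx _)).
have nE (y : R) : n%:R * y = \sum_(k < n) y by rewrite sumr_const card_ord mulr_natl.
rewrite mulr_sumr nE -big_split/=.
apply: ler_sum => k _.
set t := level lam h.
have t1 j : 1 <= t j.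
  elim: j => [|j ih]; first by rewrite /t /level expr0 mulr1.
  by rewrite /t /level exprS mulrCA -/(level lam h j) -/t; nra.
have tS j : t j <= t j.+1.
  by rewrite /t /level exprS mulrCA -/(level lam h j) -/t; have := t1 j; nra.
have tmono i j : t j <= t (i + j)%N.
  by elim: i => // i /le_trans; apply; rewrite addSn.
have tb : t k.+1 <= b.
  by apply: le_trans bn; have := tmono (n - k.+1)%N k.+1; rewrite subnK.
have b0 : 0 <= b by rewrite (le_trans _ tb)// (le_trans ler01).
have /andP[T1 T2] := truncate_itv u (tS k).
rewrite /level_term -/t; set T := truncate _ _ _ in T1 T2 *.
have T0 : 0 <= T by rewrite (le_trans _ T1)// (le_trans ler01).
have [th0 th1] := andP (th01 k); have d0 := dth0 k.
set q := t k.+1 - T; set p := _ - phi_m m T.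
have q0 : 0 <= q by rewrite subr_ge0.
have p0 : 0 <= p by rewrite subr_ge0 phi_m_le.
set S := \sum_j `|dchi j|; have S0 : 0 <= S by apply: sumr_ge0.
have dS j : `|dchi j| <= S by rewrite /S (bigD1 j)//= lerDl sumr_ge0.
pose Z := \sum_j z j * dchi j.
have -> : \sum_j z j * (chi * ((i0 == j)%:R * dth k) + th k * dchi j) =
    chi * dth k * z i0 + th k * Z.
  rewrite /Z mulr_sumr -[chi * _ * _](_ : \sum_j (if j == i0 then chi * dth k * z j else 0) = _); last first.
    by rewrite -big_mkcond big_pred1_eq.
  rewrite -big_split/=; apply: eq_bigr => j _; rewrite eq_sym.
  by case: eqP => _; rewrite ?mul1r ?mul0r; ring.
have um0 : 0 <= u `^ m by exact: powR_ge0.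
have ZS : `|Z| <= u `^ m * S.
  rewrite (le_trans (ler_norm_sum _ _ _))// mulr_sumr; apply: ler_sum => j _.
  by rewrite normrM ler_wpM2r.
have z1 : z i0 <= u `^ m by exact: le_trans (ler_norm _) (zu i0).
have A1 : q * (d * (th k * chi) + chi * dth k * z i0) - p * (chi * dth k) <=
    chi * (q * (u * th k + u `^ m * dth k) - p * dth k).
  have B1 : q * (chi * th k) * d <= q * (chi * th k) * u by rewrite ler_wpM2l// !mulr_ge0.
  have B2 : q * (chi * dth k) * z i0 <= q * (chi * dth k) * u `^ m by rewrite ler_wpM2l// !mulr_ge0.
  by nra.
have A2 : q * (th k * Z) - p * (th k * dchi i0) <= th k * ((q * u `^ m + p) * S).
  have B1 : Z <= u `^ m * S := le_trans (ler_norm _) ZS.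
  have B2 : - dchi i0 <= S by rewrite (le_trans _ (dS i0))// -normrN ler_norm.
  have B3 : q * th k * Z <= q * th k * (u `^ m * S) by rewrite ler_wpM2l// mulr_ge0.
  have B4 : p * th k * (- dchi i0) <= p * th k * S by rewrite ler_wpM2l// mulr_ge0.
  by nra.
have A3 : (q * u `^ m + p) <= (b * b `^ m + phi_m m b) * (u < b)%R%:R.
  have [ub|bu] := ltP u b.
    rewrite mulr1; apply: lerD.
      apply: ler_pM => //; first by rewrite /q; lra.
      by rewrite ge0_ler_powR ?nnegrE// ltW.
    rewrite /p lerBlDr (le_trans (phi_m_le m0 _ tb)) ?(le_trans ler01)// lerDl.
    exact: phi_m_ge0.
  have TE : T = t k.+1.
    by rewrite /T /truncate (min_idPl (le_trans tb bu)) (max_idPl (tS k)).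
  by rewrite /q /p TE !subrr mul0r add0r mulr0.
have A4 : th k * ((q * u `^ m + p) * S) <= (b * b `^ m + phi_m m b) * (u < b)%R%:R * S.
  apply: (@le_trans _ _ ((q * u `^ m + p) * S)).
    by rewrite ler_piMl// mulr_ge0// addr_ge0// mulr_ge0.
  by rewrite ler_wpM2r.
have := lerD A1 (le_trans A2 A4); apply: le_trans.
by rewrite le_eqVlt; apply/orP; left; apply/eqP; ring.
Qed.

Lemma Rintegral_sum_Linfty d (T : measurableType d) (R : realType)
    (mu : {measure set T -> \bar R}) (D : set T) (I : Type) (s : seq I)
    (F : I -> T -> R) :
  measurable D -> (mu D < +oo)%E -> (forall k, Linfty mu D (F k)) ->
  \int[mu]_(x in D) (\sum_(k <- s) F k x) = \sum_(k <- s) \int[mu]_(x in D) F k x.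
Proof.
move=> mD Dfin LF; elim: s => [|k s ih].
  rewrite big_nil; under eq_Rintegral do rewrite big_nil.
  by rewrite Rintegral_cst// mul0r.
rewrite big_cons -ih; under eq_Rintegral do rewrite big_cons.
by rewrite RintegralD//; apply: Linfty_integrable => //; exact: Linfty_sum.
Qed.

Lemma Linfty_indic d (T : measurableType d) (R : realType)
    (mu : {measure set T -> \bar R}) (D A : set T) :
  measurable A -> Linfty mu D (\1_A : T -> R).
Proof.
move=> mA; split; first exact: measurable_indic.
by exists 1; apply: aeW => x _; rewrite indicE; case: (x \in A); rewrite ?normr0 ?normr1.
Qed.

Lemma Rintegral_indic_sub d (T : measurableType d) (R : realType)
    (mu : {measure set T -> \bar R}) (D A : set T) :
  measurable D -> measurable A -> A `<=` D ->
  \int[mu]_(x in D) (\1_A x : R) = fine (mu A).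
Proof.
move=> mD mA AD; rewrite /Rintegral integral_indic//.
by congr (fine (mu _)); apply/setIidPl.
Qed.

(* The scaling keeps the argument below 1/2 on the ball of radius r, and there
   [expinv 0] is convex. *)
Definition ramp (R : realType) (N : nat) (i0 : 'I_N) (r c : R) (x : 'rV[R]_N) : R :=
  expinv 0 ((4 * r)^-1 * (x 0 i0 + (r - c))).

Definition dramp (R : realType) (N : nat) (i0 : 'I_N) (r c : R) (x : 'rV[R]_N) : R :=
  (4 * r)^-1 * expinv 2 ((4 * r)^-1 * (x 0 i0 + (r - c))).

Lemma isC_ramp (R : realType) (N : nat) (i0 : 'I_N) (r c : R) k :
  isC k (ramp i0 r c).
Proof.
apply: (@isC_compose _ _ _ (fun x : 'rV[R]_N => (4 * r)^-1 * (x 0 i0 + (r - c))) (expinv 0)).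
  apply: isC_mul; first exact: isC_cst.
  by apply: isC_add; [exact: isC_coord|exact: isC_cst].
exact: smooth1_expinv.
Qed.

Lemma is_derive_ramp (R : realType) (N : nat) (i0 j : 'I_N) (r c : R) (x : 'rV[R]_N) :
  is_derive x (delta_mx 0 j) (ramp i0 r c) ((i0 == j)%:R * dramp i0 r c x).
Proof.
have d1 : is_derive x (delta_mx 0 j) (fun y : 'rV[R]_N => y 0 i0 + (r - c))
    ((i0 == j)%:R + 0).
  by apply: is_deriveD; exact: is_derive_coord.
have d2 := @is_deriveZ R _ R^o _ (4 * r)^-1 x _ _ d1.
have d3 := @is_derive_compose R N (fun y : 'rV[R]_N => (4 * r)^-1 * (y 0 i0 + (r - c)))
  (expinv 0) x _ _ _ d2 (is_derive_expinv0 _).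
rewrite (_ : _ * dramp i0 r c x = expinv 2 ((4 * r)^-1 * (x 0 i0 + (r - c))) *
  ((4 * r)^-1 *: ((i0 == j)%:R + 0)))//.
by rewrite /dramp addr0 /GRing.scale/=; ring.
Qed.

Lemma ramp_itv (R : realType) (N : nat) (i0 : 'I_N) (r c : R) x :
  0 <= @ramp R N i0 r c x <= 1.
Proof. by rewrite expinv_ge0 expinv0_le1. Qed.

Lemma dramp_ge0 (R : realType) (N : nat) (i0 : 'I_N) (r c : R) x :
  0 < r -> 0 <= @dramp R N i0 r c x.
Proof. by move=> r0; rewrite mulr_ge0 ?expinv_ge0// invr_ge0 mulr_ge0// ltW. Qed.

(** Provides the hypothesis [th k - th k.+1 <= h * dth k] of the summation by parts. *)
Lemma ramp_sub_le (R : realType) (N : nat) (i0 : 'I_N) (r c h : R) x :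
  0 < r -> 0 < h -> 0 <= c -> enorm x < r ->
  @ramp R N i0 r c x - ramp i0 r (c + h) x <= h * dramp i0 r c x.
Proof.
move=> r0 h0 c0 xr.
have r40 : 0 < (4 * r)^-1 by rewrite invr_gt0 mulr_gt0.
rewrite /ramp /dramp mulrA [h * _]mulrC.
rewrite (_ : (4 * r)^-1 * (x 0 i0 + (r - (c + h))) =
  (4 * r)^-1 * (x 0 i0 + (r - c)) - (4 * r)^-1 * h); last by ring.
apply: expinv0_sub_le; first by rewrite mulr_gt0.
rewrite mulrC ler_pdivrMr ?mulr_gt0//.
have := le_lt_trans (ler_norm _) (le_lt_trans (normr_coord_le_enorm x i0) xr).
by lra.
Qed.

Lemma test_function_ramp (R : realType) (N : nat) (i0 : 'I_N) (r c : R)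
    (O : set 'rV[R]_N) (chi : 'rV[R]_N -> R) :
  test_function O chi -> test_function O (fun x => ramp i0 r c x * chi x).
Proof.
move=> [Cchi [K [cK KO chi0]]]; split.
  by move=> k; apply: isC_mul; [exact: isC_ramp|exact: Cchi].
by exists K; split=> // x /chi0 ->; rewrite mulr0.
Qed.

Lemma partial_ramp (R : realType) (N : nat) (i0 j : 'I_N) (r c : R)
    (chi : 'rV[R]_N -> R) x : isC 1 chi ->
  partial j (fun x => ramp i0 r c x * chi x) x =
    chi x * ((i0 == j)%:R * dramp i0 r c x) + ramp i0 r c x * partial j chi x.
Proof.
move=> Cchi; have d1 := is_derive_ramp i0 j r c x; have d2 := isCP Cchi j x.
have [_ E] := is_deriveM d1 d2.
by rewrite [LHS]E addrC.
Qed.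

(** * Vanishing of the defect *)

(** What the sum over the levels controls at the bottom level. The ramp with [c = 0] is positive on
    the open ball, so a defect equal to 0 forces [u >= lam] on the smaller ball. *)
Definition defect (R : realType) (N : nat) (i0 : 'I_N) (r r0 lam : R)
    (u : 'rV[R]_N -> R) (x : 'rV[R]_N) : R :=
  \1_[set y : 'rV[R]_N | enorm y <= r0] x * (Num.max (lam - u x) 0 * ramp i0 r 0 x).

Lemma defect_ge0 (R : realType) (N : nat) (i0 : 'I_N) (r r0 lam : R)
    (u : 'rV[R]_N -> R) (x : 'rV[R]_N) : 0 <= defect i0 r r0 lam u x.
Proof.
by rewrite !mulr_ge0 ?indicE// ?le_max ?lexx ?orbT// expinv_ge0.
Qed.

Lemma Linfty_defect (R : realType) (N : nat) (i0 : 'I_N) (r r0 lam : R)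
    (u : 'rV[R]_N -> R) :
  0 <= lam -> measurable_fun (eball 0 r : set (lebT R N)) u ->
  (forall x, eball 0 r x -> 0 <= u x) ->
  Linfty (lebN R N) (eball 0 r) (defect i0 r r0 lam u).
Proof.
move=> l0 mu u0; apply: Linfty_mul.
  apply: Linfty_indic; rewrite -[X in measurable X]setCK; apply: measurableC.
  by apply: measurable_open; apply: closed_openC; exact: closed_enorm_le.
apply: Linfty_mul; last first.
  by apply: Linfty_continuous; exact: isC_continuous (isC_ramp i0 r 0 0).
split.
  apply: measurable_maxr; last exact: measurable_cst.
  by apply: measurable_funB => //; exact: measurable_cst.
exists lam; apply: aeW => x Ox; have ux := u0 x Ox.
by rewrite ger0_norm ?le_max ?lexx ?orbT// ge_max l0 gerBl ux.
Qed.

(** The first term on the right is the discretisation error of [n] levels, and [eps] is the cost of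
    the cutoff. They are independent, because the covering is chosen after [n]. *)
Lemma defect_integral_le (R : realType) (N : nat) (i0 : 'I_N) (m r r0 lam G : R)
    (f g u : 'rV[R]_N -> R) (n : nat) (eps : R) :
  1 <= m -> 0 < r -> r0 < r -> 1 <= lam -> lam * expR (2 * r) < G ->
  Linfty (lebN R N) (eball 0 r) f ->
  {ae lebN R N, forall x, eball 0 r x -> 0 <= f x} ->
  {ae hausdorff R N N.-1, forall x, boundary (eball 0 r) x -> G <= g x} ->
  is_solution m (eball 0 r) f g u ->
  (0 < n)%N -> 0 < eps ->
  lam * \int[lebN R N]_(x in eball 0 r) defect i0 r r0 lam u x <=
    2 * (2 * r / n%:R) * (lam * expR (2 * r)) ^+ 2 * fine (lebN R N (eball 0 r)) + eps.
Proof.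
move=> m1 r_gt0 r0r lam1 bG Lf f0 gG sol n0 eps0.
set b := lam * expR (2 * r) in bG *.
have m0 : 0 < m by rewrite (lt_le_trans _ m1).
have lam0 : 0 < lam by rewrite (lt_le_trans _ lam1).
have b0 : 0 < b by rewrite mulr_gt0 ?expR_gt0.
have nR : 0 < n%:R :> R by rewrite ltr0n.
(* With [n h = 2 r] the last ramp vanishes on the whole ball and the top level stays below
   [lam exp(2 r) = b]. *)
pose h := 2 * r / n%:R; have h0 : 0 < h by rewrite divr_gt0// mulr_gt0.
have bn : level lam h n <= b.
  apply: le_trans (level_le_expR n (ltW lam0) (ltW h0)) _.
  by rewrite /h mulrCA divff ?mulr1 ?gt_eqF.
set O : set 'rV[R]_N := eball 0 r.
have oO : open O by exact: open_eball.
have mO : measurable (O : set (lebT R N)) := measurable_open oO.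
have Ofin : (lebN R N O < +oo)%E by apply: lebN_eball_lty; exact: ltW.
have N0 : (0 < N)%N := leq_ltn_trans (leq0n i0) (ltn_ord i0).
have [[u0 _ _] Lu _] := sol.
have mu : measurable_fun (O : set (lebT R N)) u by case: Lu.
pose E := [set y | O y /\ u y < b].
have mE : measurable (E : set (lebT R N)).
  have := mu mO _ (measurable_itv `]-oo, b[).
  by rewrite (_ : O `&` _ = E)//; apply/seteqP; split=> y [Oy]; rewrite /= in_itv.
have EN : hausdorff_outer N.-1 [set x | enorm x = r /\ ~ thin_at E x] = 0%E.
  have [_ _ [w [d [ub [zn [_ _ [tub _] [_ _ gub _]]]]]]] := sol.
  exact: solution_thin r_gt0 b0 bG mu tub gG gub.
have [z [d [Lz Ld du zu lev]]] := solution_levels i0 m0 r_gt0 Lf f0 sol.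
pose C0 := b * b `^ m + phi_m m b.
have C00 : 0 <= C0 by rewrite addr_ge0 ?phi_m_ge0 ?(ltW m0)// mulr_ge0 ?powR_ge0 ?(ltW b0).
have dm0 : 0 <= dstep_max R by apply: le_trans (dstep_ge0 0) (dstep_le 0).
(* Collects the [n] levels, the bound [C0] of each, the [N] partial derivatives and the slope of a
   ball cutoff. *)
pose K := n%:R * C0 * (N%:R * (4 * dstep_max R)).
have K0 : 0 <= K by apply: mulr_ge0; apply: mulr_ge0 => //; exact: mulr_ge0.
have e1 : 0 < eps / (K + 1) by rewrite divr_gt0// ltr_wpDl.
(* Radii at most half of [r - r0] keep the doubled balls off the ball of radius [r0], where the
   cutoff must be 1. *)
have d0 : 0 < (r - r0) / 2 by rewrite divr_gt0// subr_gt0.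
have [s [sP scov ssum]] := sphere_thin_cover N0 r_gt0 EN e1 d0.
have sfar p : p \in s -> forall y, enorm y <= r0 -> 2 * p.2 <= enorm (y - p.1).
  move=> ps y yr; have [pr /andP[_ pd]] := sP p ps.
  have := ler_enormD y (p.1 - y); rewrite addrCA subrr addr0 pr -(enormN (p.1 - y)) opprB.
  by move: yr pd; clear; lra.
have spos p : p \in s -> 0 < p.2 by move=> /sP[_ /andP[]].
have [chi [tchi chi01 chi1 dchi]] := cutoff_of_cover r0r r_gt0 spos sfar scov.
have Cchi : isC 1 chi by have [] := tchi.
pose th k := ramp i0 r (k%:R * h); pose dth k := dramp i0 r (k%:R * h).
pose t := level lam h.
pose F (k : nat) (x : 'rV[R]_N) := (t k.+1 - truncate (t k) (t k.+1) (u x)) *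
    (d x * (th k x * chi x) + dotp (z x) (grad (fun x => th k x * chi x) x)) -
    (phi_m m (t k.+1) - phi_m m (truncate (t k) (t k.+1) (u x))) *
    partial i0 (fun x => th k x * chi x) x.
have t1 j : 1 <= t j.
  elim: j => [|j ih]; first by rewrite /t /level expr0 mulr1.
  by rewrite /t /level exprS mulrCA -/(level lam h j) -/t; move: h0 ih; clear; nra.
have tS j : t j < t j.+1.
  by rewrite /t /level exprS mulrCA -/(level lam h j) -/t; move: h0 (t1 j); clear; nra.
have tth k : test_function O (fun x => th k x * chi x) by exact: test_function_ramp.
have LF k : Linfty (lebN R N) O (F k).
  have tk0 : 0 < t k by rewrite (lt_le_trans _ (t1 k)).
  have LT := Linfty_truncate tk0 (tS k) mu.
  have LP := Linfty_phi_m_truncate (ltW m0) tk0 (tS k) mu.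
  have Cth := (tth k).1.
  have Lth : Linfty (lebN R N) O (fun x => th k x * chi x).
    by apply: Linfty_continuous; exact: isC_continuous (Cth 0%N).
  have Lp j : Linfty (lebN R N) O (partial j (fun x => th k x * chi x)).
    by apply: Linfty_continuous; have [_ /(_ j)[_ []]] := Cth 1%N.
  have Lzg : Linfty (lebN R N) O (fun x => dotp (z x) (grad (fun x => th k x * chi x) x)).
    have -> : (fun x => dotp (z x) (grad (fun x => th k x * chi x) x)) =
        fun x => \sum_j z x 0 j * partial j (fun x => th k x * chi x) x.
      by apply/funext => x; rewrite dotp_grad.
    by apply: Linfty_sum => j; exact: (Linfty_mul (Lz j) (Lp j)).
  exact: (Linfty_add (Linfty_mul (Linfty_add (Linfty_cst _ _ (t k.+1)) (Linfty_opp LT))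
     (Linfty_add (Linfty_mul Ld Lth) Lzg))
    (Linfty_opp (Linfty_mul (Linfty_add (Linfty_cst _ _ (phi_m m (t k.+1))) (Linfty_opp LP)) (Lp i0)))).
have F0 k : 0 <= \int[lebN R N]_(x in O) F k x.
  apply: lev => //.
  - by rewrite (lt_le_trans _ (t1 k)).
  - move=> x; have /andP[h1 _] := ramp_itv i0 r (k%:R * h) x.
    by have /andP[h2 _] := chi01 x; rewrite mulr_ge0.
  - exists 1 => x; have /andP[h1 h2] := ramp_itv i0 r (k%:R * h) x.
    by have /andP[h3 h4] := chi01 x; rewrite mulr_ile1.
have sumF : 0 <= \int[lebN R N]_(x in O) (\sum_(k < n) F k x).
  rewrite (@Rintegral_sum_Linfty _ _ _ (lebN R N) O _ _
    (fun (k : 'I_n) x => F k x) mO Ofin (fun k => LF k)).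
  by apply: sumr_ge0 => k _; exact: F0.
pose EB (p : 'rV[R]_N * R) : set (lebT R N) := E `&` eball p.1 (2 * p.2).
have mEB p : measurable (EB p) by apply: measurableI => //; exact/measurable_open/open_eball.
(* Pointwise majorant of the summed integrands. Its integral is nonnegative, which is the estimate
   sought once the three terms are integrated. *)
pose W (x : 'rV[R]_N) := 2 * h * b ^+ 2 + - (lam * defect i0 r r0 lam u x) +
   \sum_(p <- s) K / p.2 * \1_(EB p) x.
have Ldef : Linfty (lebN R N) O (defect i0 r r0 lam u).
  by apply: Linfty_defect => //; exact: ltW.
have Lp p : Linfty (lebN R N) O (fun x => K / p.2 * \1_(EB p) x).
  exact: (Linfty_mul (Linfty_cst _ _ _) (Linfty_indic _ _ (mEB p))).
have LEB : Linfty (lebN R N) O (fun x => \sum_(p <- s) K / p.2 * \1_(EB p) x).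
  exact: Linfty_sum.
have Ll : Linfty (lebN R N) O (fun x => - (lam * defect i0 r r0 lam u x)).
  exact: (Linfty_opp (Linfty_mul (Linfty_cst _ _ lam) Ldef)).
have LW0 := Linfty_add (Linfty_cst (lebN R N) O (2 * h * b ^+ 2)) Ll.
have LW : Linfty (lebN R N) O W := Linfty_add LW0 LEB.
have FW : {ae lebN R N, forall x, O x -> \sum_(k < n) F k x <= W x}.
  apply: (lebN_ae_mono (lebN_ae_and du zu)) => x [dux zux] Ox.
  have ux := u0 x Ox.
  have xr : enorm x < r by move: Ox; rewrite /O /eball/= subr0.
  have pE k j : partial j (fun x => th k x * chi x) x =
      chi x * ((i0 == j)%:R * dth k x) + th k x * partial j chi x by exact: partial_ramp.
  have -> : \sum_(k < n) F k x = \sum_(k < n)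
    ((level lam h k.+1 - truncate (level lam h k) (level lam h k.+1) (u x)) *
      (d x * (th k x * chi x) +
       \sum_j z x 0 j * (chi x * ((i0 == j)%:R * dth k x) + th k x * partial j chi x)) -
     (phi_m m (level lam h k.+1) -
      phi_m m (truncate (level lam h k) (level lam h k.+1) (u x))) *
      (chi x * dth k x + th k x * partial i0 chi x)).
    apply: eq_bigr => k _; rewrite /F dotp_grad pE eqxx mul1r -/t.
    by under eq_bigr do rewrite pE.
  have main := @level_integrand_le R _ i0 m lam h (u x) b (chi x) (d x)
    (fun k => th k x) (fun k => dth k x) n (fun j => z x 0 j) (fun j => partial j chi x)
    m1 lam1 h0 ux bn (fun k => ramp_itv _ _ _ _) (fun k => dramp_ge0 _ _ _ r_gt0).
  apply: le_trans (main _ _ (chi01 x) (dux Ox) (zux Ox)) _.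
  - move=> k kn; rewrite /th -(natr1 k) mulrDl mul1r; apply: ramp_sub_le => //.
    by rewrite mulr_ge0// ltW.
  - rewrite /th /ramp expinv_le0// mulr_ge0_le0 ?invr_ge0 ?mulr_ge0 ?(ltW r_gt0)//.
    rewrite /h mulrC divfK ?gt_eqF//.
    have := le_lt_trans (ler_norm _) (le_lt_trans (normr_coord_le_enorm x i0) xr).
    by clear; lra.
  have /andP[c0 c1] := chi01 x.
  rewrite /W; apply: lerD.
    set A := lam * Num.max (lam - u x) 0 * th 0%N x.
    have A0 : 0 <= A.
      rewrite mulr_ge0 ?mulr_ge0 ?(ltW lam0) ?le_max ?lexx ?orbT//.
      by have /andP[] := ramp_itv i0 r (0%:R * h) x.
    have B0 : 0 <= 2 * h * b ^+ 2 by rewrite mulr_ge0 ?sqr_ge0// mulr_ge0// ltW.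
    have defE : lam * defect i0 r r0 lam u x <= chi x * A.
      rewrite /defect /A /th mul0r indicE; case: (boolP (x \in _)) => [|_]; last first.
        by rewrite mul0r mulr0 mulr_ge0// -?[_ * _ * _]/A; move: A0; rewrite /A /th mul0r.
      by rewrite inE/= => xr0; rewrite chi1// !mul1r mulrA.
    have : chi x * (2 * h * b ^+ 2) <= 2 * h * b ^+ 2 by rewrite ler_piMl.
    by rewrite mulrBr; move: defE; clear; lra.
  rewrite -/C0 (_ : \sum_(p <- s) _ = n%:R * (C0 *
    \sum_(p <- s) N%:R * (4 * dstep_max R / p.2 * \1_(EB p) x))); last first.
    rewrite !mulr_sumr; apply: eq_bigr => p _; rewrite /K; ring.
  rewrite ler_wpM2l// -mulrA ler_wpM2l//.
  have [ub|bu] := ltP (u x) b; last first.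
    rewrite mul0r big_seq; apply: sumr_ge0 => p /spos p0.
    rewrite mulr_ge0// mulr_ge0 ?indicE//.
    by rewrite divr_ge0 ?(ltW p0)// mulr_ge0.
  rewrite mul1r; apply: le_trans (ler_sum _ (fun j _ => dchi x j Ox)) _.
  rewrite sumr_const card_ord -[leLHS]mulr_natl mulr_sumr ler_sum// => p _.
  rewrite ler_wpM2l// !indicE (_ : (x \in EB p) = (x \in eball p.1 (2 * p.2)))//.
  by rewrite /EB in_setI (_ : x \in E)//; apply/mem_set.
have IW : \int[lebN R N]_(x in O) W x = 2 * h * b ^+ 2 * fine (lebN R N O) -
    lam * \int[lebN R N]_(x in O) defect i0 r r0 lam u x +
    \sum_(p <- s) K / p.2 * fine (lebN R N (EB p)).
  have LI k := @Linfty_integrable _ _ _ (lebN R N) O k mO Ofin.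
  rewrite /W RintegralD//; [|exact: LI LW0|exact: LI LEB].
  rewrite RintegralD//; [|exact: LI (Linfty_cst _ _ _)|exact: LI Ll].
  rewrite (Rintegral_cst _ mO).
  rewrite (@Rintegral_sum_Linfty _ _ _ (lebN R N) O _ s
    (fun p x => K / p.2 * \1_(EB p) x) mO Ofin Lp).
  congr (_ + _ + _).
    under eq_Rintegral do rewrite -mulNr.
    by rewrite (RintegralZl _ mO (LI _ Ldef)) mulNr.
  apply: eq_bigr => p _.
  rewrite (RintegralZl _ mO (LI _ (Linfty_indic _ _ (mEB p)))).
  by rewrite (Rintegral_indic_sub _ mO (mEB p))// => y [[]].
have : 0 <= \int[lebN R N]_(x in O) W x.
  have LsF := Linfty_sum (index_enum 'I_n) (fun k : 'I_n => LF k).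
  apply: le_trans sumF _.
  exact: (ae_le_Rintegral mO (Linfty_integrable mO Ofin LsF) (Linfty_integrable mO Ofin LW) FW).
rewrite IW (_ : \sum_(p <- s) _ = K * \sum_(p <- s) fine (lebN R N (EB p)) / p.2); last first.
  by rewrite mulr_sumr; apply: eq_bigr => p _; rewrite mulrA mulrAC.
have Ke : K * (eps / (K + 1)) <= eps.
  rewrite mulrA ler_pdivrMr ?ltr_wpDl// mulrDr mulr1 mulrC lerDl; exact: ltW.
have := le_trans (ler_wpM2l K0 ssum) Ke.
by rewrite -/h -/O /EB; clear; lra.
Qed.

Lemma defect_integral_eq0 (R : realType) (N : nat) (i0 : 'I_N) (m r r0 lam G : R)
    (f g u : 'rV[R]_N -> R) :
  1 <= m -> 0 < r -> r0 < r -> 1 <= lam -> lam * expR (2 * r) < G ->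
  Linfty (lebN R N) (eball 0 r) f ->
  {ae lebN R N, forall x, eball 0 r x -> 0 <= f x} ->
  {ae hausdorff R N N.-1, forall x, boundary (eball 0 r) x -> G <= g x} ->
  is_solution m (eball 0 r) f g u ->
  \int[lebN R N]_(x in eball 0 r) defect i0 r r0 lam u x = 0.
Proof.
move=> m1 r_gt0 r0r lam1 bG Lf f0 gG sol.
have I0 : 0 <= \int[lebN R N]_(x in eball 0 r) defect i0 r r0 lam u x.
  by apply: Rintegral_ge0 => x _; exact: defect_ge0.
apply/eqP; rewrite eq_le I0 andbT leNgt; apply/negP => I_gt0.
set I := Rintegral _ _ _ in I0 I_gt0.
pose c := 4 * r * (lam * expR (2 * r)) ^+ 2 * fine (lebN R N (eball 0 r)).
have c0 : 0 <= c by rewrite mulr_ge0 ?fine_ge0// mulr_ge0 ?sqr_ge0// mulr_ge0// ltW.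
have l0 : 0 < lam by rewrite (lt_le_trans _ lam1).
have e0 : 0 < lam * I / 2 by rewrite divr_gt0// mulr_gt0.
(* A positive integral [I] is contradicted by taking [eps = lam I / 2] and [n] so large that the
   discretisation error is below the other half. *)
pose n := (Num.bound (c / (lam * I / 2))).+1.
have cn : c / (lam * I / 2) < n%:R.
  apply: lt_trans (archi_boundP _) _; last by rewrite ltr_nat.
  by rewrite divr_ge0// ltW.
have n0 : (0 < n)%N by [].
clearbody n; have nR : 0 < n%:R :> R by rewrite ltr0n.
have := defect_integral_le i0 m1 r_gt0 r0r lam1 bG Lf f0 gG sol n0 e0.
rewrite -/I (_ : 2 * _ * _ * _ = c / n%:R); last by rewrite /c; field; rewrite gt_eqF.
have : c / n%:R < lam * I / 2 by rewrite ltr_pdivrMr// mulrC -ltr_pdivrMr.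
lra.
Qed.

Lemma solution_ge (R : realType) (N : nat) (m r r0 lam G : R)
    (f g u : 'rV[R]_N -> R) :
  (0 < N)%N -> 1 <= m -> 0 < r -> r0 < r -> 1 <= lam -> lam * expR (2 * r) < G ->
  Linfty (lebN R N) (eball 0 r) f ->
  {ae lebN R N, forall x, eball 0 r x -> 0 <= f x} ->
  {ae hausdorff R N N.-1, forall x, boundary (eball 0 r) x -> G <= g x} ->
  is_solution m (eball 0 r) f g u ->
  {ae lebN R N, forall x, enorm x <= r0 -> lam <= u x}.
Proof.
move=> N0 m1 r_gt0 r0r lam1 bG Lf f0 gG sol.
pose i0 := Ordinal N0.
have I0 := defect_integral_eq0 i0 m1 r_gt0 r0r lam1 bG Lf f0 gG sol.
have [[u0 _ _] [mu _] _] := sol.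
have mO : measurable (eball 0 r : set (lebT R N)) by exact/measurable_open/open_eball.
have Ofin : (lebN R N (eball 0 r) < +oo)%E by apply: lebN_eball_lty; exact: ltW.
have Ld : Linfty (lebN R N) (eball 0 r) (defect i0 r r0 lam u).
  by apply: Linfty_defect => //; rewrite (le_trans _ lam1).
have Id := Linfty_integrable mO Ofin Ld.
have {}I0 : (\int[lebN R N]_(x in eball 0 r) `|(defect i0 r r0 lam u x)%:E| = 0)%E.
  under eq_integral do rewrite gee0_abs ?lee_fin ?defect_ge0//.
  by rewrite -[LHS]fineK ?integrable_fin_num// [fine _]I0.
have /(ae_eq_integral_abs _ mO) := I0.
have md : measurable_fun (eball 0 r : set (lebT R N)) (fun x => (defect i0 r r0 lam u x)%:E).
  by apply/measurable_EFinP; case: Ld.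
move=> /(_ md) /lebN_ae_mono; apply => x dx xr0.
have xr : enorm x < r by exact: le_lt_trans xr0 r0r.
have /dx[] : eball 0 r x by rewrite /eball/= subr0.
rewrite /defect indicE mem_set// mul1r => /eqP; rewrite mulf_eq0 => /orP[/eqP ul|].
  by rewrite -subr_le0 -ul le_max lexx.
(* In the open ball the coordinate exceeds [-r], so the ramp is positive and the other factor must
   vanish. *)
rewrite gt_eqF// /ramp expinv_gt0// mulr_gt0 ?invr_gt0 ?mulr_gt0//.
have := le_lt_trans (normr_coord_le_enorm x i0) xr; rewrite ltr_norml.
lra.
Qed.

(** * Pointwise values and conclusion *)

(** For radii below [e] the set where [u < t] is null in the ball, so the quotients are eventually
    equal to 0. *)
Lemma lower_approx_limit_ge (R : realType) (N : nat) (Omega : set 'rV[R]_N)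
    (u : 'rV[R]_N -> R) (x : 'rV[R]_N) (e t : R) :
  0 < e -> {ae lebN R N, forall y, eball x e y -> t <= u y} ->
  (t%:E <= lower_approx_limit Omega u x)%E.
Proof.
move=> e0 [A [mA A0 uA]]; apply: ereal_sup_ubound; exists t => //=.
apply: cvg_near_cst.
near=> rho.
rewrite [X in (_ * X)%E](_ : _ = 0%E) ?mule0//.
apply: le_anti; rewrite (outer_measure_ge0 (lebN_om R N)) andbT -A0.
apply: (le_outer_measure (lebN_om R N)) => y [[_ uy] xy]; apply: uA => /= uA'.
have : t <= u y by apply: uA'; apply: lt_trans xy _; near: rho; exact: nbhs_right_lt.
by rewrite leNgt uy.
Unshelve. all: by end_near. Qed.

Theorem proposition6p2 (R : realType) (N : nat) (m r : R)
    (f : 'rV[R]_N -> R) (g u : R -> 'rV[R]_N -> R)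
    (hN : (1 <= N)%N) (hm : 1 <= m) (hr : 0 < r) (hrN : m = 1 -> N%:R < r)
    (hf : Linfty (lebN R N) (eball 0 r) f)
    (hf0 : {ae lebN R N, forall x, eball 0 r x -> 0 <= f x})
    (hg : forall G, 0 < G ->
      Linfty (hausdorff R N N.-1) (boundary (eball 0 r)) (g G))
    (hgG : forall G, 0 < G ->
      {ae hausdorff R N N.-1, forall x, boundary (eball 0 r) x -> G <= g G x})
    (hu : forall G, 0 < G -> is_solution m (eball 0 r) f (g G) (u G)) :
  forall x, eball 0 r x ->
    lower_approx_limit (eball 0 r) (u G) x @[G --> +oo] --> +oo%E.
Proof.
move=> x; rewrite /eball/= subr0 => xr.
apply/cvgeyPge => A.
(* The maximum provides [lam >= 1]. As [e] is half the distance of [x] to the sphere, the ball of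
   radius [e] about [x] lies in the ball of radius [r - e] about 0. *)
pose lam := Num.max A 1; pose e := (r - enorm x) / 2.
have lam1 : 1 <= lam by rewrite le_max lexx orbT.
near=> G.
have bG : lam * expR (2 * r) < G by near: G; apply: nbhs_pinfty_gt; exact: num_real.
have G0 : 0 < G.
  by apply: lt_trans bG; rewrite mulr_gt0 ?expR_gt0// (lt_le_trans _ lam1).
have er : r - e < r by rewrite ltrBlDr ltrDl divr_gt0// subr_gt0.
have uG := solution_ge hN hm hr er lam1 bG hf hf0 (hgG G G0) (hu G G0).
apply: (@le_trans _ _ lam%:E); first by rewrite lee_fin le_max lexx.
apply: (@lower_approx_limit_ge _ _ _ _ _ e); first by rewrite divr_gt0// subr_gt0.
apply: (lebN_ae_mono uG) => y uy xy; apply: uy.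
have := ler_enormD (y - x) x; rewrite subrK.
move: xy; rewrite /eball/= /e; lra.
Unshelve. all: by end_near. Qed.
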